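(* Let $\mathcal L$ be a compact complex $1$-dimensional transversally $p$-adic laminated space satisfying the properties (i), (ii), (iii) listed in the context. 1) Property (iv) of the context is equivalent to the following condition: every leafwise $C^\infty$ harmonic $1$-form $\omega\in C^0(\mathcal L,\wedge^1T^*\mathcal L)$ satisfies $\Delta_{p,T}\,\omega=0$, where $\Delta_{p,T}$ is the transverse $p$-adic Laplacian. 2) Assume that $\mathcal L$ satisfies properties (i) to (iv). Then the vector space $\mathcal H^1_{\mathcal L}$ of real leafwise harmonic $1$-forms $\omega\in C^0(\mathcal L,\wedge^1T^*\mathcal L)$ is of finite dimension $2g$, where $g\in\mathbb N$.
   Context: Laminated space. Let $p$ be a prime and $q>1$ a power of $p$. A compact complex $1$-dimensional transversally $p$-adic laminated space is a compact topological space $\mathcal L$ for which there are $m\ge 1$ and a finite open cover $\mathcal L=\bigcup_{i=1}^N A_i$ by charts (homeomorphisms) $f_i:A_i\to U_i\times\mathbb Z_p^m$, $U_i$ an open disc of $\mathbb C$, such that $f_j(A_i\cap A_j)=\Omega_{i,j}\times\mathbb Z_p^m$ and $f_i\circ f_j^{-1}(z,\theta)=(H(z),M\theta+B)$ there, with $H$ holomorphic on $\Omega_{i,j}$, $M\in GL_m(\mathbb Z_p)$, $B\in\mathbb Z_p^m$ (depending on $i,j$). The charts are assumed to extend to open sets $A_j'\supset\overline{A_j}$. The path connected components of $\mathcal L$ are $1$-dimensional complex manifolds and are the leaves of a foliation of $\mathcal L$; $T_l\mathcal L$ is the tangent space at $l$ of the leaf through $l$. $\mathrm{Jac}$ of an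 affine map of $\mathbb Q_p^m$ is the factor by which it scales Haar measure. Properties (i)–(iv). (i) The group $q^{\mathbb Z}$ acts on $\mathcal L$ (the action of $q^k$ on $l$ is written $q^k\cdot l$) so that, whenever $y\in A_j$ and $q\cdot y\in A_i$, $f_i\circ q\circ f_j^{-1}(z,\theta)=(Z(z),M_q\theta+b_q)$ on $f_j(q^{-1}(A_i)\cap A_j)$, with $Z$ holomorphic, $b_q\in\mathbb Z_p^m$, $M_q\in M_m(\mathbb Z_p)\cap GL_m(\mathbb Q_p)$ and $\mathrm{Jac}\,M_q=\frac1q$. (ii) There is a smooth leafwise Kähler metric $\widetilde g$ along the leaves of $\mathcal L$ such that $(f_i^{-1})^*\widetilde g$ does not depend on $\theta$ in each chart, and $\widetilde g(q_*u)=q\,\widetilde g(u)$ for all $l\in\mathcal L$, $u\in T_l\mathcal L$ (here $\widetilde g(u)=\widetilde g(u,u)$). (iii) There is a smooth family $(\psi^t_x)_{t\in\mathbb R,x>0}$ of diffeomorphisms of $\mathcal L$ acting leafwise holomorphically: if $y\in A_j$ and $\psi^{t_0}_{x_0}(y)\in A_i$, there is a neighborhood $I_0\times J_0\times B_y\subset\mathbb R\times\mathbb R^{+*}\times(U_j\times\mathbb Z_p^m)$ of $(t_0,x_0,f_j(y))$ on which $f_i\circ\psi^t_x\circ f_j^{-1}(z,\theta)=(R^t_x(z),M_1\theta+b_1)$ with $(R^t_x)$ a smooth family of holomorphic maps, $M_1\in GL_m(\mathbb Z_p)$, $b_1\in\mathbb Z_p^m$. Moreover, for all $t,t'\in\mathbb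 R$, $x>0$, $l\in\mathcal L$: $\psi^t_{qx}(q\cdot l)=q\cdot\psi^t_x(l)$ and $\psi^{t'}_{xe^{-t}}(\psi^t_x(l))=\psi^{t+t'}_x(l)$. Finally, if $k\ge1$ and $l_0\in A_j$ satisfy $(\psi^{\log q}_q\circ q)^k(l_0)=l_0$, then on $U_j'\times\mathbb Z_p^m$, with $U_j'\subset U_j$ an open neighborhood of the first component of $f_j(l_0)$, one can write $f_j\circ(\psi^{\log q}_q\circ q)^k\circ f_j^{-1}(z,\theta)=(Z_k(z),Q_k\theta+b_k)$ with $Z_k$ holomorphic, $b_k\in\mathbb Z_p^m$, $Q_k\in M_m(\mathbb Z_p)$, $\mathrm{Jac}(Q_k)=q^{-k}$ and $\mathrm{Jac}(\mathrm{Id}-Q_k)=1$. (iv) For every leafwise $C^\infty$ harmonic $1$-form $\omega\in C^0(\mathcal L,\wedge^1T^*\mathcal L)$ and every chart $(A_i,f_i)$, $(f_i^{-1})^*\omega(z,\theta)$ does not depend on $\theta$. Harmonic means harmonic along the leaves for the metric $\widetilde g$. Transverse $p$-adic Laplacian. A character $\chi$ of $\mathbb Z_p^m$ is written $\chi=\oplus_{j=1}^m\sum_{l=0}^{n_j}\frac{a_{l,j}}{p^l}$ with $a_{l,j}\in\{0,\dots,p-1\}$ and $a_{n_j,j}\ne0$ if $n_j\ge1$. For $\chi\neq0$ put $|\chi|=\max_{1\le j\le m,\,n_j\ge1}\left|\frac{a_{n_j,j}}{p^{n_j}}\right|_p=\max_j p^{n_j}$, and $|0|=0$. Let $\Delta_p(u)(\theta)=\sum_{\chi\in\widehat{\mathbb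 Z_p^m}}|\chi|^2\,\widehat u(\chi)\langle\chi,-\theta\rangle$, where $\widehat u(\chi)=\int_{\mathbb Z_p^m}u(\xi)\langle\chi,\xi\rangle d\mu_{\mathbb Z_p^m}(\xi)$ with the normalized Haar measure (the series being understood in the distributional sense if it does not converge). The operator $\Delta_{p,T}$ on leafwise differential forms on $\mathcal L$ is defined in each chart $(A_j,f_j)$ by $\Delta_{p,T}(u|_{A_j})=(f_j)^*\Delta_p((f_j^{-1})^*u|_{A_j})$, with $\Delta_p$ acting in the variable $\theta$ on the coefficients; this is independent of the chart. *)

(* Defs.v *)
From HB Require Import structures.
From mathcomp Require Import all_boot all_order all_algebra.
From mathcomp Require Import all_classical all_reals all_analysis.
From mathcomp Require Import complex.

Set Implicit Arguments.
Unset Strict Implicit.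
Unset Printing Implicit Defensive.
Import Order.TTheory GRing.Theory Num.Theory numFieldNormedType.Exports.
Local Open Scope classical_set_scope.
Local Open Scope ring_scope.
Local Open Scope complex_scope.

(* The ring of p-adic integers as the inverse limit of the Z/p^n: an element is
   its sequence of residues [x n] in {0, ..., p^n - 1}, each of them being the
   reduction mod p^n of the next one. *)
Record padic_int (p : nat) (p_pr : prime p) := PadicInt {
  residue :> nat -> nat;
  _ : `[< forall n, residue n = (residue n.+1 %% p ^ n)%N >] }.

HB.instance Definition _ p p_pr := [isSub for @residue p p_pr].
HB.instance Definition _ p p_pr := [Choice of @padic_int p p_pr by <:].

Section PadicRing.
Variables (p : nat) (p_pr : prime p).
Local Notation Zp := (padic_int p_pr).
Implicit Types x y z : Zp.

Lemma residue_compat x n : x n = (x n.+1 %% p ^ n)%N.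
Proof. by case: x => r /= /asboolP. Qed.

Lemma residue_mod x m n : (m <= n)%N -> (x n %% p ^ m)%N = x m.
Proof.
move=> mn; rewrite -(subnK mn); elim: (n - m)%N => [|k IHk].
  by rewrite add0n [x m in LHS]residue_compat modn_mod -residue_compat.
by rewrite -IHk addSn [x (k + m)%N]residue_compat modn_dvdm // dvdn_exp2l // leq_addl.
Qed.

Lemma padic_eq x y : (forall n, x n = y n %[mod p ^ n]) -> x = y.
Proof.
move=> xy; apply: val_inj; apply: funext => n /=.
by have := xy n; rewrite !residue_mod.
Qed.

Fact padic_of_subproof (f : nat -> nat) :
  `[< forall n, f n.+1 = f n %[mod p ^ n] >] ->
  `[< forall n, (f n %% p ^ n = (f n.+1 %% p ^ n.+1) %% p ^ n)%N >].
Proof.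
by move=> /asboolP fE; apply/asboolP => n; rewrite modn_dvdm ?fE// dvdn_exp2l.
Qed.

Definition padic_of f fE : Zp := PadicInt p_pr (@padic_of_subproof f fE).

Fact padic_add_subproof x y :
  `[< forall n, (x n.+1 + y n.+1 = x n + y n %[mod p ^ n])%N >].
Proof. by apply/asboolP => n; rewrite -modnDm -!residue_compat. Qed.
Definition padic_add x y : Zp := padic_of (padic_add_subproof x y).

Fact padic_mul_subproof x y :
  `[< forall n, (x n.+1 * y n.+1 = x n * y n %[mod p ^ n])%N >].
Proof. by apply/asboolP => n; rewrite -modnMm -!residue_compat. Qed.
Definition padic_mul x y : Zp := padic_of (padic_mul_subproof x y).

Let pX_gt0 n : (0 < p ^ n)%N. Proof. by rewrite expn_gt0 prime_gt0. Qed.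

Let residue_lt x n : (x n < p ^ n)%N.
Proof. by rewrite residue_compat ltn_mod. Qed.

Fact padic_opp_subproof x :
  `[< forall n, (p ^ n.+1 - x n.+1 = p ^ n - x n %[mod p ^ n])%N >].
Proof.
apply/asboolP => n; apply/eqP; rewrite -(eqn_modDr (x n.+1)).
rewrite subnK 1?ltnW// -modnDmr -residue_compat subnK 1?ltnW//.
by rewrite modnn expnS modnMl.
Qed.
Definition padic_opp x : Zp := padic_of (padic_opp_subproof x).

Definition padic_nat (a : nat) : Zp :=
  @padic_of (fun=> a) (asboolT (fun=> erefl)).

Let addA : associative padic_add.
Proof.
move=> x y z; apply: padic_eq => n /=.
by rewrite !modn_mod modnDmr modnDml addnA.
Qed.
Let addC : commutative padic_add.
Proof. by move=> x y; apply: padic_eq => n /=; rewrite addnC. Qed.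
Let add0 : left_id (padic_nat 0) padic_add.
Proof. by move=> x; apply: padic_eq => n /=; rewrite !modn_mod mod0n. Qed.
Let addN : left_inverse (padic_nat 0) padic_opp padic_add.
Proof.
move=> x; apply: padic_eq => n /=.
by rewrite !modn_mod modnDml subnK 1?ltnW// modnn mod0n.
Qed.
Let mulA : associative padic_mul.
Proof.
move=> x y z; apply: padic_eq => n /=.
by rewrite !modn_mod modnMmr modnMml mulnA.
Qed.
Let mulC : commutative padic_mul.
Proof. by move=> x y; apply: padic_eq => n /=; rewrite mulnC. Qed.
Let mul1 : left_id (padic_nat 1) padic_mul.
Proof.
by move=> x; apply: padic_eq => n /=; rewrite !modn_mod modnMml mul1n.
Qed.
Let mulDl : left_distributive padic_mul padic_add.
Proof.
move=> x y z; apply: padic_eq => n /=.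
by rewrite !modn_mod modnMml modnDm mulnDl.
Qed.
Let oner_neq0 : padic_nat 1 != padic_nat 0.
Proof.
apply/eqP => /(congr1 (fun x : Zp => x 1%N)) /=.
by rewrite expn1 mod0n modn_small ?prime_gt1.
Qed.

HB.instance Definition _ := GRing.isZmodule.Build Zp addA addC add0 addN.
HB.instance Definition _ := GRing.Zmodule_isComNzRing.Build Zp
  mulA mulC mul1 mulDl oner_neq0.

Lemma residue0 n : (0 : Zp) n = 0%N.
Proof. exact: mod0n. Qed.

Lemma residueM x y n : (x * y) n = (x n * y n %% p ^ n)%N.
Proof. by []. Qed.

Definition padic_unit : {pred Zp} := [pred x | `[< exists y, y * x = 1 >]].
Definition padic_inv x : Zp :=
  if x \in padic_unit then xget 0 [set y | y * x = 1] else x.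

Let mulVx : {in padic_unit, left_inverse 1 padic_inv *%R}.
Proof.
move=> x xU; rewrite /padic_inv xU.
have /asboolP[y yx] : `[< exists y, y * x = 1 >] := xU.
exact: (@xgetPex _ 0 [set y | y * x = 1] (ex_intro _ y yx)).
Qed.
Let unitP x y : y * x = 1 -> x \in padic_unit.
Proof. by move=> yx; apply/asboolP; exists y. Qed.
Let inv_out : {in [predC padic_unit], padic_inv =1 id}.
Proof. by move=> x /negbTE xU; rewrite /padic_inv xU. Qed.

HB.instance Definition _ :=
  GRing.ComNzRing_hasMulInverse.Build Zp mulVx unitP inv_out.

Let integral x y : x * y = 0 -> (x == 0) || (y == 0).
Proof.
have val_gt0 z : z != 0 ->
    exists a, forall n, (a <= n)%N -> (0 < z n)%N /\ (logn p (z n) < a)%N.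
  move=> /eqP z0; have [a za] : exists a, z a <> 0%N.
    apply: contrapT => /forallNP z0'; apply: z0; apply: padic_eq => n.
    have /contrapT zn := z0' n; by rewrite residue0 zn.
  exists a => n an; have zn : (0 < z n)%N.
    by rewrite lt0n; apply/eqP => zn; apply: za; rewrite -(residue_mod z an) zn mod0n.
  split=> //; rewrite ltnNge -(pfactor_dvdn _ p_pr zn).
  by rewrite /dvdn residue_mod//; apply/eqP.
move=> xy0; have [//|/val_gt0[a xa]] := eqVneq x 0.
have [//|/val_gt0[b yb]] := eqVneq y 0.
have [x0 xla] := xa _ (leq_addr b a); have [y0 ylb] := yb _ (leq_addl a b).
have := congr1 (fun z : Zp => z (a + b)%N) xy0.
rewrite residueM residue0 => /eqP; rewrite -/(dvdn _ _) pfactor_dvdn ?muln_gt0 ?x0//.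
by rewrite lognM// leqNgt (leq_trans _ (leq_add (ltnW xla) ylb))// addnS ltnS.
Qed.

HB.instance Definition _ := GRing.ComUnitRing_isIntegral.Build Zp integral.

(* The p-adic topology: the balls x + p^n Z_p. *)
Definition padic_nbhs x : set_system Zp :=
  filter_from setT (fun n => [set y : Zp | y n = x n]).

Let nbhs_filter x : ProperFilter (padic_nbhs x).
Proof.
apply: filter_from_proper; last by move=> n _; exists x.
apply: filter_from_filter; first by exists 0%N.
move=> m n _ _; exists (maxn m n) => // y /= xy.
rewrite -(residue_mod y (leq_maxl m n)) -(residue_mod y (leq_maxr m n)) xy.
by rewrite !residue_mod ?leq_maxl ?leq_maxr.
Qed.
Let nbhs_singleton x A : padic_nbhs x A -> A x.
Proof. by move=> [n _]; exact. Qed.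
Let nbhs_nbhs x A : padic_nbhs x A -> padic_nbhs x (padic_nbhs^~ A).
Proof.
move=> [n _ nA]; exists n => // y /= yx; exists n => // z /= zy.
by apply: nA => /=; rewrite zy.
Qed.

HB.instance Definition _ := hasNbhs.Build Zp padic_nbhs.
HB.instance Definition _ := Nbhs_isNbhsTopological.Build Zp
  nbhs_filter nbhs_singleton nbhs_nbhs.
HB.instance Definition _ := isPointed.Build Zp 0.
End PadicRing.

(* Elements of Z_p^m are column vectors; [R[i]^o] is the complex line with its
   usual topology and its structure of normed space over itself. *)
Notation zpm p_pr m := 'cV[padic_int p_pr]_m.
Notation cline R := ((R[i])^o).

Section Haar.
Variables (R : realType) (p : nat) (p_pr : prime p) (m : nat).

Definition borel_zpm := g_sigma_algebraType (@open (zpm p_pr m)).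

Variable mu : probability borel_zpm R.

(* As [mu] is a probability, this says that [mu] is the normalized Haar measure. *)
Definition is_haar := forall (b : zpm p_pr m) (E : set borel_zpm),
  measurable E -> mu ((fun theta : zpm p_pr m => theta + b) @` E) = mu E.

(* [Jac M = c], for an endomorphism M of Q_p^m that preserves Z_p^m: the Haar
   measure of Q_p^m is tested on the Borel subsets of Z_p^m. *)
Definition has_jac (M : 'M[padic_int p_pr]_m) (c : R) :=
  forall E : set borel_zpm, measurable E ->
    mu ((fun theta : zpm p_pr m => M *m theta) @` E) = (c%:E * mu E)%E.

Definition integralC (u : zpm p_pr m -> R[i]) : R[i] :=
  Rintegral mu setT (fun xi => complex.Re (u xi)) +i*
  Rintegral mu setT (fun xi => complex.Im (u xi)).

(* A coordinate a_1/p + ... + a_n/p^n of a character, with a_n != 0 if n >= 1,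
   is the sequence [:: a_1; ...; a_n]. The digit a_0 is left out: its
   contribution is an integer, which pairs trivially with Z_p. *)
Definition char_coord := {s : seq 'I_p | last 1%N (map val s) != 0%N}.
Definition zpm_dual := {ffun 'I_m -> char_coord}.

Definition char_depth (chi : zpm_dual) (j : 'I_m) : nat := size (val (chi j)).

Definition char_value (chi : zpm_dual) (j : 'I_m) : R :=
  \sum_(l < char_depth chi j)
     (nth 0%N (map val (val (chi j))) l)%:R / p%:R ^+ l.+1.

(* |a_n / p^n|_p = p^n as a_n is prime to p. *)
Definition char_norm (chi : zpm_dual) : nat :=
  \max_(j < m | (0 < char_depth chi j)%N) p ^ char_depth chi j.

(* <chi, xi> = exp (2 i pi chi xi); as p^n chi is an integer, chi xi only depends
   modulo 1 on the residue of xi modulo p^n. *)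
Definition pairing (chi : zpm_dual) (xi : zpm p_pr m) : R[i] :=
  let t : R := 2 * pi *
    \sum_j char_value chi j * (xi j ord0 (char_depth chi j))%:R in
  cos t +i* sin t.

Definition fourier (u : zpm p_pr m -> R[i]) (chi : zpm_dual) : R[i] :=
  integralC (fun xi => u xi * pairing chi xi).

Definition locally_constant (phi : zpm p_pr m -> R[i]) :=
  forall theta, \forall theta' \near theta, phi theta' = phi theta.

(* The distribution Delta_p u on Z_p^m: its series is paired termwise with a
   test function phi. For phi locally constant, only finitely many of the
   integrals of <chi, - theta> phi(theta) are nonzero. *)
Definition padic_laplacian (u phi : zpm p_pr m -> R[i]) : R[i] :=
  \sum_(chi \in [set: zpm_dual])
    ((char_norm chi)%:R ^+ 2 * fourier u chi *
     integralC (fun theta => pairing chi (- theta) * phi theta)).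

End Haar.

Section PlaneCalculus.
Variable R : realType.
Local Notation C := (cline R).

Definition holomorphic_on (O : set C) (f : C -> C) :=
  forall z, O z -> derivable f z 1.

Fixpoint Ck_on (V : normedModType R) (k : nat) (D : set V) (f : V -> R) : Prop :=
  (forall x, D x -> {for x, continuous f}) /\
  if k is k'.+1 then
    forall v, (forall x, D x -> derivable f x v) /\ Ck_on k' D ('D_v f)
  else True.

(* For D open. *)
Definition smooth_on (V : normedModType R) (D : set V) (f : V -> R) :=
  forall k, Ck_on k D f.

(* Smoothness and partial derivatives with respect to z = x + i y are those of
   functions of (x, y) in the plane R * R. *)
Definition cplx (a : R * R) : C := a.1 +i* a.2.

Definition smooth_onC (O : set C) (f : C -> C) :=
  smooth_on (cplx @^-1` O) (fun a => complex.Re (f (cplx a))) /\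
  smooth_on (cplx @^-1` O) (fun a => complex.Im (f (cplx a))).

Definition partial (v : R * R) (f : C -> C) (z : C) : C :=
  'D_v (fun a => complex.Re (f (cplx a))) (complex.Re z, complex.Im z) +i*
  'D_v (fun a => complex.Im (f (cplx a))) (complex.Re z, complex.Im z).

Definition dX := partial (1, 0).
Definition dY := partial (0, 1).

(* Exterior calculus on the plane with the metric lambda (dx^2 + dy^2). The
   1-form a dx + b dy is given by z |-> (a z, b z) and the 2-form h dx /\ dy by h;
   * dx = dy, * dy = - dx, * (dx /\ dy) = 1 / lambda, and delta = - * d *. *)
Definition ext_d0 (f : C -> C) (z : C) : C * C := (dX f z, dY f z).
Definition ext_d1 (w : C -> C * C) (z : C) : C :=
  dX (fun z => (w z).2) z - dY (fun z => (w z).1) z.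
Definition star1 (w : C -> C * C) (z : C) : C * C := (- (w z).2, (w z).1).
Definition star2 (lambda : C -> R) (h : C -> C) (z : C) : C :=
  h z / (lambda z)%:C.
Definition codiff1 (lambda : C -> R) (w : C -> C * C) (z : C) : C :=
  - star2 lambda (ext_d1 (star1 w)) z.
Definition codiff2 (lambda : C -> R) (h : C -> C) (z : C) : C * C :=
  - star1 (ext_d0 (star2 lambda h)) z.

Definition hodge_laplacian (lambda : C -> R) (w : C -> C * C) (z : C) : C * C :=
  ext_d0 (codiff1 lambda w) z + codiff2 lambda (ext_d1 w) z.

Definition coveval (w : C * C) (v : C) : C :=
  (complex.Re v)%:C * w.1 + (complex.Im v)%:C * w.2.

Definition hermitian_metric (h : C -> C -> R) :=
  [/\ forall u v, h u v = h v u,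
      forall (a : R) u u' v, h (a%:C * u + u') v = a * h u v + h u' v,
      forall u v, h ((0 +i* 1) * u) ((0 +i* 1) * v) = h u v &
      forall u, u != 0 -> 0 < h u u].

End PlaneCalculus.

Section Lamination.
Variables (R : realType) (p : nat) (p_pr : prime p) (m : nat).
Variable L : topologicalType.
Local Notation C := (cline R).
Local Notation Zpm := (zpm p_pr m).

(* A chart from [cdom] onto (open disc) x Z_p^m. The maps [cmap] and [cinv] are
   only meaningful on [cdom] and [ccodom]. *)
Record lchart := LChart {
  cdom : set L;
  ccenter : C;
  cradius : R;
  cmap : L -> C * Zpm;
  cinv : C * Zpm -> L }.

Definition cdisc (c : lchart) : set C :=
  [set z | `|z - ccenter c| < (cradius c)%:C].

Definition ccodom (c : lchart) : set (C * Zpm) := cdisc c `*` setT.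

Definition is_lchart (c : lchart) :=
  [/\ open (cdom c) /\ 0 < cradius c,
      forall l, cdom c l -> ccodom c (cmap c l) /\ cinv c (cmap c l) = l,
      forall x, ccodom c x -> cdom c (cinv c x) /\ cmap c (cinv c x) = x,
      forall l, cdom c l -> {for l, continuous (cmap c)} &
      forall x, ccodom c x -> {for x, continuous (cinv c)}].

Definition compatible (c d : lchart) :=
  exists (O : set C) (H : C -> C) (M : 'M[padic_int p_pr]_m) (B : Zpm),
    [/\ open O /\ cmap d @` (cdom c `&` cdom d) = O `*` setT,
        holomorphic_on O H,
        M \in unitmx &
        forall z theta, O z ->
          cmap c (cinv d (z, theta)) = (H z, M *m theta + B)].

Variable N : nat.

Definition is_atlas (A : 'I_N -> lchart) :=
  [/\ forall j, is_lchart (A j),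
      \bigcup_j cdom (A j) = [set: L] &
      forall i j, compatible (A i) (A j)].

Definition laminated (A : 'I_N -> lchart) :=
  [/\ compact [set: L],
      is_atlas A &
      exists A' : 'I_N -> lchart, is_atlas A' /\
        forall j, closure (cdom (A j)) `<=` cdom (A' j) /\
                  {in cdom (A j), cmap (A' j) =1 cmap (A j)}].

Variable A : 'I_N -> lchart.

(* Derivative at l, in the charts j (source) and i (target), of the restriction
   of phi to the leaf through l. A tangent vector to the leaf at l is given in
   the chart j by a complex number u, and its image by phi is given in the chart
   i by [leaf_deriv i j phi l * u]; for phi = id this is a change of charts. *)
Definition leaf_deriv (i j : 'I_N) (phi : L -> L) (l : L) : C :=
  derive1 (fun z : C =>
    (cmap (A i) (phi (cinv (A j) (z, (cmap (A j) l).2)))).1 : C)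
    (cmap (A j) l).1.

(* Tensors along the leaves are given by their expressions on the images of the
   charts; values outside of these images are irrelevant. *)
Definition metric_family := 'I_N -> C * Zpm -> C -> C -> R.
Definition form_family := 'I_N -> C * Zpm -> C * C.

(* In complex dimension one, the fundamental form of a Hermitian metric is of top
   degree, so that a Hermitian metric is always Kaehler. *)
Definition leafwise_kahler (g : metric_family) :=
  [/\ forall i x, ccodom (A i) x -> hermitian_metric (g i x),
      forall i j l u v, cdom (A i) l -> cdom (A j) l ->
        g j (cmap (A j) l) u v =
        g i (cmap (A i) l) (leaf_deriv i j id l * u) (leaf_deriv i j id l * v) &
      forall i theta u v,
        smooth_on (@cplx R @^-1` cdisc (A i))
          (fun a => g i (cplx a, theta) u v)].

Definition leafwise_form (w : form_family) :=
  forall i j l v, cdom (A i) l -> cdom (A j) l ->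
    coveval (w j (cmap (A j) l)) v =
    coveval (w i (cmap (A i) l)) (leaf_deriv i j id l * v).

Definition continuous_form (w : form_family) :=
  forall i x, ccodom (A i) x -> {for x, continuous (w i)}.

Definition leafwise_smooth (w : form_family) :=
  forall i theta, smooth_onC (cdisc (A i)) (fun z => (w i (z, theta)).1) /\
                  smooth_onC (cdisc (A i)) (fun z => (w i (z, theta)).2).

Definition leafwise_harmonic (g : metric_family) (w : form_family) :=
  forall i z theta, cdisc (A i) z ->
    hodge_laplacian (fun z => g i (z, theta) 1 1)
                    (fun z => w i (z, theta)) z = 0.

Definition harmonic_1form (g : metric_family) (w : form_family) :=
  [/\ leafwise_form w, continuous_form w, leafwise_smooth w &
      leafwise_harmonic g w].

Definition real_form (w : form_family) :=
  forall i x, ccodom (A i) x ->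
    complex.Im (w i x).1 = 0 /\ complex.Im (w i x).2 = 0.

Definition real_harmonic_1form (g : metric_family) (w : form_family) :=
  harmonic_1form g w /\ real_form w.

(* [e] is a real basis of H: uniqueness for w = 0 is the linear independence, and
   the converse implication says that H contains all the combinations. *)
Definition has_real_dim (H : form_family -> Prop) (n : nat) :=
  exists e : 'I_n -> form_family,
    (forall k, H (e k)) /\
    forall w, H w <->
      exists! c : 'rV[R]_n, forall i x, ccodom (A i) x ->
        w i x = \sum_k (c ord0 k)%:C *: e k i x.

Definition theta_independent (T : Type) (i : 'I_N) (f : C * Zpm -> T) :=
  forall z theta theta', cdisc (A i) z -> f (z, theta) = f (z, theta').

Variables (mu : probability (borel_zpm p_pr m) R) (q : nat).
Variables (act : int -> L -> L) (g : metric_family) (psi : R -> R -> L -> L).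

(* [act k] is the action of q^k. Q_p is the fraction field of Z_p. *)
Definition property_i :=
  [/\ forall l, act 0 l = l,
      forall k k' l, act (k + k') l = act k (act k' l),
      forall k, continuous (act k) &
      forall i j y, cdom (A j) y -> cdom (A i) (act 1 y) ->
        let W := cmap (A j) @` (act 1 @^-1` cdom (A i) `&` cdom (A j)) in
        exists (Z : C -> C) (M : 'M[padic_int p_pr]_m) (b : Zpm),
          [/\ holomorphic_on (fst @` W) Z,
              map_mx (@tofrac _) M \in unitmx,
              has_jac mu M q%:R^-1 &
              forall z theta, W (z, theta) ->
                cmap (A i) (act 1 (cinv (A j) (z, theta))) =
                (Z z, M *m theta + b)]].

Definition property_ii :=
  [/\ leafwise_kahler g,
      forall i, theta_independent i (g i) &
      forall i j l u, cdom (A j) l -> cdom (A i) (act 1 l) ->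
        let u' := leaf_deriv i j (act 1) l * u in
        g i (cmap (A i) (act 1 l)) u' u' = q%:R * g j (cmap (A j) l) u u].

Definition flow_local_form :=
  forall i j y t0 x0, 0 < x0 -> cdom (A j) y -> cdom (A i) (psi t0 x0 y) ->
    exists (I0 J0 : set R) (B : set (C * Zpm))
           (Rf : R -> R -> C -> C) (M : 'M[padic_int p_pr]_m) (b : Zpm),
      [/\ [/\ open I0, I0 t0, open J0, J0 x0 & J0 `<=` [set x | 0 < x]],
          [/\ open B, B (cmap (A j) y) & B `<=` ccodom (A j)],
          let D := [set a : R * R * (R * R) |
                     [/\ I0 a.1.1, J0 a.1.2 & (fst @` B) (cplx a.2)]] in
          smooth_on D (fun a => complex.Re (Rf a.1.1 a.1.2 (cplx a.2))) /\
          smooth_on D (fun a => complex.Im (Rf a.1.1 a.1.2 (cplx a.2))),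
          forall t x, I0 t -> J0 x -> holomorphic_on (fst @` B) (Rf t x) &
          M \in unitmx /\
          forall t x z theta, I0 t -> J0 x -> B (z, theta) ->
            let l := psi t x (cinv (A j) (z, theta)) in
            cdom (A i) l /\ cmap (A i) l = (Rf t x z, M *m theta + b)].

Definition flow_return_form :=
  let ret l := psi (ln q%:R) q%:R (act 1 l) in
  forall (k : nat) j l0, (0 < k)%N -> cdom (A j) l0 -> iter k ret l0 = l0 ->
    exists (U' : set C) (Z : C -> C) (Q : 'M[padic_int p_pr]_m) (b : Zpm),
      [/\ [/\ open U', U' `<=` cdisc (A j) & U' (cmap (A j) l0).1],
          holomorphic_on U' Z,
          has_jac mu Q (q%:R ^- k),
          has_jac mu (1%:M - Q) 1 &
          forall z theta, U' z ->
            let l := iter k ret (cinv (A j) (z, theta)) in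
            cdom (A j) l /\ cmap (A j) l = (Z z, Q *m theta + b)].

(* The inverse of [psi t x] is necessarily [psi (- t) (x * expR (- t))], 
   so that it is smooth as well. *)
Definition property_iii :=
  [/\ forall t x, 0 < x -> bijective (psi t x),
      flow_local_form,
      forall t x l, 0 < x -> psi t (q%:R * x) (act 1 l) = act 1 (psi t x l),
      forall t t' x l, 0 < x ->
        psi t' (x * expR (- t)) (psi t x l) = psi (t + t') x l &
      flow_return_form].

Definition property_iv :=
  forall w, harmonic_1form g w -> forall i, theta_independent i (w i).

(* Delta_{p,T} w is the leafwise 1-form whose coefficients in the chart i are, at
   a given z, distributions in theta. *)
Definition transverse_laplacian (w : form_family) (i : 'I_N) (z : C) :
    ((Zpm -> R[i]) -> R[i]) * ((Zpm -> R[i]) -> R[i]) :=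
  (padic_laplacian mu (fun theta => (w i (z, theta)).1),
   padic_laplacian mu (fun theta => (w i (z, theta)).2)).

Definition transverse_laplacian_eq0 (w : form_family) :=
  forall i z, cdisc (A i) z -> forall phi, locally_constant phi ->
    (transverse_laplacian w i z).1 phi = 0 /\
    (transverse_laplacian w i z).2 phi = 0.

End Lamination.

(* Main.v *)
(* Fourier analysis on Z_p^m gives the first assertion: if all the Fourier
   coefficients of a continuous function at the nontrivial characters vanish, then,
   the indicator of a coset of p^n Z_p^m being a finite combination of characters,
   the averages of the function over all these cosets are equal, and the function
   is constant. This is applied to the coefficients of the form at a given z.

   For the second one, let w = a dx + b dy be a real harmonic 1-form; it does
   not depend on theta, nor does the metric lambda |dz|^2. Then G = delta w - i
   (star d w) is holomorphic in z and does not depend on the chart; if it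
   vanishes, phi = a - i b is holomorphic too, and |phi|^2 / lambda does not
   depend on the chart. The maximum principle applied to the quotient of (phi -
   phi(z))^2 by the coordinate centered at z bounds |phi - phi(z)|^2 linearly in
   the distance to z; as L is compact, a function phi of this kind that vanishes
   on a fine enough finite net is 0: at a point where |phi|^2 / lambda is almost
   maximal it would be too small. So the values of G and w on a finite set of
   points determine w, which bounds the dimension. It is even because the Hodge
   star acts on the space of these forms with square - 1.

   Holomorphy here is mere complex differentiability; the consequences that usually
   follow from the Cauchy formula (Cauchy-Riemann equations for the derivative,
   invariance of G under the changes of charts) are obtained from an estimate
   of the increment of a function around small circles. *)
Require Import Defs.
From mathcomp Require Import all_boot all_order all_algebra.
From mathcomp Require Import all_classical all_reals all_analysis.
From mathcomp Require Import complex ring lra.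
Set Implicit Arguments.
Unset Strict Implicit.
Unset Printing Implicit Defensive.
Import Order.TTheory GRing.Theory Num.Theory numFieldNormedType.Exports.
Local Open Scope classical_set_scope.
Local Open Scope ring_scope.
Local Open Scope complex_scope.

(** The leaves may be noncompact, so that closedness and coclosedness of a harmonic form cannot be
    read off from an integration by parts over a leaf. Hence [curvature], which packs delta w and
    star d w, is kept as a second unknown with a net and a weight of its own, and is eliminated
    before [form10] becomes holomorphic. Property (iv) turns all these objects into functions on
    finitely many discs, read at theta = 0. One complex derivative is not known here to entail a
    second one. So [holomorphic2] records two derivatives, obtained for the concrete functions from
    their real smoothness, whereas a transition map H comes with its first derivative D alone. The
    relation phi' = (phi o H) D between the coefficients of a form in two charts cannot be
    differentiated then; the law for the zbar-derivatives is extracted from increments around small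
    circles, with a mere bound on D. The estimate of |phi - phi(z)|^2 is used in an iterative way:
    on a net of the right mesh, it halves any bound on |phi|^2 / lambda. *)

Notation cabs := Normc.normc.

(** * Complex derivatives *)

Section ComplexModulus.
Variable R : realType.
Implicit Types (x y z : R[i]) (a b r e : R).

Lemma cabsE z : `|z| = (cabs z)%:C.
Proof. by case: z => a b. Qed.

Lemma cabs_ge0 z : 0 <= cabs z.
Proof. by case: z => a b; exact: sqrtr_ge0. Qed.

Lemma cabs_eq0 z : (cabs z == 0) = (z == 0).
Proof.
apply/eqP/eqP => [|->]; first exact: Normc.eq0_normc.
exact: Normc.normc0.
Qed.

Lemma cabs_gt0 z : (0 < cabs z) = (z != 0).
Proof. by rewrite lt_def cabs_eq0 cabs_ge0 andbT. Qed.

Lemma cabsD x y : cabs (x + y) <= cabs x + cabs y.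
Proof. exact: le_normcD. Qed.

Lemma cabsN x : cabs (- x) = cabs x.
Proof. exact: normcN. Qed.

Lemma cabsB x y : cabs (x - y) <= cabs x + cabs y.
Proof. by rewrite -(cabsN y) cabsD. Qed.

Lemma cabs_sub x y : cabs x - cabs y <= cabs (x - y).
Proof. by rewrite lerBlDr -{1}(subrK y x) cabsD. Qed.

Lemma cabsM x y : cabs (x * y) = cabs x * cabs y.
Proof. exact: Normc.normcM. Qed.

Lemma cabsX x n : cabs (x ^+ n) = cabs x ^+ n.
Proof.
elim: n => [|n IHn]; first by rewrite !expr0 Normc.normc1.
by rewrite !exprS cabsM IHn.
Qed.

Lemma cabsV x : cabs x^-1 = (cabs x)^-1.
Proof. exact: Normc.normcV. Qed.

Lemma cabs0 : cabs (0 : R[i]) = 0.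
Proof. exact: Normc.normc0. Qed.

Lemma cabs_real a : cabs a%:C = `|a|.
Proof. by rewrite /= expr0n /= addr0 sqrtr_sqr. Qed.

Lemma cabs_i : cabs ('i : R[i]) = 1.
Proof. by rewrite /= expr0n /= add0r expr1n sqrtr1. Qed.

Lemma cabs_conj z : cabs z^*%C = cabs z.
Proof. by case: z => a b /=; rewrite sqrrN. Qed.

Lemma sqr_cabs z : cabs z ^+ 2 = complex.Re z ^+ 2 + complex.Im z ^+ 2.
Proof. by case: z => a b; rewrite /= sqr_sqrtr// addr_ge0 ?sqr_ge0. Qed.

Lemma mulcJ z : z * z^*%C = (cabs z ^+ 2)%:C.
Proof.
rewrite sqr_cabs; case: z => a b; simpc; rewrite !expr2.
by congr (_ +i* _); ring.
Qed.

Lemma Re_le_cabs z : `|complex.Re z| <= cabs z.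
Proof.
rewrite -(@ler_pXn2r _ 2) ?nnegrE ?normr_ge0 ?cabs_ge0// sqr_cabs.
by rewrite real_normK ?num_real// lerDl sqr_ge0.
Qed.

Lemma Im_le_cabs z : `|complex.Im z| <= cabs z.
Proof.
rewrite -(@ler_pXn2r _ 2) ?nnegrE ?normr_ge0 ?cabs_ge0// sqr_cabs.
by rewrite real_normK ?num_real// lerDr sqr_ge0.
Qed.

Lemma cabs_le_ReIm z : cabs z <= `|complex.Re z| + `|complex.Im z|.
Proof.
have -> : z = (complex.Re z)%:C + 'i * (complex.Im z)%:C by exact: complexE.
by rewrite (le_trans (cabsD _ _))// cabsM cabs_i mul1r !cabs_real
  -complexE lexx.
Qed.

End ComplexModulus.

Section ComplexDerivative.
Variable R : realType.
Local Notation C := (cline R).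
Implicit Types (f : C -> C) (y : R -> C) (z d : C) (t : R).

(** Balls of [cline R] have radii in R[i], where 0 < e forces Im e = 0; the radius can thus be taken
    in R, as in all the estimates below. *)
Lemma cline_nbhsP (z : C) (P : set C) :
  nbhs z P <-> exists2 r : R, 0 < r & forall h : C, cabs h < r -> P (z + h).
Proof.
rewrite -nbhs_ballE; split => [[e /= e0 eP]|[r r0 rP]].
  have [Ime Ree] : complex.Im e = 0 /\ 0 < complex.Re e.
    by move: e0; rewrite ltcE/= => /andP[/eqP].
  exists (complex.Re e) => // h hr; apply: eP.
  rewrite /ball /= opprD addNKr normrN cabsE ltcE /= Ime eqxx /=.
  by move: hr; case: (h).
exists r%:C; first by rewrite /= ltcR.
move=> y; rewrite /ball /= distrC cabsE ltcR => yr.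
by have := rP _ yr; rewrite addrC subrK.
Qed.

Lemma is_cderiveP f z d : is_derive z 1 f d <->
  forall e : R, 0 < e -> exists2 r : R, 0 < r &
    forall h : C, cabs h < r -> cabs (f (z + h) - f z - d * h) <= e * cabs h.
Proof.
split=> [[fz <-] e e0|H].
  have := fz; rewrite /derivable => /cvg_ex[/= l fl].
  have -> : 'D_1 f z = l by apply: cvg_lim.
  move/cvgrPdist_le : fl => /(_ e%:C); rewrite ltcR => /(_ e0).
  rewrite near_withinE => /cline_nbhsP[r r0 rP]; exists r => // h hr.
  have [->|h0] := eqVneq h 0.
    by rewrite addr0 subrr mulr0 subr0 cabs0 mulr0.
  have := rP h hr; rewrite add0r => /(_ h0).
  rewrite /GRing.scale /= mulr1 [h + z]addrC cabsE lecR => H.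
  have -> : f (z + h) - f z - l * h = - ((l - h^-1 * (f (z + h) - f z)) * h).
    by field.
  by rewrite cabsN cabsM ler_wpM2r// cabs_ge0.
have fl : (fun h : C => h^-1 *: (f (h *: (1 : C) + z) - f z)) @ 0^' --> d.
  apply/cvgrPdist_le => e e0.
  have [Ime Ree] : complex.Im e = 0 /\ 0 < complex.Re e.
    by move: e0; rewrite ltcE/= => /andP[/eqP].
  have -> : e = (complex.Re e)%:C by case: (e) Ime => a b /= ->.
  have [r r0 rP] := H _ Ree.
  rewrite near_withinE; apply/cline_nbhsP; exists r => // h hr h0.
  rewrite add0r in h0 *.
  rewrite /GRing.scale /= mulr1 [h + z]addrC cabsE lecR.
  have -> : d - h^-1 * (f (z + h) - f z) = - ((f (z + h) - f z - d * h) / h).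
    by field.
  by rewrite cabsN cabsM cabsV ler_pdivrMr ?cabs_gt0// rP.
by split; [apply/cvg_ex; exists d | apply: cvg_lim].
Qed.

Lemma is_cderiveV f z d : is_derive z 1 f d -> f z != 0 ->
  is_derive z 1 (fun w : C => (f w)^-1 : C) (- d / f z ^+ 2).
Proof.
move=> [fz <-] fz0; split; first exact: derivableV.
by rewrite deriveV// /GRing.scale /= !mulNr mulrC.
Qed.

(** [cline R] is a normed space over R[i], so [is_derive] does not fit a path from R to it; the
    derivative is encoded by its first order expansion. *)
Definition is_pderive y t d := forall e : R, 0 < e -> exists2 r : R, 0 < r &
  forall s : R, `|s| < r -> cabs (y (t + s) - y t - s%:C * d) <= e * `|s|.

Lemma is_pderive_comp f y t a d :
  is_derive (y t) 1 f d -> is_pderive y t a -> is_pderive (f \o y) t (a * d).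
Proof.
move=> /is_cderiveP fd ya e e0.
(* The constant 1 + |a| + |d| serves twice: times |s| it bounds the increment h of y, and it absorbs
   the factor |d| of the second error term. *)
have K0 : 0 < 1 + cabs a + cabs d by rewrite -addrA ltr_wpDr ?addr_ge0 ?cabs_ge0.
have [r1 r10 P1] := fd (e / 2 / (1 + cabs a + cabs d)) ltac:(by rewrite !divr_gt0).
have e1 : 0 < Num.min 1 (e / 2 / (1 + cabs a + cabs d)).
  by rewrite lt_min ltr01 !divr_gt0.
have [r2 r20 P2] := ya _ e1.
exists (Num.min r2 (r1 / (1 + cabs a + cabs d))).
  by rewrite lt_min r20 divr_gt0.
move=> s; rewrite lt_min ltr_pdivlMr// => /andP[sr2 sr1] /=.
set h := y (t + s) - y t.
have hs : cabs (h - s%:C * a) <= Num.min 1 (e / 2 / (1 + cabs a + cabs d)) * `|s|.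
  exact: P2.
have hle : cabs h <= (1 + cabs a + cabs d) * `|s|.
  have -> : h = (h - s%:C * a) + s%:C * a by rewrite subrK.
  apply: le_trans (cabsD _ _) _; rewrite [cabs (_ * _)]cabsM cabs_real.
  have m1 : Num.min 1 (e / 2 / (1 + cabs a + cabs d)) <= 1 by rewrite ge_min lexx.
  have := ler_wpM2r (normr_ge0 s) m1; have := cabs_ge0 d.
  have := normr_ge0 s => H1 H2 H3.
  have := mulr_ge0 H1 H2; nra.
have hr1 : cabs h < r1 by rewrite (le_lt_trans hle)// mulrC.
have -> : y (t + s) = y t + h by rewrite /h [RHS]addrC subrK.
have -> : f (y t + h) - f (y t) - s%:C * (a * d) =
    (f (y t + h) - f (y t) - d * h) + d * (h - s%:C * a) by ring.
apply: le_trans (cabsD _ _) _; rewrite [cabs (_ * _)]cabsM.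
have H1 := P1 h hr1.
have m2 : Num.min 1 (e / 2 / (1 + cabs a + cabs d)) <=
    e / 2 / (1 + cabs a + cabs d) by rewrite ge_min lexx orbT.
have H2 := le_trans hs (ler_wpM2r (normr_ge0 s) m2).
set K := 1 + cabs a + cabs d in K0 hle H1 H2 *.
have H3 : e / 2 / K * cabs h <= e / 2 * `|s|.
  rewrite mulrAC ler_pdivrMr// -[leRHS]mulrA ler_wpM2l ?divr_ge0 ?(ltW e0)//.
  by rewrite mulrC.
have H4 : cabs d * cabs (h - s%:C * a) <= e / 2 * `|s|.
  apply: le_trans (ler_wpM2l (cabs_ge0 d) H2) _.
  have dK : cabs d / K <= 1.
    by rewrite ler_pdivrMr// mul1r /K lerDr addr_ge0 ?cabs_ge0.
  have -> : cabs d * (e / 2 / K * `|s|) = cabs d / K * (e / 2 * `|s|) by ring.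
  by rewrite ler_piMl ?mulr_ge0 ?divr_ge0 ?(ltW e0).
by have := le_trans H1 H3; lra.
Qed.

Lemma is_pderive_Re y t (u d : C) : is_pderive y t d ->
  is_derive t 1 (fun s => complex.Re (u * y s)) (complex.Re (u * d)).
Proof.
move=> yd.
have fl : (fun h : R => h^-1 *: (complex.Re (u * y (h *: (1 : R) + t)) -
    complex.Re (u * y t))) @ 0^' --> complex.Re (u * d).
  apply/cvgrPdist_le => e e0.
  have K0 : 0 < 1 + cabs u by rewrite ltr_wpDr ?cabs_ge0.
  have [r r0 rP] := yd (e / (1 + cabs u)) ltac:(by rewrite divr_gt0).
  rewrite near_withinE; exists r => //= h; rewrite /ball /= sub0r normrN => hr h0.
  rewrite /GRing.scale /= mulr1 [h + t]addrC.
  have -> : complex.Re (u * d) -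
      h^-1 * (complex.Re (u * y (t + h)) - complex.Re (u * y t)) =
      - complex.Re (u * (y (t + h) - y t - h%:C * d)) / h.
    case: (u) (d) (y (t + h)) (y t) => [u1 u2] [d1 d2] [a1 a2] [b1 b2] /=.
    by field.
  rewrite normrM normrN normfV ler_pdivrMr ?normr_gt0//.
  apply: le_trans (Re_le_cabs _) _; rewrite cabsM.
  apply: le_trans (ler_wpM2l (cabs_ge0 u) (rP h hr)) _.
  rewrite mulrA ler_wpM2r ?normr_ge0// mulrA ler_pdivrMr//.
  rewrite mulrC ler_wpM2l ?(ltW e0)//.
  by rewrite lerDr.
split; first by apply/cvg_ex; exists (complex.Re (u * d)).
by apply: cvg_lim.
Qed.

(** The mean value theorem fails for complex values. It is applied to Re (v^* y), the component of y
    along the very error v to be bounded, and gives |v|^2 <= |v| K (b - a). *)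
Lemma mean_value_ineq y (dy : R -> C) (c : C) (a b K : R) : a <= b ->
  (forall t, a <= t <= b -> is_pderive y t (dy t)) ->
  (forall t, a <= t <= b -> cabs (dy t - c) <= K) ->
  cabs (y b - y a - (b - a)%:C * c) <= K * (b - a).
Proof.
move=> ab yd dyK; set v := y b - y a - _.
have [->|v0] := eqVneq v 0.
  rewrite cabs0 mulr_ge0 ?subr_ge0//.
  by rewrite (le_trans (cabs_ge0 _) (dyK a _))// lexx ab.
pose F t := complex.Re (v^*%C * y t).
have Fd t : a <= t <= b -> is_derive t 1 F (complex.Re (v^*%C * dy t)).
  by move=> tab; apply: is_pderive_Re; exact: yd.
have Fc : {within `[a, b], continuous F}.
  apply: derivable_within_continuous => t; rewrite in_itv /= => tab.
  by have [] := Fd t tab.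
have Fd' t : t \in `]a, b[%R -> is_derive t 1 F (complex.Re (v^*%C * dy t)).
  by rewrite in_itv /= => /andP[at_ tb]; apply: Fd; rewrite !ltW.
have [t tab Ft] := MVT_segment ab Fd' Fc.
rewrite in_itv /= in tab.
have : cabs v ^+ 2 = complex.Re (v^*%C * (dy t - c)) * (b - a).
  have -> : cabs v ^+ 2 = complex.Re (v^*%C * v) by rewrite mulrC mulcJ.
  have E (w u1 u2 u3 : R[i]) (r : R) : complex.Re (w * (u1 - u2 - r%:C * u3)) =
      complex.Re (w * u1) - complex.Re (w * u2) - r * complex.Re (w * u3).
    by case: w u1 u2 u3 => [? ?] [? ?] [? ?] [? ?] /=; ring.
  rewrite {2}/v E -[complex.Re (_ * y b) - _]/(F b - F a).
  rewrite Ft; have E' (w u1 u2 : R[i]) :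
      complex.Re (w * (u1 - u2)) = complex.Re (w * u1) - complex.Re (w * u2).
    by case: w u1 u2 => [? ?] [? ?] [? ?] /=; ring.
  by rewrite E'; ring.
have := Re_le_cabs (v^*%C * (dy t - c)); rewrite cabsM cabs_conj => H1 H2.
have H3 := dyK t tab; have v0' : 0 < cabs v by rewrite cabs_gt0.
rewrite -(ler_pM2l v0') -expr2 H2 mulrA ler_wpM2r ?subr_ge0//.
by rewrite (le_trans (ler_norm _))// (le_trans H1)// ler_wpM2l// ltW.
Qed.

Lemma is_pderive_segment (z h : C) t :
  is_pderive (fun s => z + s%:C * h : C) t h.
Proof.
move=> e e0; exists 1 => // s _.
have -> : z + (t + s)%:C * h - (z + t%:C * h) - s%:C * h = 0.
  by rewrite rmorphD /=; ring.
by rewrite cabs0 mulr_ge0 ?normr_ge0 ?(ltW e0).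
Qed.

Lemma cderive_mean_value_ineq f (df : C -> C) (z h c : C) (K : R) :
  (forall w, cabs (w - z) <= cabs h -> is_derive w 1 f (df w)) ->
  (forall w, cabs (w - z) <= cabs h -> cabs (df w - c) <= K) ->
  cabs (f (z + h) - f z - c * h) <= K * cabs h.
Proof.
move=> fd dfK; pose y (s : R) : C := f (z + s%:C * h).
have inb t : 0 <= t <= 1 -> cabs (z + t%:C * h - z) <= cabs h.
  move=> /andP[t0 t1]; rewrite addrC addKr cabsM cabs_real ger0_norm//.
  by rewrite ler_piMl ?cabs_ge0.
have := @mean_value_ineq y (fun t => h * df (z + t%:C * h)) (h * c) 0 1 (K * cabs h) ler01.
rewrite subr0 mulr1 mul1r /y mul1r mul0r addr0 [h * c]mulrC; apply.
  by move=> t /inb tb; apply: is_pderive_comp (is_pderive_segment _ _ _); exact: fd.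
by move=> t /inb tb; rewrite [c * h]mulrC -mulrBr cabsM mulrC ler_wpM2r ?cabs_ge0// dfK.
Qed.

End ComplexDerivative.

(** * Wirtinger derivatives by increments around circles *)

Section CircleArgument.
Variable R : realType.
Local Notation C := (cline R).
Implicit Types (f X Y : C -> C) (z k d : C) (t : R).

Lemma is_derive_real_expansion (u : R -> R) (t du : R) : is_derive t 1 u du ->
  forall e : R, 0 < e -> exists2 r : R, 0 < r &
    forall s : R, `|s| < r -> `|u (t + s) - u t - s * du| <= e * `|s|.
Proof.
move=> [ut <-] e e0.
have := ut; rewrite /derivable => /cvg_ex[/= l ul].
have -> : 'D_1 u t = l by apply: cvg_lim.
move/cvgrPdist_le : ul => /(_ e e0).
rewrite near_withinE => -[/= r r0 rP]; exists r => // s sr.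
have [->|s0] := eqVneq s 0.
  by rewrite addr0 mul0r subrr subr0 normr0 mulr0.
have := rP s; rewrite /ball /= sub0r normrN => /(_ sr s0).
rewrite /GRing.scale /= mulr1 [s + t]addrC => H.
have -> : u (t + s) - u t - s * l = - ((l - s^-1 * (u (t + s) - u t)) * s).
  by field.
by rewrite normrN normrM ler_wpM2r.
Qed.

Lemma is_pderive_complex (u v : R -> R) (t du dv : R) :
  is_derive t 1 u du -> is_derive t 1 v dv ->
  is_pderive (fun s => u s +i* v s : C) t (du +i* dv).
Proof.
move=> /is_derive_real_expansion ud /is_derive_real_expansion vd e e0.
have e2 : 0 < e / 2 by rewrite divr_gt0.
have [r1 r10 P1] := ud _ e2; have [r2 r20 P2] := vd _ e2.
exists (Num.min r1 r2); first by rewrite lt_min r10.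
move=> s; rewrite lt_min => /andP[/P1 H1 /P2 H2].
apply: le_trans (cabs_le_ReIm _) _ => /=.
rewrite [e * _](_ : _ = e / 2 * `|s| + e / 2 * `|s|); last by field.
by rewrite lerD// !(mul0r, subr0, addr0, add0r).
Qed.

Definition circle (r t : R) : C := (r * cos t) +i* (r * sin t).

Lemma cabs_circle r t : 0 <= r -> cabs (circle r t) = r.
Proof.
move=> r0; apply/eqP; rewrite -(@eqrXn2 _ 2) ?cabs_ge0//; apply/eqP.
by rewrite sqr_cabs /= !exprMn -mulrDr cos2Dsin2 mulr1.
Qed.

Lemma is_pderive_circle r t : is_pderive (circle r) t ('i * circle r t).
Proof.
have -> : 'i * circle r t = (r * - sin t) +i* (r * cos t).
  by rewrite /circle; simpc; congr (_ +i* _); ring.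
by apply: is_pderive_complex; apply: is_derive_eq; rewrite /GRing.scale /=; ring.
Qed.

(* The increment of Y around the circle vanishes, whereas c k^*%C dk contributes
   2 i pi r^2 c: this plays the part of Stokes' theorem, and needs no continuity
   of the derivative of Y. *)
Lemma circle_bound Y (dY : C -> C) (c : C) (r e : R) : 0 < r ->
  (forall k : C, cabs k = r -> is_derive k 1 Y (dY k)) ->
  (forall k : C, cabs k = r -> cabs (dY k - c * k^*%C) <= e * r) ->
  cabs c <= e.
Proof.
move=> r0 Yd YdP.
have pi20 : 0 <= 2 * pi :> R by rewrite mulr_ge0// pi_ge0.
have pi2 : 0 < pi *+ 2 :> R by rewrite pmulrn_lgt0 ?pi_gt0.
have r0' := ltW r0.
(* As k^* k = r^2, the velocity dY(k) i k stays within e r^2 of the constant i c r^2, while the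
   total increment over [0, 2 pi] is 0. *)
have := @mean_value_ineq R (Y \o circle r) (fun t => dY (circle r t) * ('i * circle r t))
  ('i * c * (r ^+ 2)%:C) 0 (2 * pi) (e * r ^+ 2) pi20.
rewrite /= /circle mulr_natl cos2pi sin2pi cos0 sin0 subrr sub0r subr0 => H.
have /H{H}H : forall t : R, 0 <= t <= pi *+ 2 ->
    is_pderive (Y \o circle r) t (dY (circle r t) * ('i * circle r t)).
  move=> t _; rewrite mulrC; apply: is_pderive_comp (is_pderive_circle _ _).
  by apply: Yd; rewrite cabs_circle.
have : cabs (- ((pi *+ 2)%:C * ('i * c * (r ^+ 2)%:C))) <= e * r ^+ 2 * (pi *+ 2).
  apply: H => t _; rewrite -[(_ +i* _)]/(circle r t).
  set k := circle r t; have kr : cabs k = r by rewrite cabs_circle.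
  have -> : dY k * ('i * k) - 'i * c * (r ^+ 2)%:C = 'i * k * (dY k - c * k^*%C).
    by rewrite -kr -mulcJ; ring.
  rewrite !cabsM cabs_i mul1r kr (_ : e * r ^+ 2 = r * (e * r)); last by ring.
  by rewrite ler_wpM2l// YdP.
rewrite cabsN !cabsM !cabs_real cabs_i mul1r !ger0_norm ?sqr_ge0 ?(ltW pi2)//.
rewrite mulrC ler_pM2r// ler_pM2r// exprn_gt0//.
Qed.

(** A and B are the Wirtinger derivatives of f at z, with respect to z and its conjugate: real
    differentiability, in a form that isolates the obstruction B to holomorphy. *)
Definition is_wderive f z (A B : C) :=
  forall e : R, 0 < e -> exists2 r : R, 0 < r &
    forall h : C, cabs h < r ->
      cabs (f (z + h) - f z - (A * h + B * h^*%C)) <= e * cabs h.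

Lemma is_wderive0 f z A : is_wderive f z A 0 <-> is_derive z 1 f A.
Proof.
split=> [fz|/is_cderiveP fz].
  apply/is_cderiveP => e /fz[r r0 rP]; exists r => // h /rP.
  by rewrite mul0r addr0.
by move=> e /fz[r r0 rP]; exists r => // h /rP; rewrite mul0r addr0.
Qed.

Lemma is_cderive_shift f z k d :
  is_derive (z + k) 1 f d -> is_derive k 1 (fun k : C => f (z + k)) d.
Proof.
move=> /is_cderiveP fd; apply/is_cderiveP => e /fd[r r0 rP].
by exists r => // h /rP; rewrite addrA.
Qed.

Lemma cabs_le_eps (c : R[i]) :
  (forall e : R, 0 < e -> cabs c <= e) -> c = 0.
Proof.
move=> H; apply/eqP; rewrite -cabs_eq0 eq_le cabs_ge0 andbT.
by apply/ler_addgt0Pl => e /H; rewrite addr0.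
Qed.

(** Once psi(z) k + A k^2 / 2 is subtracted, X(z + k) has a derivative close to B k^*, and
    [circle_bound] makes B arbitrarily small. So the derivative of a holomorphic function, where it
    is real differentiable, is complex differentiable. *)
Lemma cderive_is_cderivable X (psi : C -> C) z (A B : C) (r : R) : 0 < r ->
  (forall h, cabs h < r -> is_derive (z + h) 1 X (psi (z + h))) ->
  is_wderive psi z A B -> B = 0.
Proof.
move=> r0 Xd psid; apply: cabs_le_eps => e /psid[r1 r10 P1].
pose s := Num.min r r1 / 2.
have m0 : 0 < Num.min r r1 by rewrite lt_min r0.
have s0 : 0 < s by rewrite divr_gt0.
have : s < Num.min r r1 by rewrite ltr_pdivrMr// mulr2n mulrDr mulr1 ltrDl.
rewrite lt_min => /andP[sr sr1].
apply: (@circle_bound (fun k : C => X (z + k) - psi z * k - A / 2 * k ^+ 2)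
  (fun k => psi (z + k) - psi z - A * k) B s e s0) => [k ks|k ks].
  have Xk : is_derive k 1 (fun k : C => X (z + k) : C) (psi (z + k)).
    by apply/is_cderive_shift/Xd; rewrite ks.
  by apply: is_derive_eq; rewrite /GRing.scale /=; field.
have := P1 k; rewrite ks => /(_ sr1); apply: le_trans.
by rewrite le_eqVlt; apply/orP; left; apply/eqP; congr cabs; ring.
Qed.

(** If D were differentiable, this would be the chain rule for phi' = (phi o H) D. With only a bound
    on D near z, the two expansions are compared on a small circle through [circle_bound]. *)
Lemma wderive_pullback (phi phi' H D : C -> C) z (A B A' B' : C) (r K : R) :
  0 < r ->
  (forall h, cabs h < r -> is_derive (z + h) 1 H (D (z + h))) ->
  (forall h, cabs h < r -> cabs (D (z + h)) <= K) ->
  (forall h, cabs h < r -> phi' (z + h) = phi (H (z + h)) * D (z + h)) ->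
  is_wderive phi (H z) A B -> is_wderive phi' z A' B' ->
  B' = (cabs (D z) ^+ 2)%:C * B.
Proof.
move=> r0 Hd DK phiE phid phid'; apply/eqP; rewrite eq_sym -subr_eq0; apply/eqP.
apply: cabs_le_eps => e e0.
set a := D z; have a0 := cabs_ge0 a; have B0 := cabs_ge0 B.
have K0 : 0 <= K by apply: le_trans (DK 0 _); rewrite ?cabs_ge0// cabs0.
have q1 : 0 < 4 * ((cabs B + 1) * (K + cabs a + 1)).
  by rewrite !mulr_gt0// ltr_wpDl// addr_ge0.
have q2 : 0 < 4 * ((cabs a + 1) * (K + 1)).
  by rewrite !mulr_gt0// ltr_wpDl.
(* [e1] controls the last two error terms of the splitting below and [e2] the one with phi, each
   share being e s / 4; the minimum with 1 yields |g k| <= (|a| + 1) s. *)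
pose e1 := Num.min 1 (e / (4 * ((cabs B + 1) * (K + cabs a + 1)))).
pose e2 := e / (4 * ((cabs a + 1) * (K + 1))).
have e10 : 0 < e1 by rewrite lt_min ltr01 divr_gt0.
have e20 : 0 < e2 by rewrite divr_gt0.
have Hd0 : is_derive z 1 H a by have := Hd 0; rewrite addr0 cabs0; apply.
move/is_cderiveP : (Hd0) => /(_ _ e10)[r1 r10 P1].
have [r2 r20 P2] := phid _ e20.
have [r3 r30 P3] := phid' (e / 4) ltac:(by rewrite divr_gt0).
pose m := Num.min (Num.min r r1) (Num.min (r2 / (cabs a + 1)) r3).
have m0 : 0 < m by rewrite !lt_min r0 r10 r30 divr_gt0// ltr_wpDl.
pose s := m / 2.
have s0 : 0 < s by rewrite divr_gt0.
have : s < m by rewrite ltr_pdivrMr// mulr2n mulrDr mulr1 ltrDl.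
rewrite !lt_min => /andP[/andP[sr sr1] /andP[sr2 sr3]].
rewrite ltr_pdivlMr ?ltr_wpDl// in sr2.
pose g (k : C) : C := H (z + k) - H z.
have gP k : cabs k = s -> cabs (g k - a * k) <= e1 * s.
  by move=> ks; rewrite /g -ks P1// ks.
have g_le k : cabs k = s -> cabs (g k) <= s * (cabs a + 1).
  move=> ks; have -> : g k = (g k - a * k) + a * k by rewrite subrK.
  apply: le_trans (cabsD _ _) _; rewrite [cabs (a * k)]cabsM ks.
  have : e1 * s <= 1 * s by rewrite ler_wpM2r ?(ltW s0)// ge_min lexx.
  by have := gP k ks; lra.
(* As k^*%C = s^2 / k on the circle, the terms in [b] replace B (g k)^*%C D (z + k),
   which has no primitive, up to |a|^2 B k^*%C. *)
pose b : C := B * a^*%C * (s ^+ 2)%:C.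
pose Y (k : C) : C := phi' z * k + A' / 2 * k ^+ 2 - phi (H z) * g k
  - A / 2 * g k ^+ 2 - b * (g k * k^-1).
pose dY (k : C) : C := phi' z + A' * k - phi (H z) * D (z + k) - A * g k * D (z + k)
  - b * (D (z + k) / k - g k / k ^+ 2).
pose c : C := (cabs a ^+ 2)%:C * B - B'.
have Yd (k : C) : cabs k = s -> is_derive k 1 Y (dY k).
  move=> ks.
  have k0 : k != 0 by rewrite -cabs_gt0 ks.
  have Hk : is_derive k 1 (fun k : C => H (z + k) : C) (D (z + k)).
    by apply/is_cderive_shift/Hd; rewrite ks.
  have gk : is_derive k 1 (g : C -> C) (D (z + k)).
    by apply: is_derive_eq; rewrite subr0.
  have kV : is_derive k 1 (fun k : C => k^-1 : C) (- 1 / k ^+ 2).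
    by apply: is_cderiveV.
  by rewrite /Y /dY; apply: is_derive_eq; rewrite /GRing.scale /=; field.
suff YP (k : C) : cabs k = s -> cabs (dY k - c * k^*%C) <= e * s.
  exact: (circle_bound s0 Yd YP).
move=> ks.
have k0 : k != 0 by rewrite -cabs_gt0 ks.
(* The error splits into the remainder of phi' at z, the remainder of phi at H z times D, and two
   replacements of g by its linear part a k: in g^* D, and in the correction with [b]. *)
have -> : dY k - c * k^*%C =
   - (phi' (z + k) - phi' z - (A' * k + B' * k^*%C)) +
   (phi (H z + g k) - phi (H z) - (A * g k + B * (g k)^*%C)) * D (z + k) +
   B * (g k - a * k)^*%C * D (z + k) + B * a^*%C * (k^*%C / k) * (g k - a * k).
  have -> : (g k - a * k)^*%C = (g k)^*%C - a^*%C * k^*%C by rewrite -rmorphM -rmorphB.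
  rewrite /dY /b /c -ks -!mulcJ phiE ?ks//.
  have -> : H z + g k = H (z + k) by rewrite [LHS]addrC subrK.
  by field.
have Dk : cabs (D (z + k)) <= K by rewrite DK ?ks.
have T1 : cabs (- (phi' (z + k) - phi' z - (A' * k + B' * k^*%C))) <= e / 4 * s.
  by rewrite cabsN -ks P3 ?ks.
have T2 : cabs ((phi (H z + g k) - phi (H z) - (A * g k + B * (g k)^*%C)) * D (z + k))
    <= e / 4 * s.
  rewrite cabsM; apply: le_trans (_ : (e2 * (s * (cabs a + 1))) * K <= _).
    apply: ler_pM => //; rewrite ?cabs_ge0//.
    apply: le_trans (P2 _ _) _; first by rewrite (le_lt_trans (g_le k ks)).
    by rewrite ler_wpM2l ?(ltW e20)// g_le.
  have -> : e2 * (s * (cabs a + 1)) * K = (e / 4 * s) * (K / (K + 1)).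
    by rewrite /e2; field; rewrite !gt_eqF ?ltr_wpDl.
  have K1 : K / (K + 1) <= 1.
    rewrite ler_pdivrMr; last by rewrite ltr_wpDl.
    by rewrite mul1r lerDl ler01.
  have e4s : 0 <= e / 4 * s by apply: mulr_ge0; [apply: divr_ge0 => //; exact: ltW|exact: ltW].
  by rewrite ler_piMr.
have e1le : e1 <= e / (4 * ((cabs B + 1) * (K + cabs a + 1))).
  by rewrite ge_min lexx orbT.
have gP' := le_trans (gP k ks) (ler_wpM2r (ltW s0) e1le).
have T3 : cabs (B * (g k - a * k)^*%C * D (z + k)) +
    cabs (B * a^*%C * (k^*%C / k) * (g k - a * k)) <= e / 4 * s.
  rewrite !cabsM !cabs_conj cabsV divff ?mulr1 ?cabs_eq0// -/a.
  have -> : cabs B * cabs (g k - a * k) * cabs (D (z + k)) +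
    cabs B * cabs a * cabs (g k - a * k) =
    cabs (g k - a * k) * (cabs B * (cabs (D (z + k)) + cabs a)) by ring.
  apply: le_trans (_ : (e / (4 * ((cabs B + 1) * (K + cabs a + 1))) * s) *
    ((cabs B + 1) * (K + cabs a + 1)) <= _).
    apply: ler_pM; rewrite ?cabs_ge0 ?mulr_ge0 ?addr_ge0 ?cabs_ge0//.
    apply: ler_pM; rewrite ?cabs_ge0 ?addr_ge0 ?cabs_ge0 ?lerDl//.
    by rewrite -addrA lerD// lerDl.
  rewrite le_eqVlt; apply/orP; left; apply/eqP; field.
  by rewrite !gt_eqF// ltr_wpDl// addr_ge0.
apply: le_trans (_ : e / 4 * s + e / 4 * s + e / 4 * s <= _); last first.
  by have := mulr_gt0 e0 s0; lra.
apply: le_trans (lerD (lerD T1 T2) T3); apply: le_trans (cabsD _ _) _.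
rewrite [leRHS]addrA lerD2r; apply: le_trans (cabsD _ _) _.
by rewrite lerD2r cabsD.
Qed.

End CircleArgument.

(** * Maximum principle and a Hoelder estimate *)

Section MaximumPrinciple.
Variable R : realType.
Local Notation C := (cline R).
Implicit Types (f X Y : C -> C) (z w k d : C) (t r e rho : R).

Lemma cabs_dist_continuous w : continuous (fun z : C => cabs (z - w) : R).
Proof.
move=> z P /nbhs_ballP[/= e e0 eP]; apply/cline_nbhsP; exists e => // h he.
apply: eP; rewrite /ball /= addrAC; apply: le_lt_trans he.
rewrite ler_norml; apply/andP; split.
  by have := cabsD (z - w) h; lra.
by rewrite (le_trans (cabs_sub _ _))// opprD addNKr cabsN.
Qed.

Lemma cabs_comp_continuous f z :
  {for z, continuous f} -> {for z, continuous (fun z : C => cabs (f z) : R)}.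
Proof.
move=> fz P /nbhs_ballP[/= e e0 eP].
have H : nbhs (f z) [set y | `|cabs (f z) - cabs y| < e].
  apply/cline_nbhsP; exists e => // h he /=; apply: le_lt_trans he.
  rewrite ler_norml; apply/andP; split.
    by have := cabsD (f z) h; lra.
  by rewrite (le_trans (cabs_sub _ _))// opprD addNKr cabsN.
by apply: (@filterS _ (nbhs z) _ _ _ _ (fz _ H)) => y yP; exact: eP.
Qed.

Lemma cplx_continuous : continuous (@cplx R).
Proof.
move=> -[a b]; move=> P /= /cline_nbhsP[r r0 rP].
have r2 : 0 < r / 2 by rewrite divr_gt0.
exists (ball a (r / 2), ball b (r / 2)); first by split; exact: nbhsx_ballx.
move=> [a' b'] [/= aa' bb'].
have -> : cplx (a', b') = cplx (a, b) + ((a' - a) +i* (b' - b)).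
  by rewrite /cplx /=; simpc; congr (_ +i* _); ring.
apply: rP; apply: le_lt_trans (cabs_le_ReIm _) _ => /=.
by rewrite [ltRHS](splitr r) ltrD// distrC.
Qed.

Lemma cdisc_compact w rho : compact [set z : C | cabs (z - w) <= rho].
Proof.
pose Q := `[complex.Re w - rho, complex.Re w + rho]%classic `*`
          `[complex.Im w - rho, complex.Im w + rho]%classic : set (R * R).
apply: (@subclosed_compact _ _ (@cplx R @` Q)).
- apply: (@preimage_closed _ _ (fun z : C => cabs (z - w)) _ _ (@closed_le R rho)) => z _.
  exact: cabs_dist_continuous.
- apply: continuous_compact; last first.
    by apply: compact_setX; exact: segment_compact.
  by apply: continuous_subspaceT; exact: cplx_continuous.
- move=> z /= zw; exists (complex.Re z, complex.Im z); last by case: (z).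
  have := le_trans (Re_le_cabs _) zw; have := le_trans (Im_le_cabs _) zw.
  move: z w {zw} @Q => [a b] [c d] /=; rewrite !ler_norml => /andP[? ?] /andP[? ?].
  by split => /=; rewrite in_itv /=; apply/andP; split; lra.
Qed.

Lemma cderive_continuous f z d : is_derive z 1 f d -> {for z, continuous f}.
Proof. by move=> [fd _]; apply/differentiable_continuous/derivable1_diffP. Qed.

(** The second order remainder has derivative f1 w - f1 z - d (w - z), at most e |h| on the disc of
    radius |h| by differentiability of f1 at z; the mean value inequality supplies the second factor
    |h|. *)
Lemma cderive_taylor2 f (f1 : C -> C) z d r : 0 < r ->
  (forall h, cabs h < r -> is_derive (z + h) 1 f (f1 (z + h))) ->
  is_derive z 1 f1 d ->
  forall e, 0 < e -> exists2 s : R, 0 < s & forall h, cabs h < s ->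
    cabs (f (z + h) - (f z + f1 z * h + d / 2 * h ^+ 2)) <= e * cabs h ^+ 2.
Proof.
move=> r0 fd /is_cderiveP f1d e e0; have [s s0 sP] := f1d e e0.
exists (Num.min r s); first by rewrite lt_min r0.
move=> h; rewrite lt_min => /andP[hr hs].
pose G (w : C) : C := f w - f1 z * (w - z) - d / 2 * (w - z) ^+ 2.
pose dG (w : C) : C := f1 w - f1 z - d * (w - z).
have Gd (w : C) : cabs (w - z) <= cabs h -> is_derive w 1 G (dG w).
  move=> wh; have := fd (w - z); rewrite [z + _]addrC subrK => /(_ (le_lt_trans wh hr)) fw.
  by rewrite /G /dG; apply: is_derive_eq; rewrite /GRing.scale /=; field.
have dGP (w : C) : cabs (w - z) <= cabs h -> cabs (dG w - 0) <= e * cabs h.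
  move=> wh; have := sP (w - z) (le_lt_trans wh hs).
  rewrite subr0 [z + _]addrC subrK => /le_trans; apply.
  by rewrite ler_wpM2l ?(ltW e0).
have := cderive_mean_value_ineq Gd dGP.
rewrite mul0r subr0 -mulrA -expr2; congr (_ <= _); congr cabs.
by rewrite /G [z + h]addrC addrK subrr; ring.
Qed.

Lemma sqr_cabs_approx (x y : R[i]) (K e : R) : cabs x <= K -> cabs (y - x) <= e ->
  cabs x ^+ 2 - 2 * K * e <= cabs y ^+ 2.
Proof.
move=> xK yx; have x0 := cabs_ge0 x; have y0 := cabs_ge0 y.
have d0 := cabs_ge0 (y - x).
have H1 : cabs x <= cabs y + cabs (y - x).
  by have := cabsB y (y - x); rewrite opprB addrC subrK.
have H2 : cabs x * cabs (y - x) <= K * e by rewrite ler_pM.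
have H3 := cabsB y x.
have H4 : 0 <= (cabs y - (cabs x - cabs (y - x))) * (cabs y + (cabs x - cabs (y - x))).
  by apply: mulr_ge0; lra.
have H5 := sqr_ge0 (cabs (y - x)).
move: H2 H4 H5; move: (cabs (y - x)) (cabs y) (cabs x) => u v t; lra.
Qed.

(** The four values of h are s times the fourth roots of unity, over which the cross terms of |a + b
    h + c h^2|^2 cancel; what remains is 4 (|a|^2 + |b|^2 s^2 + |c|^2 s^4). *)
Lemma parseval4 (a b c : R[i]) (s : R) :
  let T (h : R[i]) := cabs (a + b * h + c * h ^+ 2) ^+ 2 in
  4 * cabs a ^+ 2 <= T s%:C + T (- s%:C) + T ('i * s%:C) + T (- ('i * s%:C)).
Proof.
rewrite /= !sqr_cabs !expr2; case: a b c => [a a'] [b b'] [c c'] /=.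
have := sqr_ge0 (s * b); have := sqr_ge0 (s * b').
have := sqr_ge0 (s * s * c); have := sqr_ge0 (s * s * c').
rewrite !expr2; nra.
Qed.

Lemma sum4_dist (z : R[i]) (s : R) :
  let T (h : R[i]) := cabs (z + h) ^+ 2 in
  T s%:C + T (- s%:C) + T ('i * s%:C) + T (- ('i * s%:C)) =
  4 * cabs z ^+ 2 + 4 * s ^+ 2.
Proof. by rewrite /= !sqr_cabs !expr2; case: z => [a a'] /=; ring. Qed.

(* Summing over the four directions s, - s, i s, - i s cancels the first and
   second order terms, as for the Laplacian of the modulus squared. *)
Lemma no_interior_maximum f (f1 : C -> C) z w d e r : 0 < r -> 0 < e ->
  (forall h, cabs h < r -> is_derive (z + h) 1 f (f1 (z + h))) ->
  is_derive z 1 f1 d ->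
  (forall h, cabs h < r -> cabs (f (z + h)) ^+ 2 + e * cabs (z + h - w) ^+ 2 <=
     cabs (f z) ^+ 2 + e * cabs (z - w) ^+ 2) -> False.
Proof.
move=> r0 e0 fd f1d fmax.
pose a := f z; pose b := f1 z; pose c := d / 2.
pose K := cabs a + cabs b + cabs c + 1.
have K0 : 0 < K by rewrite ltr_wpDl// !addr_ge0 ?cabs_ge0.
(* [eta] makes the Taylor error 2 K eta s^2 equal to e s^2 / 2, half of the average gain e s^2 that
   [sum4_dist] gives for the term e |. - w|^2. *)
pose eta := e / (4 * K).
have eta0 : 0 < eta by rewrite divr_gt0// mulr_gt0.
have [s1 s10 sP] := cderive_taylor2 r0 fd f1d eta0.
pose s := Num.min 1 (Num.min r s1) / 2.
have m0 : 0 < Num.min 1 (Num.min r s1) by rewrite !lt_min ltr01 r0.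
have s0 : 0 < s by rewrite divr_gt0.
have : s < Num.min 1 (Num.min r s1).
  by rewrite ltr_pdivrMr// mulr2n mulrDr mulr1 ltrDl.
rewrite !lt_min => /andP[s_1 /andP[sr ss1]].
pose T (h : C) := a + b * h + c * h ^+ 2.
have TP (h : C) : cabs h = s ->
    cabs (T h) ^+ 2 - 2 * K * (eta * s ^+ 2) + e * cabs (z - w + h) ^+ 2 <=
    cabs a ^+ 2 + e * cabs (z - w) ^+ 2.
  move=> hs; have := fmax h; rewrite hs => /(_ sr); apply: le_trans.
  rewrite [z - w + h]addrAC lerD2r; apply: sqr_cabs_approx; last by rewrite -hs sP ?hs.
  rewrite /T /K; apply: le_trans (cabsD _ _) _.
  apply: le_trans (lerD (cabsD _ _) (lexx _)) _.
  rewrite [cabs (b * h)]cabsM [cabs (c * _)]cabsM cabsX hs.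
  have : cabs b * s <= cabs b by rewrite ler_piMr ?cabs_ge0 ?(ltW s_1).
  have : cabs c * s ^+ 2 <= cabs c.
    by rewrite ler_piMr ?cabs_ge0// expr_le1 ?(ltW s_1) ?(ltW s0).
  lra.
have sC : cabs (s%:C : R[i]) = s by rewrite cabs_real ger0_norm ?(ltW s0).
have isC : cabs ('i * s%:C : R[i]) = s by rewrite cabsM cabs_i mul1r.
have H1 := TP s%:C sC.
have H2 := TP (- s%:C) ltac:(by rewrite cabsN).
have H3 := TP ('i * s%:C) isC.
have H4 := TP (- ('i * s%:C)) ltac:(by rewrite cabsN).
have H5 := parseval4 a b c s; have H6 := sum4_dist (z - w) s.
rewrite /= in H5 H6; rewrite /T in H1 H2 H3 H4.
have H7 : 2 * K * (eta * s ^+ 2) = e / 2 * s ^+ 2.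
  by rewrite /eta; field; rewrite gt_eqF.
have H8 : 0 < e * s ^+ 2 by rewrite mulr_gt0// exprn_gt0.
have H6' : e * (cabs (z - w + s%:C) ^+ 2 + cabs (z - w - s%:C) ^+ 2 +
   cabs (z - w + 'i * s%:C) ^+ 2 + cabs (z - w - 'i * s%:C) ^+ 2) =
   4 * (e * cabs (z - w) ^+ 2) + 4 * (e * s ^+ 2) by rewrite H6; ring.
rewrite !mulrDr in H6'; rewrite H7 in H1 H2 H3 H4.
move: H1 H2 H3 H4 H5 H6' H8; lra.
Qed.

(** As in the Schwarz lemma, but with the squared numerator (f - f w)^2: the quotient g by z - w
    tends to 0 at w, so a nonzero maximum of |g| lies at a point where g is twice differentiable, or
    on the circle of radius rho, where |g| <= 4 M / rho. The price is the Hoelder exponent 1/2. *)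
Lemma schwarz_hoelder f (f1 f2 : C -> C) w rho r M : 0 < rho -> rho < r ->
  (forall z, cabs (z - w) < r -> is_derive z 1 f (f1 z)) ->
  (forall z, cabs (z - w) < r -> is_derive z 1 f1 (f2 z)) ->
  (forall z, cabs (z - w) <= rho -> cabs (f z) ^+ 2 <= M) ->
  forall z, cabs (z - w) <= rho ->
    rho * cabs (f z - f w) ^+ 2 <= 4 * M * cabs (z - w).
Proof.
move=> rho0 rhor fd f1d fM z0 z0rho.
have M0 : 0 <= M.
  by apply: le_trans (fM w _); rewrite ?exprn_ge0 ?cabs_ge0// subrr cabs0 ltW.
pose g (z : C) : C := (f z - f w) ^+ 2 * (z - w)^-1.
pose g1 (z : C) : C := 2 * (f z - f w) * f1 z * (z - w)^-1 -
  (f z - f w) ^+ 2 * ((z - w)^-1) ^+ 2.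
have Vd (z : C) : z != w -> is_derive z 1 (fun z : C => (z - w)^-1 : C) (- (z - w)^-1 ^+ 2).
  move=> zw; have zw0 : z - w != 0 by rewrite subr_eq0.
  have H : is_derive z 1 (fun z : C => z - w : C) 1.
    by apply: is_derive_eq; rewrite subr0.
  have := is_cderiveV H zw0; congr is_derive.
  by rewrite mulN1r exprVn.
have gd (z : C) : z != w -> cabs (z - w) < r -> is_derive z 1 g (g1 z).
  move=> zw zr; have fz := fd z zr; have Vz := Vd z zw.
  by rewrite /g /g1; apply: is_derive_eq; rewrite /GRing.scale /=; ring.
have g1d (z : C) : z != w -> cabs (z - w) < r -> exists d, is_derive z 1 g1 d.
  move=> zw zr; have fz := fd z zr; have f1z := f1d z zr; have Vz := Vd z zw.
  by eexists; rewrite /g1; exact: is_deriveB.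
(* The convention 0^-1 = 0 gives g the value 0 at w, which is also its limit there. *)
have gw0 : g w = 0 by rewrite /g !subrr invr0 mulr0.
have g_cont (z : C) : cabs (z - w) <= rho -> {for z, continuous g}.
  move=> zrho; have zr := le_lt_trans zrho rhor.
  have [->|zw] := eqVneq z w; last exact: cderive_continuous (gd z zw zr).
  have := fd w; rewrite subrr cabs0 => /(_ (lt_trans rho0 rhor)) /is_cderiveP.
  move=> /(_ 1 ltr01)[s s0 sP] P; rewrite gw0 => /cline_nbhsP[s1 s10 s1P].
  pose K := 1 + cabs (f1 w).
  have K0 : 0 < K by rewrite ltr_wpDr ?cabs_ge0.
  apply/cline_nbhsP; exists (Num.min s (s1 / K ^+ 2)).
    by rewrite lt_min s0 divr_gt0// exprn_gt0.
  move=> h; rewrite lt_min => /andP[hs]; rewrite ltr_pdivlMr ?exprn_gt0// => hs1.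
  rewrite /= -[g _]add0r; apply: s1P; apply: le_lt_trans hs1.
  rewrite /g [w + h]addrC addrK cabsM cabsX cabsV.
  have [->|h0] := eqVneq h 0; first by rewrite cabs0 invr0 mulr0 mul0r.
  rewrite ler_pdivrMr ?cabs_gt0//.
  have -> : cabs h * K ^+ 2 * cabs h = (K * cabs h) ^+ 2 by ring.
  rewrite ler_pXn2r ?nnegrE ?cabs_ge0 ?mulr_ge0 ?(ltW K0) ?cabs_ge0//.
  have -> : f (h + w) - f w = (f (w + h) - f w - f1 w * h) + f1 w * h.
    by rewrite subrK [w + h]addrC.
  rewrite /K mulrDl; apply: le_trans (cabsD _ _) _.
  by rewrite [cabs (f1 w * h)]cabsM lerD2r sP.
have fwM : cabs (f w) ^+ 2 <= M by apply: fM; rewrite subrr cabs0 ltW.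
have fbound (z : C) : cabs (z - w) <= rho -> cabs (f z - f w) ^+ 2 <= 4 * M.
  move=> /fM fz.
  have fzw : cabs (f z - f w) ^+ 2 <= (cabs (f z) + cabs (f w)) ^+ 2.
    by rewrite ler_pXn2r ?nnegrE ?addr_ge0 ?cabs_ge0// cabsB.
  have := sqr_ge0 (cabs (f z) - cabs (f w)).
  move: (cabs (f z - f w)) (cabs (f z)) (cabs (f w)) fz fwM fzw => x y u; lra.
(* The term e |z - w|^2 excludes a maximum of [k] in the open disc away from w, by
   [no_interior_maximum]; e is arbitrary and disappears at the end. *)
have key e : 0 < e -> cabs (g z0) ^+ 2 <= (4 * M / rho) ^+ 2 + e * rho ^+ 2.
  move=> e0.
  have B0 : 0 <= (4 * M / rho) ^+ 2 by rewrite sqr_ge0.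
  pose k (z : C) : R := cabs (g z) ^+ 2 + e * cabs (z - w) ^+ 2.
  have kc : {within [set z : C | cabs (z - w) <= rho], continuous k}.
    apply: continuous_in_subspaceT => z; rewrite inE /= => zrho.
    have sq (h : C -> R) : {for z, continuous h} -> {for z, continuous (fun y => h y ^+ 2)}.
      by move=> hc; apply: (@continuousM _ _ h h).
    rewrite /k /=; apply: (@continuousD _ _ _ (fun z : C => cabs (g z) ^+ 2)
      (fun z : C => e * cabs (z - w) ^+ 2)).
      by apply/sq/cabs_comp_continuous/g_cont.
    apply: (@continuousM _ _ (fun=> e) (fun z : C => cabs (z - w) ^+ 2)).
      exact: cst_continuous.
    by apply/sq; exact: cabs_dist_continuous.
  have D0 : [set z : C | cabs (z - w) <= rho] !=set0.
    by exists w; rewrite /= subrr cabs0 ltW.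
  have [p] := compact_EVT_max D0 (@cdisc_compact w rho) kc.
  rewrite inE /= => prho pmax.
  have pmax' (z : C) : cabs (z - w) <= rho -> k z <= k p by move=> ?; apply: pmax; rewrite inE.
  have kz0 : cabs (g z0) ^+ 2 <= k z0 by rewrite lerDl mulr_ge0 ?sqr_ge0// ltW.
  apply: le_trans kz0 (le_trans (pmax' _ z0rho) _); rewrite /k.
  have [->|pw] := eqVneq p w.
    by rewrite gw0 subrr cabs0 expr0n /= mulr0 addr0 addr_ge0// mulr_ge0 ?sqr_ge0 ?(ltW e0).
  have [pr|pr] := eqVneq (cabs (p - w)) rho.
    rewrite pr lerD2r ler_pXn2r ?nnegrE ?cabs_ge0 ?divr_ge0 ?mulr_ge0 ?(ltW rho0)//.
    by rewrite /g cabsM cabsX cabsV pr ler_pM2r ?invr_gt0// fbound.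
  have prlt : cabs (p - w) < rho by rewrite lt_neqAle pr.
  have pw0 : 0 < cabs (p - w) by rewrite cabs_gt0 subr_eq0.
  pose s := Num.min (cabs (p - w)) (rho - cabs (p - w)).
  have s0 : 0 < s by rewrite lt_min pw0 subr_gt0.
  have ps (h : C) : cabs h < s -> p + h != w /\ cabs (p + h - w) <= rho.
    rewrite lt_min => /andP[h1 h2]; split.
      apply/eqP => phw; have : h = - (p - w) by rewrite -phw; ring.
      by move=> hE; move: h1; rewrite hE cabsN ltxx.
    rewrite addrAC; apply: le_trans (cabsD _ _) _; lra.
  have [d gp] := g1d p pw (lt_trans prlt rhor).
  have gps (h : C) : cabs h < s -> is_derive (p + h) 1 g (g1 (p + h)).
    by move=> /ps[hw hr]; apply: gd => //; exact: le_lt_trans rhor.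
  have pmaxs (h : C) : cabs h < s ->
      cabs (g (p + h)) ^+ 2 + e * cabs (p + h - w) ^+ 2 <=
      cabs (g p) ^+ 2 + e * cabs (p - w) ^+ 2.
    by move=> /ps[hw hr]; exact: pmax'.
  by have := no_interior_maximum s0 e0 gps gp pmaxs.
have [->|zw] := eqVneq z0 w; first by rewrite !subrr cabs0 expr0n /= !mulr0.
have zw0 : 0 < cabs (z0 - w) by rewrite cabs_gt0 subr_eq0.
have : cabs (g z0) <= 4 * M / rho.
  rewrite -(@ler_pXn2r _ 2) ?nnegrE ?cabs_ge0 ?divr_ge0 ?mulr_ge0 ?(ltW rho0)//.
  apply/ler_addgt0Pl => e e0.
  have := key (e / rho ^+ 2) ltac:(by rewrite divr_gt0// exprn_gt0).
  by rewrite divfK ?expf_neq0 ?gt_eqF// addrC.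
rewrite /g cabsM cabsX cabsV ler_pdivlMr// mulrAC ler_pdivrMr//.
by rewrite mulrC.
Qed.
End MaximumPrinciple.

(** * Harmonic 1-forms in a disc *)

Section SmoothFunctions.
Variables (R : realType) (V : normedModType R) (D : set V).
Hypothesis openD : open D.
Implicit Types f g : V -> R.

Lemma near_eq_continuous (T U : topologicalType) (f g : T -> U) (x : T) :
  (\near x, f x = g x) -> {for x, continuous f} -> {for x, continuous g}.
Proof.
move=> fg fc; have fgx : f x = g x by exact: nbhs_singleton fg.
have := fc; rewrite /prop_for /continuous_at fgx; apply: cvg_trans.
by apply: near_eq_cvg; apply: filterS fg => y ->.
Qed.

Lemma Ck_on_ext k f g : (forall x, D x -> f x = g x) -> Ck_on k D f -> Ck_on k D g.
Proof.
have nfg f' g' : (forall x, D x -> f' x = g' x) -> forall x, D x -> \near x, f' x = g' x.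
  move=> fg x Dx.
  by apply: filterS (open_nbhs_nbhs (conj openD Dx)) => y /fg.
elim: k f g => [|k IHk] f g fg /= [fc fk]; split=> //=.
- by move=> x Dx; apply: near_eq_continuous (fc x Dx); exact: nfg.
- by move=> x Dx; apply: near_eq_continuous (fc x Dx); exact: nfg.
move=> v; have [fd fDk] := fk v; split=> [x Dx|].
  by apply: near_eq_derivable (fd x Dx); exact: nfg.
apply: IHk fDk => x Dx.
by apply: near_eq_derive => //; exact: nfg.
Qed.

Lemma Ck_onS k f : Ck_on k.+1 D f -> Ck_on k D f.
Proof.
elim: k f => [|k IHk] f [fc fk]; split=> //= v.
by have [fd fDk] := fk v; split=> //; exact: IHk.
Qed.

Lemma Ck_on_derivable k f x v : Ck_on k.+1 D f -> D x -> derivable f x v.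
Proof. by move=> [_ /(_ v)[fd _]] /fd. Qed.

Lemma Ck_on_derive k f v : Ck_on k.+1 D f -> Ck_on k D ('D_v f).
Proof. by move=> [_ /(_ v)[_ fd]]. Qed.

Lemma Ck_on_cst k (c : R) : Ck_on k D (fun=> c).
Proof.
elim: k c => [|k IHk] c; split=> //=; try by move=> x _; exact: cst_continuous.
move=> v; split=> [x _|]; first exact: derivable_cst.
by apply: Ck_on_ext (IHk 0) => x _; rewrite derive_cst.
Qed.

Lemma Ck_onD k f g : Ck_on k D f -> Ck_on k D g -> Ck_on k D (fun x => f x + g x).
Proof.
elim: k f g => [|k IHk] f g Hf Hg.
  split=> // x Dx; apply: (@continuousD _ _ _ f g); first exact: Hf.1.
  exact: Hg.1.
split=> [x Dx|v].
  by apply: (@continuousD _ _ _ f g); [exact: Hf.1|exact: Hg.1].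
split=> [x Dx|].
  by apply: (@derivableD _ _ _ f g); [exact: (Ck_on_derivable Hf Dx)|exact: (Ck_on_derivable Hg Dx)].
apply: Ck_on_ext (IHk _ _ (Ck_on_derive v Hf) (Ck_on_derive v Hg)) => x Dx.
by rewrite [RHS](deriveD (Ck_on_derivable Hf Dx) (Ck_on_derivable Hg Dx)).
Qed.

Lemma Ck_onM k f g : Ck_on k D f -> Ck_on k D g -> Ck_on k D (fun x => f x * g x).
Proof.
elim: k f g => [|k IHk] f g Hf Hg.
  split=> // x Dx; apply: (@continuousM _ _ f g); first exact: Hf.1.
  exact: Hg.1.
split=> [x Dx|v].
  by apply: (@continuousM _ _ f g); [exact: Hf.1|exact: Hg.1].
split=> [x Dx|].
  by apply: (@derivableM _ _ f g); [exact: (Ck_on_derivable Hf Dx)|exact: (Ck_on_derivable Hg Dx)].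
apply: Ck_on_ext (Ck_onD (IHk _ _ (Ck_onS Hf) (Ck_on_derive v Hg))
  (IHk _ _ (Ck_onS Hg) (Ck_on_derive v Hf))) => x Dx.
by rewrite [RHS](deriveM (Ck_on_derivable Hf Dx) (Ck_on_derivable Hg Dx)).
Qed.

Lemma Ck_onN k f : Ck_on k D f -> Ck_on k D (fun x => - f x).
Proof.
by move=> Hf; apply: Ck_on_ext (Ck_onM (Ck_on_cst k (-1)) Hf) => x _; rewrite mulN1r.
Qed.

Lemma Ck_onV k f : (forall x, D x -> f x != 0) -> Ck_on k D f ->
  Ck_on k D (fun x => (f x)^-1).
Proof.
move=> f0; elim: k => [|k IHk] Hf.
  by split=> // x Dx; apply: (@continuousV _ _ f); [exact: f0|exact: Hf.1].
split=> [x Dx|v].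
  by apply: (@continuousV _ _ f); [exact: f0|exact: Hf.1].
split=> [x Dx|].
  by apply: derivableV; [exact: f0|exact: Ck_on_derivable Hf Dx].
have Hi := IHk (Ck_onS Hf).
apply: Ck_on_ext (Ck_onN (Ck_onM (Ck_onM Hi Hi) (Ck_on_derive v Hf))) => x Dx.
rewrite (deriveV (f0 x Dx) (Ck_on_derivable Hf Dx)).
by rewrite /GRing.scale /= mulNr expr2 invfM.
Qed.

Lemma smooth_on_ext f g : (forall x, D x -> f x = g x) -> smooth_on D f -> smooth_on D g.
Proof. by move=> fg Hf k; apply: Ck_on_ext (Hf k). Qed.

Lemma smooth_onD f g : smooth_on D f -> smooth_on D g -> smooth_on D (fun x => f x + g x).
Proof. by move=> Hf Hg k; exact: Ck_onD. Qed.

Lemma smooth_onM f g : smooth_on D f -> smooth_on D g -> smooth_on D (fun x => f x * g x).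
Proof. by move=> Hf Hg k; exact: Ck_onM. Qed.

Lemma smooth_onN f : smooth_on D f -> smooth_on D (fun x => - f x).
Proof. by move=> Hf k; exact: Ck_onN. Qed.

Lemma smooth_onV f : (forall x, D x -> f x != 0) -> smooth_on D f ->
  smooth_on D (fun x => (f x)^-1).
Proof. by move=> f0 Hf k; exact: Ck_onV. Qed.

Lemma smooth_on_cst (c : R) : smooth_on D (fun=> c).
Proof. by move=> k; exact: Ck_on_cst. Qed.

Lemma smooth_on_derive f v : smooth_on D f -> smooth_on D ('D_v f).
Proof. by move=> Hf k; exact: Ck_on_derive (Hf k.+1). Qed.

Lemma smooth_on_derivable f x v : smooth_on D f -> D x -> derivable f x v.
Proof. by move=> Hf; exact: Ck_on_derivable (Hf 1%N). Qed.

Lemma smooth_on_continuous f x : smooth_on D f -> D x -> {for x, continuous f}.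
Proof. by move=> Hf; exact: (Hf 0%N).1. Qed.

End SmoothFunctions.

(** * Total differentiability in the plane *)

Section PlaneDifferentiability.
Variable R : realType.
Implicit Types (u : R * R -> R) (p v : R * R).

Lemma is_derive_line u p v (t : R) : derivable u (p + t *: v) v ->
  is_derive t 1 (fun s : R => u (p + s *: v)) ('D_v u (p + t *: v)).
Proof.
move=> ud.
have E : (fun h : R => h^-1 *: ((fun s : R => u (p + s *: v)) (h *: (1 : R) + t) -
    (fun s : R => u (p + s *: v)) t)) =
    (fun h : R => h^-1 *: ((u \o shift (p + t *: v)) (h *: v) - u (p + t *: v))).
  apply: funext => h /=; have -> : h *: (1 : R) = h by rewrite /GRing.scale /= mulr1.
  by congr (_ *: (u _ - _)); rewrite scalerDl addrCA.
split; first by rewrite /derivable E.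
by rewrite /derive E.
Qed.

Lemma plane_nbhsP p (P : set (R * R)) : nbhs p P <-> exists2 r : R, 0 < r &
  forall h k, `|h| < r -> `|k| < r -> P (p.1 + h, p.2 + k).
Proof.
split=> [[[A B] /= [[a /= a0 aA] [b /= b0 bB]] ABP]|[r r0 rP]].
  exists (Num.min a b); first by rewrite lt_min a0.
  move=> h k; rewrite !lt_min => /andP[ha _] /andP[_ kb]; apply: ABP; split => /=.
    by apply: aA; rewrite /= opprD addNKr normrN.
  by apply: bB; rewrite /= opprD addNKr normrN.
exists (ball p.1 r, ball p.2 r); first by split; exact: nbhsx_ballx.
move=> [x y] [/= xr yr].
have := rP (x - p.1) (y - p.2).
by rewrite ![_ + (_ - _)]addrC !subrK; apply; rewrite distrC.
Qed.

(** The increment is split into a horizontal move at height p.2 + k, treated by the mean value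
    theorem and the continuity at p of the x-derivative, and a vertical move from p, treated by the
    definition of the y-derivative. *)
Lemma plane_expansion u p :
  (\forall y \near p, derivable u y (1, 0)) ->
  {for p, continuous ('D_(1, 0) u)} -> derivable u p (0, 1) ->
  forall e : R, 0 < e -> exists2 r : R, 0 < r & forall h k, `|h| < r -> `|k| < r ->
    `|u (p.1 + h, p.2 + k) - u p - (h * 'D_(1, 0) u p + k * 'D_(0, 1) u p)|
      <= e * (`|h| + `|k|).
Proof.
move=> ux uxc uy e e0.
have H : \forall y \near p, derivable u y (1, 0) /\
    `|'D_(1, 0) u p - 'D_(1, 0) u y| <= e.
  apply: filterS2 ux _ => [y H1 H2|]; first by split; [exact: H1|exact: H2].
  by have /cvgrPdist_le := uxc; apply.
have {H}/plane_nbhsP[r1 r10 P1] := H.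
have uy' : derivable u (p + 0 *: (0, 1)) (0, 1) by rewrite scale0r addr0.
have /is_derive_real_expansion := is_derive_line uy'.
move=> /(_ _ e0)[r2 r20 P2].
exists (Num.min r1 r2); first by rewrite lt_min r10.
move=> h k; rewrite !lt_min => /andP[hr1 hr2] /andP[kr1 kr2].
have E (s t : R) : (p.1 + s, p.2 + t) = p + s *: (1, 0) + t *: (0, 1).
  case: p {ux uxc uy P1 uy' P2} => x y.
  by apply: injective_projections; rewrite /GRing.scale /= /GRing.scale /=; ring.
have := P2 k kr2; rewrite add0r scale0r !addr0.
have -> : p + k *: (0, 1) = (p.1, p.2 + k) by have := E 0 k; rewrite scale0r !addr0.
move=> T2.
pose w (s : R) : R := u ((p.1, p.2 + k) + s *: (1, 0)).
have Ew (s : R) : (p.1, p.2 + k) + s *: (1, 0) = (p.1 + s, p.2 + k).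
  by apply: injective_projections; rewrite /GRing.scale /= /GRing.scale /=; ring.
have wd (s : R) : `|s| < r1 -> is_derive s 1 w ('D_(1, 0) u (p.1 + s, p.2 + k)).
  move=> sr; rewrite -Ew; apply: is_derive_line; rewrite Ew.
  by have [] := P1 s k sr kr1.
have T1 : `|w h - w 0 - h * 'D_(1, 0) u p| <= e * `|h|.
  have hb (s : R) : 0 <= s <= 1 -> `|s * h| < r1.
    move=> /andP[s0 s1]; rewrite normrM ger0_norm//; apply: le_lt_trans hr1.
    by rewrite ler_piMl.
  pose W (s : R) : R := w (s * h).
  have Wd (s : R) : 0 <= s <= 1 ->
      is_derive s 1 W ('D_(1, 0) u (p.1 + s * h, p.2 + k) * h).
    move=> sb; have wsh := wd _ (hb s sb).
    have hs : is_derive s 1 (fun s : R => s * h) h.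
      by apply: is_derive_eq; rewrite /GRing.scale /=; ring.
    exact: (@is_derive1_comp _ w (fun s => s * h) s _ _ wsh hs).
  have Wc : {within `[0, 1], continuous W}.
    apply: derivable_within_continuous => s; rewrite in_itv /= => sb.
    by have [] := Wd s sb.
  have Wd' (s : R) : s \in `]0, 1[%R ->
      is_derive s 1 W ('D_(1, 0) u (p.1 + s * h, p.2 + k) * h).
    by rewrite in_itv /= => /andP[s0 s1]; apply: Wd; rewrite !ltW.
  have [s sb Ws] := MVT_segment (@ler01 R) Wd' Wc.
  rewrite in_itv /= in sb.
  have -> : w h - w 0 = W 1 - W 0 by rewrite /W mul1r mul0r.
  rewrite Ws subr0 mulr1.
  have -> : 'D_(1, 0) u (p.1 + s * h, p.2 + k) * h - h * 'D_(1, 0) u p =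
    ('D_(1, 0) u (p.1 + s * h, p.2 + k) - 'D_(1, 0) u p) * h by ring.
  rewrite normrM ler_wpM2r// distrC.
  by have [] := P1 _ k (hb s sb) kr1.
rewrite /w !Ew addr0 in T1.
have -> : u (p.1 + h, p.2 + k) - u p - (h * 'D_(1, 0) u p + k * 'D_(0, 1) u p) =
  (u (p.1 + h, p.2 + k) - u (p.1, p.2 + k) - h * 'D_(1, 0) u p) +
  (u (p.1, p.2 + k) - u p - k * 'D_(0, 1) u p) by ring.
by rewrite mulrDr (le_trans (ler_normD _ _))// lerD.
Qed.

End PlaneDifferentiability.

Section HarmonicForms.
Variable R : realType.
Local Notation C := (cline R).
Implicit Types (u v : R * R -> R) (O : set C) (z : C).

Definition plane z : R * R := (complex.Re z, complex.Im z).

Lemma cplxK p : plane (cplx p) = p. Proof. by case: p. Qed.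

Lemma planeK z : cplx (plane z) = z. Proof. by case: z. Qed.

Lemma open_cplx_preimage O : open O -> open (@cplx R @^-1` O).
Proof. by move=> Oo; apply: open_comp => // p _; exact: cplx_continuous. Qed.

Definition cfun u v : C -> C := fun z => u (plane z) +i* v (plane z).

Lemma smooth_wderive O u v z : open O -> O z ->
  smooth_on (@cplx R @^-1` O) u -> smooth_on (@cplx R @^-1` O) v ->
  let fx := cfun ('D_(1, 0) u) ('D_(1, 0) v) z in
  let fy := cfun ('D_(0, 1) u) ('D_(0, 1) v) z in
  is_wderive (cfun u v) z ((2^-1)%:C * (fx - 'i * fy)) ((2^-1)%:C * (fx + 'i * fy)).
Proof.
move=> /open_cplx_preimage Oo Oz us vs fx fy e e0.
have Dz : (@cplx R @^-1` O) (plane z) by rewrite /preimage /= planeK.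
have nD : \forall y \near plane z, (@cplx R @^-1` O) y.
  exact: open_nbhs_nbhs (conj Oo Dz).
have ex (h : R * R -> R) : smooth_on (@cplx R @^-1` O) h -> forall e, 0 < e ->
    exists2 r : R, 0 < r & forall s t, `|s| < r -> `|t| < r ->
    `|h (complex.Re z + s, complex.Im z + t) - h (plane z) -
      (s * 'D_(1, 0) h (plane z) + t * 'D_(0, 1) h (plane z))|
      <= e * (`|s| + `|t|).
  move=> hs; apply: (@plane_expansion _ h (plane z)).
  - by apply: filterS nD => y Dy; exact: (smooth_on_derivable hs Dy).
  - exact: (smooth_on_continuous (smooth_on_derive ((1, 0) : R * R) hs) Dz).
  - exact: (smooth_on_derivable hs Dz).
have e4 : 0 < e / 4 by rewrite divr_gt0.
have [r1 r10 P1] := ex u us _ e4; have [r2 r20 P2] := ex v vs _ e4.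
exists (Num.min r1 r2); first by rewrite lt_min r10.
move=> h; rewrite lt_min => /andP[hr1 hr2].
have Rh := Re_le_cabs h; have Ih := Im_le_cabs h.
have T1 := P1 _ _ (le_lt_trans Rh hr1) (le_lt_trans Ih hr1).
have T2 := P2 _ _ (le_lt_trans Rh hr2) (le_lt_trans Ih hr2).
apply: le_trans (cabs_le_ReIm _) _.
set X := complex.Re _; set Y := complex.Im _.
have -> : X = u (complex.Re z + complex.Re h, complex.Im z + complex.Im h) -
    u (plane z) - (complex.Re h * 'D_(1, 0) u (plane z) +
      complex.Im h * 'D_(0, 1) u (plane z)).
  rewrite /X /fx /fy /cfun /plane; case: (z) (h) => [z1 z2] [h1 h2] /=.
  move: ('D_(1, 0) u _) ('D_(0, 1) u _) ('D_(1, 0) v _) ('D_(0, 1) v _) (u _) (u _).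
  by move=> *; field.
have -> : Y = v (complex.Re z + complex.Re h, complex.Im z + complex.Im h) -
    v (plane z) - (complex.Re h * 'D_(1, 0) v (plane z) +
      complex.Im h * 'D_(0, 1) v (plane z)).
  rewrite /Y /fx /fy /cfun /plane; case: (z) (h) => [z1 z2] [h1 h2] /=.
  move: ('D_(1, 0) u _) ('D_(0, 1) u _) ('D_(1, 0) v _) ('D_(0, 1) v _) (v _) (v _).
  by move=> *; field.
apply: le_trans (lerD T1 T2) _.
have -> : e * cabs h = e / 4 * (cabs h + cabs h) + e / 4 * (cabs h + cabs h) by field.
by rewrite lerD// ler_wpM2l ?(ltW e4)// lerD.
Qed.

(** The second derivative is part of the notion: the second order expansion behind
    [no_interior_maximum] takes it as a datum. *)
Definition holomorphic2 O (f : C -> C) := exists f1 f2 : C -> C, forall z, O z ->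
  is_derive z 1 f (f1 z) /\ is_derive z 1 f1 (f2 z).

(** The derivative f1 = f_x has the primitive f, and is real differentiable because u and v are
    smooth; [cderive_is_cderivable] turns this into complex differentiability of f1. *)
Lemma cauchy_riemann_holomorphic2 O u v : open O ->
  smooth_on (@cplx R @^-1` O) u -> smooth_on (@cplx R @^-1` O) v ->
  (forall z, O z -> 'D_(1, 0) u (plane z) = 'D_(0, 1) v (plane z)) ->
  (forall z, O z -> 'D_(0, 1) u (plane z) = - 'D_(1, 0) v (plane z)) ->
  holomorphic2 O (cfun u v).
Proof.
move=> Oo us vs cr1 cr2.
have ux := smooth_on_derive ((1, 0) : R * R) us; have vx := smooth_on_derive ((1, 0) : R * R) vs.
pose f1 := cfun ('D_(1, 0) u) ('D_(1, 0) v).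
pose f2 z := (2^-1)%:C * (cfun ('D_(1, 0) ('D_(1, 0) u)) ('D_(1, 0) ('D_(1, 0) v)) z -
  'i * cfun ('D_(0, 1) ('D_(1, 0) u)) ('D_(0, 1) ('D_(1, 0) v)) z).
have fd z : O z -> is_derive z 1 (cfun u v) (f1 z).
  move=> Oz; apply/is_wderive0; have := smooth_wderive Oo Oz us vs.
  have E : 'i * cfun ('D_(0, 1) u) ('D_(0, 1) v) z = - f1 z.
    rewrite /f1 /cfun -cr1// cr2//; apply/eqP; rewrite eq_complex /=.
    by apply/andP; split; apply/eqP; ring.
  rewrite /= E -/(f1 z) subrr mulr0 opprK.
  have -> : (2^-1)%:C * (f1 z + f1 z) = f1 z :> C; last by [].
  by case: (f1 z) => x y; apply/eqP; rewrite eq_complex /=; apply/andP; split; apply/eqP; field.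
exists f1, f2 => z Oz; split; first exact: fd.
have wd := smooth_wderive Oo Oz ux vx.
have [r r0 rO] : exists2 r : R, 0 < r & forall h : C, cabs h < r -> O (z + h).
  by apply/cline_nbhsP; exact: open_nbhs_nbhs (conj Oo Oz).
have fr (h : C) : cabs h < r -> is_derive (z + h) 1 (cfun u v) (f1 (z + h)).
  by move=> /rO; exact: fd.
have B0 := cderive_is_cderivable r0 fr wd.
by apply/is_wderive0; move: wd; rewrite /= B0.
Qed.

Variables (O : set C) (lam : C -> R) (w : C -> C * C).
Let D := @cplx R @^-1` O.
Let a p := complex.Re (w (cplx p)).1.
Let b p := complex.Re (w (cplx p)).2.
Let l p := lam (cplx p).

(* With w = a dx + b dy, the coefficient of the (1, 0)-part of w is form10 / 2,
   and holomorphy of (delta w) - i (star d w) expresses harmonicity. *)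
Definition form10 : C -> C :=
  fun z => complex.Re (w z).1 +i* - complex.Re (w z).2.
Definition curvature : C -> C :=
  fun z => complex.Re (codiff1 lam w z) +i* - complex.Re (star2 lam (ext_d1 w) z).

Hypotheses (Oo : open O) (a_smooth : smooth_on D a) (b_smooth : smooth_on D b)
  (l_smooth : smooth_on D l) (lam_gt0 : forall z, O z -> 0 < lam z).

Let Do : open D. Proof. exact: open_cplx_preimage. Qed.

Let Re_div (x : C) (y : R) : complex.Re (x / y%:C) = complex.Re x / y.
Proof.
case: x => x1 x2; have [->|y0] := eqVneq y 0.
  by rewrite rmorph0 !invr0 !mulr0.
by rewrite -fmorphV /= mulr0 subr0.
Qed.

Let ReN (x : C) : complex.Re (- x) = - complex.Re x. Proof. by case: x. Qed.

Let ReD (x y : C) : complex.Re (x + y) = complex.Re x + complex.Re y.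
Proof. by case: x y => [? ?] [? ?]. Qed.

(** For the real parts a and b, delta w = - D1 / lambda and - star d w = D2 / lambda, while D1 + i
    D2 is twice the zbar-derivative of [form10]. *)
Let D1 := fun p => 'D_(1, 0) a p + 'D_(0, 1) b p.
Let D2 := fun p => 'D_(0, 1) a p - 'D_(1, 0) b p.

Let codiffE p : D p -> complex.Re (codiff1 lam w (cplx p)) = - (D1 p / l p).
Proof.
move=> Dp; rewrite /codiff1 /star2.
rewrite ReN Re_div /ext_d1; congr (- (_ / _)).
rewrite ReD ReN /dX /dY /partial /= -[(p.1, p.2)]/(plane (cplx p)) cplxK /D1.
congr (_ + _).
have -> : (fun q => complex.Re (- (w (cplx q)).2)) = (fun q => - b q).
  by apply: funext => q; rewrite ReN.
by rewrite (deriveN (smooth_on_derivable b_smooth Dp)) opprK.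
Qed.

Let curlE p : D p -> - complex.Re (star2 lam (ext_d1 w) (cplx p)) = D2 p / l p.
Proof.
move=> Dp; rewrite /star2 Re_div -mulNr; congr (_ / _).
rewrite /ext_d1 ReD ReN /dX /dY /partial /= -[(p.1, p.2)]/(plane (cplx p)) cplxK.
by rewrite opprB.
Qed.

Let l0 p : D p -> l p != 0. Proof. by move=> /lam_gt0 lp; rewrite /l gt_eqF. Qed.

Let D1_smooth : smooth_on D D1.
Proof. by apply: smooth_onD => //; apply: smooth_on_derive. Qed.

Let D2_smooth : smooth_on D D2.
Proof. by apply: smooth_onD => //; last apply: smooth_onN => //; apply: smooth_on_derive. Qed.

Let lV_smooth : smooth_on D (fun p => (l p)^-1).
Proof. exact: smooth_onV. Qed.

Lemma curvature_smooth :
  smooth_on D (fun p => complex.Re (codiff1 lam w (cplx p))) /\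
  smooth_on D (fun p => - complex.Re (star2 lam (ext_d1 w) (cplx p))).
Proof.
split.
  have := smooth_onN Do (smooth_onM Do D1_smooth lV_smooth).
  by apply: smooth_on_ext => // p Dp; rewrite codiffE.
have := smooth_onM Do D2_smooth lV_smooth.
by apply: smooth_on_ext => // p Dp; rewrite curlE.
Qed.

(** With F = delta w and H = star d w, the two components of the Laplacian are F_x + H_y and F_y -
    H_x; their vanishing is the Cauchy-Riemann system of F - i H. *)
Lemma harmonic_curvature_holomorphic :
  (forall z, O z -> hodge_laplacian lam w z = 0) -> holomorphic2 O curvature.
Proof.
move=> harm; have [us vs] := curvature_smooth.
pose U (p : R * R) := complex.Re (codiff1 lam w (cplx p)).
pose V (p : R * R) := - complex.Re (star2 lam (ext_d1 w) (cplx p)).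
have VE : (fun p => complex.Re (star2 lam (ext_d1 w) (cplx p))) = (fun p => - V p).
  by apply: funext => p; rewrite opprK.
have -> : curvature = cfun U V by apply: funext => z; rewrite /cfun /U /V planeK.
have Dz z : O z -> D (plane z) by rewrite /D /preimage /= planeK.
pose F := codiff1 lam w; pose H := star2 lam (ext_d1 w).
have E1 z : (hodge_laplacian lam w z).1 = dX F z - (- dY H z) by [].
have E2 z : (hodge_laplacian lam w z).2 = dY F z - dX H z by [].
pose K p := complex.Re (H (cplx p)).
have KE : K = (fun p => - V p) by exact: VE.
have R1 z : complex.Re (hodge_laplacian lam w z).1 =
    'D_(1, 0) U (plane z) + 'D_(0, 1) K (plane z).
  by rewrite E1 ReD !ReN opprK; congr (_ + _).
have R2 z : complex.Re (hodge_laplacian lam w z).2 =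
    'D_(0, 1) U (plane z) - 'D_(1, 0) K (plane z).
  by rewrite E2 ReD !ReN; congr (_ - _).
have dK z (e : R * R) : O z -> 'D_e K (plane z) = - 'D_e V (plane z).
  by rewrite KE => /Dz Dpz; exact: (deriveN (smooth_on_derivable vs Dpz)).
have harm1 z : O z -> complex.Re (hodge_laplacian lam w z).1 = 0 by move=> /harm ->.
have harm2 z : O z -> complex.Re (hodge_laplacian lam w z).2 = 0 by move=> /harm ->.
have T1 (x y t s : R) : s = x + y -> s = 0 -> y = - t -> x = t.
  by move=> -> + yt; rewrite yt => /eqP; rewrite subr_eq0 => /eqP.
have T2 (x y t s : R) : s = x - y -> s = 0 -> y = - t -> x = - t.
  by move=> -> + yt; rewrite yt opprK => /eqP; rewrite addr_eq0 => /eqP.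
have cr1 z : O z -> 'D_(1, 0) U (plane z) = 'D_(0, 1) V (plane z).
  by move=> Oz; exact: (T1 _ _ _ _ (R1 z) (harm1 z Oz) (dK z _ Oz)).
have cr2 z : O z -> 'D_(0, 1) U (plane z) = - 'D_(1, 0) V (plane z).
  by move=> Oz; exact: (T2 _ _ _ _ (R2 z) (harm2 z Oz) (dK z _ Oz)).
exact: (cauchy_riemann_holomorphic2 Oo us vs cr1 cr2).
Qed.

(** This prepares the invariance of [curvature]: a change of charts multiplies the zbar-derivative
    of [form10] by |D|^2, and lambda as well, so that their quotient is a function on L. *)
Lemma form10_wderive z : O z -> exists A : C,
  is_wderive form10 z A (- (lam z / 2)%:C * (curvature z)^*%C).
Proof.
move=> Oz; have Dz : D (plane z) by rewrite /D /preimage /= planeK.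
have bN := smooth_onN Do b_smooth.
have -> : form10 = cfun a (fun p => - b p).
  by apply: funext => y; rewrite /cfun /a /b planeK.
have := smooth_wderive Oo Oz a_smooth bN; rewrite /=.
set A := _ * (_ - _); set B := _ * (_ + _) => wd; exists A.
suff <- : B = - (lam z / 2)%:C * (curvature z)^*%C by [].
have c1 := codiffE Dz; have c2 := curlE Dz; rewrite planeK in c1 c2.
rewrite /curvature c1 c2.
have lz : lam z = l (plane z) by rewrite /l planeK.
have lz0 := l0 Dz.
rewrite /B /cfun !(deriveN (smooth_on_derivable b_smooth Dz)) lz /D1 /D2.
move: ('D_(1, 0) a _) ('D_(0, 1) a _) ('D_(1, 0) b _) ('D_(0, 1) b _) (l _) lz0.
move=> ax ay bx by_ l' l'0; apply/eqP; rewrite eq_complex /=.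
by apply/andP; split; apply/eqP; field.
Qed.

Lemma form10_holomorphic :
  (forall z, O z -> curvature z = 0) -> holomorphic2 O form10.
Proof.
move=> curv0; have bN := smooth_onN Do b_smooth.
have Dz z : O z -> D (plane z) by rewrite /D /preimage /= planeK.
have -> : form10 = cfun a (fun p => - b p).
  by apply: funext => y; rewrite /cfun /a /b planeK.
have db z (e : R * R) : O z -> 'D_e (fun p => - b p) (plane z) = - 'D_e b (plane z).
  by move=> /Dz Dpz; exact: (deriveN (smooth_on_derivable b_smooth Dpz)).
have D0 z : O z -> D1 (plane z) = 0 /\ D2 (plane z) = 0.
  move=> Oz; have c1 := codiffE (Dz z Oz); have c2 := curlE (Dz z Oz).
  rewrite planeK in c1 c2; have := curv0 z Oz.
  rewrite /curvature c1 c2 => -[/eqP + /eqP].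
  by rewrite oppr_eq0 !mulf_eq0 invr_eq0 !(negbTE (l0 (Dz z Oz))) !orbF => /eqP -> /eqP ->.
have T1 (x y y' : R) : x + y = 0 -> y' = - y -> x = y'.
  by move=> /eqP; rewrite addr_eq0 => /eqP -> ->.
have T2 (x y y' : R) : x - y = 0 -> y' = - y -> x = - y'.
  by move=> /eqP; rewrite subr_eq0 => /eqP -> ->; rewrite opprK.
have cr1 z : O z -> 'D_(1, 0) a (plane z) = 'D_(0, 1) (fun p => - b p) (plane z).
  by move=> Oz; exact: (T1 _ _ _ (D0 z Oz).1 (db z _ Oz)).
have cr2 z : O z -> 'D_(0, 1) a (plane z) = - 'D_(1, 0) (fun p => - b p) (plane z).
  by move=> Oz; exact: (T2 _ _ _ (D0 z Oz).2 (db z _ Oz)).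
exact: (cauchy_riemann_holomorphic2 Oo a_smooth bN cr1 cr2).
Qed.

End HarmonicForms.

(** * Finite dimension *)

Section Net.
Variables (R : realType) (p : nat) (p_pr : prime p) (m : nat).
Variables (L : topologicalType) (N : nat) (A : 'I_N -> lchart R p_pr m L).
Local Notation C := (cline R).
Local Notation Zpm := (zpm p_pr m).
Hypotheses (L_compact : compact [set: L]) (A_atlas : is_atlas A).

Lemma cdiscE (c : lchart R p_pr m L) (z : C) :
  cdisc c z <-> cabs (z - ccenter c) < cradius c.
Proof. by rewrite /cdisc /= cabsE ltcR. Qed.

Lemma open_cball (w : C) (r : R) : open [set y : C | cabs (y - w) < r].
Proof.
have -> : [set y : C | cabs (y - w) < r] =
    (fun z : C => cabs (z - w)) @^-1` [set x | x < r] by [].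
by apply: open_comp => // z _; exact: cabs_dist_continuous.
Qed.

Lemma open_cdisc (c : lchart R p_pr m L) : open (cdisc c).
Proof.
have -> : cdisc c = [set z : C | cabs (z - ccenter c) < cradius c].
  by apply/seteqP; split => z /cdiscE.
exact: open_cball.
Qed.

Definition in_core (s : R) (i : 'I_N) (l : L) :=
  cdom (A i) l /\ cabs ((cmap (A i) l).1 - ccenter (A i)) <= s * cradius (A i).

(** Each point lies strictly inside the disc of some chart, hence in its core of factor n / (n + 1)
    for n large, and so do the nearby points; [compact_near_coveringP] makes n uniform. *)
Lemma core_cover : exists s : R, [/\ 0 <= s, s < 1 & forall l, exists i, in_core s i l].
Proof.
have [charts cover _] := A_atlas.
pose P (n : nat) (l : L) := exists i, in_core (n%:R / n.+1%:R) i l.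
have Pnear : \forall n \near \oo, [set: L] `<=` P n.
  move/compact_near_coveringP : L_compact; apply => l _.
  have [i _ il] : (\bigcup_j cdom (A j)) l by rewrite cover.
  have [[odom r0] dom_cod _ cmap_cont _] := charts i.
  have [[/cdiscE zr _] _] := dom_cod l il.
  set z := (cmap (A i) l).1 in zr.
  pose r := cradius (A i); rewrite -/r in zr r0.
  have z0 := cabs_ge0 (z - ccenter (A i)).
  pose t := (cabs (z - ccenter (A i)) + r) / 2.
  have tr : t < r by rewrite ltr_pdivrMr//; lra.
  have zt : cabs (z - ccenter (A i)) < t by rewrite ltr_pdivlMr//; lra.
  have near_l : \forall l' \near l, cdom (A i) l' /\
      cabs ((cmap (A i) l').1 - ccenter (A i)) < t.
    near=> l'; split.
      by near: l'; exact: open_nbhs_nbhs.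
    near: l'.
    have cc : {for l, continuous (fun l' => (cmap (A i) l').1 : C)}.
      apply: (@continuous_comp _ _ _ (cmap (A i)) (fun x => x.1 : C)).
        exact: cmap_cont.
      by move=> ?; exact: cvg_fst.
    have nb : nbhs ((cmap (A i) l).1 : C) [set y : C | cabs (y - ccenter (A i)) < t].
      by apply: open_nbhs_nbhs; split; [exact: open_cball|exact: zt].
    exact: (cc _ nb).
  (* The inequality t <= r n / (n + 1) amounts to t / (r - t) <= n. *)
  pose k := (Num.bound (t / (r - t))).
  exists ([set l' | cdom (A i) l' /\ cabs ((cmap (A i) l').1 - ccenter (A i)) < t],
          [set n | (k <= n)%N]).
    by split; [exact: near_l|exists k].
  move=> [l' n] [/= [l'i l't] kn]; exists i; split => //; apply: ltW.
  apply: lt_le_trans l't _.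
  have rt0 : 0 < r - t by rewrite subr_gt0.
  have : t / (r - t) < n%:R.
    apply: lt_le_trans (_ : k%:R <= _); last by rewrite ler_nat.
    by apply: archi_boundP; rewrite divr_ge0 ?(ltW rt0)// divr_ge0// addr_ge0// ltW.
  rewrite ltr_pdivrMr// => H.
  rewrite mulrAC ler_pdivlMr// -natr1; rewrite -/r; lra.
have [n _ Pn] := Pnear.
exists (n%:R / n.+1%:R); split; first by rewrite divr_ge0.
  by rewrite ltr_pdivrMr// mul1r ltr_nat.
by move=> l; exact: (Pn n (leqnn n) l).
Unshelve. all: by end_near. Qed.

(* The Hoelder estimate makes the evaluation at the points of a fine net of the
   compact cores of the charts injective. *)
Lemma finite_determining_net (rho : 'I_N -> C -> R) :
  (forall i z, cdisc (A i) z -> 0 < rho i z /\ {for z, continuous (rho i)}) ->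
  exists P : seq ('I_N * C), (forall x, x \in P -> cdisc (A x.1) x.2) /\
  forall phi : 'I_N -> C -> C,
    (forall i, holomorphic2 (cdisc (A i)) (phi i)) ->
    (forall i j l, cdom (A i) l -> cdom (A j) l ->
       cabs (phi i (cmap (A i) l).1) ^+ 2 * rho j (cmap (A j) l).1 =
       cabs (phi j (cmap (A j) l).1) ^+ 2 * rho i (cmap (A i) l).1) ->
    (forall x, x \in P -> phi x.1 x.2 = 0) ->
    forall i z, cdisc (A i) z -> phi i z = 0.
Proof.
move=> rhoP; have [s [s0 s1 cover]] := core_cover.
have [charts _ _] := A_atlas.
pose r i := cradius (A i); pose c i := ccenter (A i).
have r0 i : 0 < r i by have [[]] := charts i.
pose K t i := [set z : C | cabs (z - c i) <= t * r i].
have KC t i z : t < 1 -> K t i z -> cdisc (A i) z.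
  move=> t1 zK; apply/cdiscE; apply: le_lt_trans zK _.
  by rewrite gtr_pMl.
have Kc i t : 0 <= t -> K t i (c i).
  by move=> t0; rewrite /K /= subrr cabs0 mulr_ge0// ltW.
have extr (i : 'I_N) t (h : C -> R) : 0 <= t -> t < 1 ->
    (forall z, cdisc (A i) z -> {for z, continuous h}) ->
    exists2 y, K t i y & forall z, K t i z -> h z <= h y.
  move=> t0 t1 hc; have hK : {within K t i, continuous h}.
    by apply: continuous_in_subspaceT => z /[!inE] /(KC _ _ _ t1); exact: hc.
  have K0 : K t i !=set0 by exists (c i); exact: Kc.
  have [y /[!inE] yK ymax] := compact_EVT_max K0 (@cdisc_compact R (c i) (t * r i)) hK.
  by exists y => // z zK; apply: ymax; rewrite inE.
(* The closed discs of the larger factor s' leave a room of [d i] around every point of a core, on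
   which the density is still bounded. *)
pose s' := (1 + s) / 2.
have ss' : s < s' by rewrite ltr_pdivlMr//; lra.
have s'1 : s' < 1 by rewrite ltr_pdivrMr//; lra.
have s'0 : 0 <= s' by rewrite (le_trans s0)// ltW.
have /choice[Lam LamP] : forall i, exists M, 0 < M /\ forall z, K s' i z -> rho i z <= M.
  move=> i; have [y yK ymax] := extr i s' (rho i) s'0 s'1 (fun z zi => (rhoP i z zi).2).
  by exists (rho i y); split=> //; exact: (rhoP i y (KC _ _ _ s'1 yK)).1.
have /choice[mu muP] : forall i, exists M, 0 < M /\ forall z, K s i z -> M <= rho i z.
  move=> i; have hc z : cdisc (A i) z -> {for z, continuous (fun z => - rho i z)}.
    by move=> zi; apply: (@continuousN _ _ _ (rho i)); exact: (rhoP i z zi).2.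
  have [y yK ymax] := extr i s _ s0 s1 hc.
  exists (rho i y); split; first exact: (rhoP i y (KC _ _ _ s1 yK)).1.
  by move=> z /ymax; rewrite lerN2.
have Lam0 i : 0 < Lam i by exact: (LamP i).1.
have mu0 i : 0 < mu i by exact: (muP i).1.
pose d i := (s' - s) * r i.
have d0 i : 0 < d i by rewrite mulr_gt0// subr_gt0.
(* The mesh is chosen for [bd_half]: the Hoelder bound 4 M Lam eps / d is then exactly M mu / 2. *)
pose eps i := d i * mu i / (8 * Lam i).
have eps0 i : 0 < eps i.
  by apply: divr_gt0; apply: mulr_gt0.
have eps_le i : eps i <= d i.
  rewrite /eps ler_pdivrMr; last by apply: mulr_gt0.
  rewrite ler_pM2l//.
  have := (muP i).2 _ (Kc i s s0); have := (LamP i).2 _ (Kc i s' s'0).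
  by have := (LamP i).1; lra.
have /choice[Q QP] : forall i, exists Q : seq C, (forall w, w \in Q -> K s i w) /\
    forall z, K s i z -> exists2 w, w \in Q & cabs (z - w) < eps i.
  move=> i; have := @cdisc_compact R (c i) (s * r i); rewrite -/(K s i) compact_cover.
  move=> /(_ C (K s i) (fun w => [set y : C | cabs (y - w) < eps i])).
  case=> [w _||Q QK KQ].
  - exact: open_cball.
  - by move=> z zK; exists z => //=; rewrite subrr cabs0.
  exists (finmap.enum_fset Q); split=> [w wQ|z /KQ[w wQ wz]]; last by exists w.
  by have := QK w wQ; rewrite inE.
exists (flatten [seq [seq (i, w) | w <- Q i] | i <- enum 'I_N]); split.
  move=> x /flatten_mapP[i _ /mapP[w wQ ->]] /=.
  by apply: KC s1 _; exact: (QP i).1.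
move=> phi phi_hol phi_inv phi0.
have {}phi0 i w : w \in Q i -> phi i w = 0.
  move=> wQ; apply: (phi0 (i, w)); apply/flatten_mapP; exists i.
    by rewrite mem_enum.
  by apply/mapP; exists w.
have lift i z : cdisc (A i) z -> exists j l, [/\ in_core s j l, cdom (A i) l &
    (cmap (A i) l).1 = z].
  move=> zi; have [_ _ cod_dom _ _] := charts i.
  have [l_dom lE] := cod_dom (z, 0) (conj zi I).
  have [j jl] := cover (cinv (A i) (z, 0)).
  by exists j, (cinv (A i) (z, 0)); split=> //; rewrite lE.
pose bd M := forall i z, K s i z -> cabs (phi i z) ^+ 2 <= M * rho i z.
(* The quotient |phi|^2 / rho has the same value in all charts and each point is in the core of one
   of them, so a bound on the cores extends to the whole discs. *)
have bd_all M i z : bd M -> cdisc (A i) z -> cabs (phi i z) ^+ 2 <= M * rho i z.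
  move=> bM zi; have [j [l [[jl jK] il <-]]] := lift i z zi.
  have [_ dom_cod _ _ _] := charts j; have [[jd _] _] := dom_cod l jl.
  have rj := (rhoP j _ jd).1.
  have ri : 0 < rho i (cmap (A i) l).1.
    have [_ dom_cod' _ _ _] := charts i; have [[id _] _] := dom_cod' l il.
    exact: (rhoP i _ id).1.
  rewrite -(ler_pM2r rj) (phi_inv i j l il jl).
  by rewrite [leRHS]mulrAC ler_pM2r//; exact: bM.
(* Near a net point w, where phi vanishes, [schwarz_hoelder] on the disc of radius [d i] improves M
   to M / 2 at distance less than [eps i]. *)
have bd_half M : 0 <= M -> bd M -> bd (M / 2).
  move=> M0 bM i z zK.
  have [w wQ zw] := (QP i).2 z zK; have wK := (QP i).1 w wQ.
  have [f1 [f2 fd]] := phi_hol i.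
  have near_w (y : C) t : cabs (y - w) <= t * r i -> K (s + t) i y.
    move=> yw; rewrite /K /= mulrDl.
    have -> : y - c i = (y - w) + (w - c i) by rewrite addrA subrK.
    by apply: le_trans (cabsD _ _) _; rewrite addrC lerD.
  pose r' := (1 - s) * r i.
  have dr' : d i < r' by rewrite /d /r' ltr_pM2r//; lra.
  have wr (y : C) : cabs (y - w) < r' -> cdisc (A i) y.
    move=> yw; apply/cdiscE.
    have -> : y - ccenter (A i) = (y - w) + (w - c i) by rewrite addrA subrK.
    apply: le_lt_trans (cabsD _ _) _.
    by have := wK; rewrite /K /= => wK'; move: yw; rewrite /r' -/(r i); lra.
  have fd1 (y : C) : cabs (y - w) < r' -> is_derive y 1 (phi i) (f1 y).
    by move=> /wr /fd[].
  have fd2 (y : C) : cabs (y - w) < r' -> is_derive y 1 f1 (f2 y).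
    by move=> /wr /fd[].
  have fM (y : C) : cabs (y - w) <= d i -> cabs (phi i y) ^+ 2 <= M * Lam i.
    move=> yw; have yK : K s' i y.
      by rewrite (_ : s' = s + (s' - s)); [exact: near_w|rewrite addrC subrK].
    apply: le_trans (bd_all M i y bM (KC _ _ _ s'1 yK)) _.
    by rewrite ler_wpM2l// (LamP i).2.
  have zd : cabs (z - w) <= d i by rewrite (le_trans (ltW zw)).
  have := schwarz_hoelder (d0 i) dr' fd1 fd2 fM zd.
  rewrite (phi0 i w wQ) subr0 => H.
  have H1 : 4 * (M * Lam i) * cabs (z - w) <= 4 * (M * Lam i) * eps i.
    by rewrite ler_wpM2l ?(ltW zw)// !mulr_ge0// ltW.
  have H2 : 4 * (M * Lam i) * eps i = d i * (M / 2 * mu i).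
    by rewrite /eps; field; rewrite gt_eqF.
  have H3 : d i * cabs (phi i z) ^+ 2 <= d i * (M / 2 * mu i).
    by rewrite -H2 (le_trans H).
  rewrite ler_pM2l// in H3; apply: le_trans H3 _.
  by rewrite ler_wpM2l ?divr_ge0// (muP i).2.
(* A first bound exists on each core by compactness; the sum of the B i is one that serves all the
   charts. *)
have [M M0 bM] : exists2 M, 0 <= M & bd M.
  have /choice[B BP] : forall i, exists B, 0 <= B /\
      forall z, K s i z -> cabs (phi i z) ^+ 2 <= B * rho i z.
    move=> i; have [f1 [f2 fd]] := phi_hol i.
    pose h (z : C) : R := cabs (phi i z) * cabs (phi i z).
    have hc z : cdisc (A i) z -> {for z, continuous h}.
      move=> /fd[/cderive_continuous/cabs_comp_continuous fc _].
      exact: (@continuousM _ _ (fun z => cabs (phi i z)) (fun z => cabs (phi i z)) z fc fc).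
    have [y yK ymax] := extr i s h s0 s1 hc.
    have hy0 : 0 <= h y by rewrite mulr_ge0 ?cabs_ge0.
    exists (h y / mu i); split; first by rewrite divr_ge0// ltW.
    move=> z zK; apply: le_trans (ymax z zK) _.
    have hm : 0 <= h y / mu i by rewrite divr_ge0// ltW.
    apply: le_trans (ler_wpM2l hm ((muP i).2 z zK)).
    by rewrite divfK// gt_eqF.
  exists (\sum_i B i); first by apply: sumr_ge0 => i _; exact: (BP i).1.
  move=> i z zK; apply: le_trans ((BP i).2 z zK) _.
  have ri := (rhoP i z (KC _ _ _ s1 zK)).1.
  rewrite ler_pM2r// (bigD1 i)//= lerDl.
  by apply: sumr_ge0 => j _; exact: (BP j).1.
have bMn n : bd (M / 2 ^+ n).
  elim: n => [|n IHn]; first by rewrite expr0 divr1.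
  rewrite exprSr invfM mulrA; apply: bd_half => //.
  by rewrite divr_ge0// exprn_ge0.
move=> i z zi; apply/eqP; rewrite -cabs_eq0 -sqrf_eq0 eq_le sqr_ge0 andbT.
have ri := (rhoP i z zi).1.
rewrite leNgt; apply/negP => pos.
have [n nP] : exists n, M * rho i z / (cabs (phi i z) ^+ 2) < n%:R.
  exists (Num.bound (M * rho i z / (cabs (phi i z) ^+ 2))).
  by apply: archi_boundP; rewrite divr_ge0 ?(ltW pos)// mulr_ge0// ltW.
have := bd_all _ i z (bMn n) zi; apply/negP; rewrite -ltNge.
rewrite mulrAC ltr_pdivrMr ?exprn_gt0// [ltRHS]mulrC -ltr_pdivrMr//.
apply: lt_le_trans nP _; rewrite -natrX ler_nat.
exact: ltnW (ltn_expl _ _).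
Qed.

End Net.

(** * Changes of charts *)

Section Transitions.
Variables (R : realType) (p : nat) (p_pr : prime p) (m : nat).
Variables (L : topologicalType) (N : nat) (A : 'I_N -> lchart R p_pr m L).
Local Notation C := (cline R).
Local Notation Zpm := (zpm p_pr m).
Hypothesis A_atlas : is_atlas A.

(** The same H and its derivative are described at all points of the plaque near l, and not at l
    alone, because [wderive_pullback] works on circles. *)
Lemma holomorphic_transition i j l : cdom (A i) l -> cdom (A j) l ->
  let z := (cmap (A j) l).1 in
  let pt (y : C) := cinv (A j) (y, (cmap (A j) l).2) in
  exists (r : R) (H : C -> C), 0 < r /\ forall h : C, cabs h < r ->
    [/\ cdom (A i) (pt (z + h)), cdom (A j) (pt (z + h)),
        (cmap (A j) (pt (z + h))).1 = z + h,
        (cmap (A i) (pt (z + h))).1 = H (z + h) &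
        is_derive (z + h) 1 H (leaf_deriv A i j id (pt (z + h)))].
Proof.
move=> il jl z pt; have [charts _ compat] := A_atlas.
have [ O [H [M [B [[Oo OE] Hhol _ HE]]]]] := compat i j.
have OP y : O y -> [/\ cdom (A i) (pt y), cdom (A j) (pt y) &
    cmap (A j) (pt y) = (y, (cmap (A j) l).2)].
  move=> Oy; have : (O `*` setT) (y, (cmap (A j) l).2) by [].
  rewrite -OE => -[l' [l'i l'j] l'E].
  have [_ dom_cod _ _ _] := charts j; have [_ l'K] := dom_cod l' l'j.
  by rewrite /pt -l'E l'K.
have Oz : O z.
  have : (O `*` setT) (cmap (A j) l) by rewrite -OE; exists l.
  by case.
have [r r0 rO] : exists2 r : R, 0 < r & forall h : C, cabs h < r -> O (z + h).
  by apply/cline_nbhsP; exact: open_nbhs_nbhs (conj Oo Oz).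
exists r, H; split; first exact: r0.
move=> h hr; have Oh := rO h hr; have [h1 h2 h3] := OP _ Oh.
have H4 y : O y -> (cmap (A i) (pt y)).1 = H y by move=> Oy; rewrite /pt HE.
split; [exact: h1|exact: h2|by rewrite h3|exact: H4|].
have -> : leaf_deriv A i j id (pt (z + h)) = 'D_1 H (z + h).
  rewrite /leaf_deriv h3 /= derive1E.
  apply: near_eq_derive; have nO := open_nbhs_nbhs (conj Oo Oh).
  by apply: filterS nO => y; exact: H4.
by apply: derivableP; exact: Hhol.
Qed.

(** Invariance under i gives h 1 i = h i (-1) = - h 1 i, so 1 and i are orthogonal of equal length:
    h is a multiple of the Euclidean metric. *)
Lemma hermitian_norm (h : C -> C -> R) (d : C) : hermitian_metric h ->
  h d d = cabs d ^+ 2 * h 1 1 /\ 0 < h 1 1.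
Proof.
move=> [hC hlin hJ hpos]; split; last by apply: hpos; exact: oner_neq0.
have hlinr (a : R) u v v' : h u (a%:C * v + v') = a * h u v + h u v'.
  by rewrite hC hlin hC [h v' u]hC.
have h0 u : h 0 u = 0.
  by have := hlin 1 0 0 u; rewrite mulr0 addr0; lra.
have h0r u : h u 0 = 0 by rewrite hC h0.
have hN u v : h (- u) v = - h u v.
  by have := hlin (-1) u 0 v; rewrite rmorphN mulN1r addr0 h0 addr0 mulN1r.
pose I : C := 0 +i* 1.
have II : I * I = -1 by apply/eqP; rewrite eq_complex /=; apply/andP; split; apply/eqP; ring.
have hI1 : h 1 I = 0.
  have := hJ 1 I; rewrite -/I mulr1 II hC hN hC => /eqP.
  by rewrite eq_sym -subr_eq0 opprK -mulr2n mulrn_eq0 /= => /eqP.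
have hII : h I I = h 1 1 by have := hJ 1 1; rewrite -/I mulr1.
have hd : d = (complex.Re d)%:C * 1 + ((complex.Im d)%:C * I + 0).
  by case: d => x y; apply/eqP; rewrite eq_complex /=; apply/andP; split; apply/eqP; ring.
rewrite sqr_cabs {1 2}hd !(hlin, hlinr) [h I 1]hC hI1 hII !h0 !h0r.
ring.
Qed.

Variables (g : metric_family R p_pr m N) (w : form_family R p_pr m N).
Hypotheses (g_kahler : leafwise_kahler A g)
  (g_indep : forall i, theta_independent A i (g i))
  (w_harm : harmonic_1form A g w) (w_indep : forall i, theta_independent A i (w i)).

(** By independence of theta, the slice theta = 0 stands for all of them. *)
Definition leaf_density (i : 'I_N) (z : C) : R := g i (z, 0) 1 1.
Definition leaf_form (i : 'I_N) (z : C) : C * C := w i (z, 0).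

Lemma cdisc_cmap i l : cdom (A i) l -> cdisc (A i) (cmap (A i) l).1.
Proof.
move=> il; have [charts _ _] := A_atlas; have [_ dom_cod _ _ _] := charts i.
by have [[]] := dom_cod l il.
Qed.

Lemma leaf_density_gt0 i z : cdisc (A i) z -> 0 < leaf_density i z.
Proof.
move=> zi; have [herm _ _] := g_kahler.
exact: (hermitian_norm 0 (herm i (z, 0) (conj zi I))).2.
Qed.

Lemma leaf_density_smooth i :
  smooth_on (@cplx R @^-1` cdisc (A i)) (fun a => leaf_density i (cplx a)).
Proof. by have [_ _ gs] := g_kahler; exact: gs. Qed.

Lemma leaf_density_continuous i z :
  cdisc (A i) z -> {for z, continuous (leaf_density i)}.
Proof.
move=> zi; have Dz : (@cplx R @^-1` cdisc (A i)) (plane z) by rewrite /preimage /= planeK.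
have c := smooth_on_continuous (leaf_density_smooth i) Dz.
have -> : leaf_density i = (fun a => leaf_density i (cplx a)) \o @plane R.
  by apply: funext => y; rewrite /= planeK.
apply: (@continuous_comp _ _ _ (@plane R)); last exact: c.
move=> P /plane_nbhsP[r r0 rP]; apply/cline_nbhsP; exists r => // h hr.
have := rP (complex.Re h) (complex.Im h) (le_lt_trans (Re_le_cabs h) hr)
  (le_lt_trans (Im_le_cabs h) hr).
by case: (z) (h) => [? ?] [? ?].
Qed.

Lemma leaf_densityE i l : cdom (A i) l ->
  g i (cmap (A i) l) 1 1 = leaf_density i (cmap (A i) l).1.
Proof.
move=> il; rewrite /leaf_density -(g_indep (cmap (A i) l).2 0 (cdisc_cmap il)).
by rewrite -surjective_pairing.
Qed.

Lemma leaf_formE i l : cdom (A i) l ->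
  w i (cmap (A i) l) = leaf_form i (cmap (A i) l).1.
Proof.
move=> il; rewrite /leaf_form -(w_indep (cmap (A i) l).2 0 (cdisc_cmap il)).
by rewrite -surjective_pairing.
Qed.

Lemma leaf_density_transition i j l : cdom (A i) l -> cdom (A j) l ->
  leaf_density j (cmap (A j) l).1 =
  cabs (leaf_deriv A i j id l) ^+ 2 * leaf_density i (cmap (A i) l).1.
Proof.
move=> il jl; have [herm gij _] := g_kahler.
rewrite -!leaf_densityE// (gij i j l 1 1 il jl) !mulr1.
exact: (hermitian_norm _ (herm i _ (conj (cdisc_cmap il) I))).1.
Qed.

(** Testing the form on the tangent vectors 1 and i recovers both coefficients; in the combination a
    - i b, the (1, 0)-part, their changes amount to a complex multiplication. *)
Lemma form10_transition i j l : cdom (A i) l -> cdom (A j) l ->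
  form10 (leaf_form j) (cmap (A j) l).1 =
  form10 (leaf_form i) (cmap (A i) l).1 * leaf_deriv A i j id l.
Proof.
move=> il jl; have [wij _ _ _] := w_harm.
have := wij i j l 1 il jl; have := wij i j l 'i il jl.
rewrite /form10 -!leaf_formE// /coveval.
case: (leaf_deriv A i j id l) => d1 d2.
case: (w j _) => [[a1 a2] [b1 b2]]; case: (w i _) => [[c1 c2] [e1 e2]] /=.
rewrite !(mul0r, mul1r, mulr0, mulr1, add0r, addr0, subr0, sub0r).
move=> /(congr1 (@complex.Re R)) /= E1 /(congr1 (@complex.Re R)) /= E2.
apply/eqP; rewrite eq_complex /=; apply/andP; split; apply/eqP; move: E1 E2; lra.
Qed.

Lemma leaf_form_smooth i :
  smooth_on (@cplx R @^-1` cdisc (A i)) (fun a => complex.Re (leaf_form i (cplx a)).1) /\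
  smooth_on (@cplx R @^-1` cdisc (A i)) (fun a => complex.Re (leaf_form i (cplx a)).2).
Proof. by have [_ _ ws _] := w_harm; have [[? _] [? _]] := ws i 0. Qed.

Definition leaf_curvature i := curvature (leaf_density i) (leaf_form i).

(** The zbar-derivative of [form10] is multiplied by |D|^2 by [wderive_pullback], and the density by
    [leaf_density_transition]; this factor is nonzero because densities are positive. *)
Lemma leaf_curvature_transition i j l : cdom (A i) l -> cdom (A j) l ->
  leaf_curvature j (cmap (A j) l).1 = leaf_curvature i (cmap (A i) l).1.
Proof.
move=> il jl; set zj := (cmap (A j) l).1; set zi := (cmap (A i) l).1.
pose pt (y : C) := cinv (A j) (y, (cmap (A j) l).2).
have [r [H [r0 HP]]] : exists (r : R) (H : C -> C), 0 < r /\
    forall h : C, cabs h < r ->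
    [/\ cdom (A i) (pt (zj + h)), cdom (A j) (pt (zj + h)),
        (cmap (A j) (pt (zj + h))).1 = zj + h,
        (cmap (A i) (pt (zj + h))).1 = H (zj + h) &
        is_derive (zj + h) 1 H (leaf_deriv A i j id (pt (zj + h)))].
  exact: holomorphic_transition il jl.
have [charts _ _] := A_atlas.
have ptl : pt zj = l.
  have [_ dom_cod _ _ _] := charts j; have [_ <-] := dom_cod l jl.
  by rewrite /pt /zj -surjective_pairing (dom_cod l jl).2.
have := HP 0; rewrite cabs0 addr0 ptl => /(_ r0)[_ _ _ Hz Hd]; rewrite -/zi in Hz.
pose D (y : C) := leaf_deriv A i j id (pt y).
have Hcont : {for zj, continuous H} by exact: (cderive_continuous Hd).
have zj_disc : cdisc (A j) zj by exact: cdisc_cmap.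
have zi_disc : cdisc (A i) zi by exact: cdisc_cmap.
have lj0 := leaf_density_gt0 zj_disc; have li0 := leaf_density_gt0 zi_disc.
have cj := leaf_density_continuous zj_disc.
have ci : {for zj, continuous (leaf_density i \o H)}.
  by apply: continuous_comp => //; rewrite -Hz; exact: leaf_density_continuous.
(* As |D|^2 is the quotient of the densities, keeping each of them within a factor 2 of its value at
   the base point bounds |D|^2 by [Q], hence |D| by 1 + Q. *)
have near_zj : \forall y \near zj, leaf_density j y < 2 * leaf_density j zj /\
    leaf_density i zi / 2 < leaf_density i (H y).
  near=> y; split.
    near: y; apply: (cvgr_lt (leaf_density j zj)) => //.
    by rewrite ltr_pMl// ltr1n.
  near: y; apply: (cvgr_gt (leaf_density i (H zj))) => //.
  by rewrite -Hz ltr_pdivrMr// ltr_pMr// ltr1n.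
have /cline_nbhsP[r1 r10 P1] := near_zj.
pose r2 := Num.min r r1.
have r20 : 0 < r2 by rewrite lt_min r0.
pose Q := 4 * leaf_density j zj / leaf_density i zi.
have Q0 : 0 <= Q by rewrite divr_ge0 ?(ltW li0)// mulr_ge0// ltW.
have Hder (h : C) : cabs h < r2 -> is_derive (zj + h) 1 H (D (zj + h)).
  by rewrite lt_min => /andP[hr _]; have [_ _ _ _] := HP h hr.
have DK (h : C) : cabs h < r2 -> cabs (D (zj + h)) <= 1 + Q.
  rewrite lt_min => /andP[hr hr1]; have [p1 p2 p3 p4 _] := HP h hr.
  have := leaf_density_transition p1 p2; rewrite p3 p4 -/(D (zj + h)) => E.
  have [q1 q2] := P1 h hr1; rewrite E in q1.
  set x := cabs _ in q1 *; have x0 : 0 <= x by exact: cabs_ge0.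
  have x2 : x ^+ 2 <= Q.
    rewrite /Q ler_pdivlMr//; have := ler_wpM2l (sqr_ge0 x) (ltW q2).
    by move: q1; lra.
  have := sqr_ge0 (x - 1); move: x2; lra.
have phiE (h : C) : cabs h < r2 -> form10 (leaf_form j) (zj + h) =
    form10 (leaf_form i) (H (zj + h)) * D (zj + h).
  rewrite lt_min => /andP[hr _]; have [p1 p2 p3 p4 _] := HP h hr.
  by have := form10_transition p1 p2; rewrite p3 p4.
have [ai bi] := leaf_form_smooth i; have [aj bj] := leaf_form_smooth j.
have [Ai wi] := form10_wderive (@open_cdisc _ _ _ _ _ (A i)) ai bi
  (@leaf_density_gt0 i) zi_disc.
have [Aj wj] := form10_wderive (@open_cdisc _ _ _ _ _ (A j)) aj bj
  (@leaf_density_gt0 j) zj_disc.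
rewrite Hz in wi.
have := wderive_pullback r20 Hder DK phiE wi wj.
rewrite /D ptl (leaf_density_transition il jl) -/zi.
rewrite -/(leaf_curvature i) -/(leaf_curvature j).
have d0 : cabs (leaf_deriv A i j id l) ^+ 2 != 0.
  apply/eqP => d0; move: lj0.
  by rewrite (leaf_density_transition il jl) d0 mul0r ltxx.
move: (cabs _ ^+ 2) d0 => d d0 E.
have : (leaf_curvature j zj)^*%C = (leaf_curvature i zi)^*%C.
  have nz : (- (d * leaf_density i zi / 2)%:C : C) != 0.
    by rewrite oppr_eq0 (inj_eq (@complexI R)) !mulf_neq0// ?invr_eq0 ?gt_eqF.
  apply: (mulfI nz); rewrite [LHS]E mulrA -Hz; congr (_ * _).
  by rewrite mulrN -rmorphM mulrA.
by move=> /(congr1 (@conjc R)); rewrite !conjcK.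
Unshelve. all: by end_near. Qed.

End Transitions.

(** * Linearity of the Hodge operators and symmetry under the star *)

Section HodgeLinearity.
Variable R : realType.
Local Notation C := (cline R).
Variable O : set C.
Hypothesis Oo : open O.
Implicit Types (f : C -> C) (w : C -> C * C) (z : C) (c : R).
Let D := @cplx R @^-1` O.
Let Do : open D. Proof. exact: open_cplx_preimage. Qed.

Let Dz z : O z -> D (plane z). Proof. by rewrite /D /preimage /= planeK. Qed.

Lemma smooth_onC_ext f f' : (forall z, O z -> f z = f' z) ->
  smooth_onC O f -> smooth_onC O f'.
Proof.
by move=> ff' [fr fi]; split; [apply: smooth_on_ext fr|apply: smooth_on_ext fi] => // a Da;
   rewrite ff'.
Qed.

Lemma smooth_onC_partial v f : smooth_onC O f -> smooth_onC O (partial v f).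
Proof.
move=> [fr fi]; split.
  by apply: smooth_on_ext (smooth_on_derive v fr) => // -[x y].
by apply: smooth_on_ext (smooth_on_derive v fi) => // -[x y].
Qed.

Lemma smooth_onC_lin c f f' : smooth_onC O f -> smooth_onC O f' ->
  smooth_onC O (fun z => c%:C * f z + f' z).
Proof.
move=> [fr fi] [fr' fi']; have cs := smooth_on_cst Do c; split.
  apply: smooth_on_ext (smooth_onD Do (smooth_onM Do cs fr) fr') => // a _.
  by case: (f _) (f' _) => [x y] [x' y'] /=; rewrite mul0r subr0.
apply: smooth_on_ext (smooth_onD Do (smooth_onM Do cs fi) fi') => // a _.
by case: (f _) (f' _) => [x y] [x' y'] /=; rewrite mul0r addr0.
Qed.

Lemma smooth_onC_cst c : smooth_onC O (fun=> c%:C).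
Proof. by split; exact: smooth_on_cst. Qed.

Lemma smooth_onCN f : smooth_onC O f -> smooth_onC O (fun z => - f z).
Proof.
move=> fs; apply: smooth_onC_ext (smooth_onC_lin (-1) fs (smooth_onC_cst 0)) => z _.
by rewrite rmorphN rmorph1 mulN1r rmorph0 addr0.
Qed.

Lemma smooth_onCB f f' : smooth_onC O f -> smooth_onC O f' ->
  smooth_onC O (fun z => f z - f' z).
Proof.
move=> fs fs'; apply: smooth_onC_ext (smooth_onC_lin (-1) fs' fs) => z _.
by rewrite rmorphN rmorph1 mulN1r addrC.
Qed.

Lemma partial_ext v f f' z : O z -> (forall y, O y -> f y = f' y) ->
  partial v f z = partial v f' z.
Proof.
move=> Oz ff'; rewrite /partial -/(plane z).
have nD : \forall y \near plane z, D y by exact: open_nbhs_nbhs (conj Do (Dz Oz)).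
by congr (_ +i* _); apply: near_eq_derive; apply: filterS nD => y Dy; rewrite ff'.
Qed.

Lemma partial_lin v c f f' z : O z -> smooth_onC O f -> smooth_onC O f' ->
  partial v (fun z => c%:C * f z + f' z) z = c%:C * partial v f z + partial v f' z.
Proof.
move=> Oz [fr fi] [fr' fi']; rewrite /partial -/(plane z).
have ReE y : complex.Re (c%:C * f y + f' y) = c * complex.Re (f y) + complex.Re (f' y).
  by case: (f _) (f' _) => [x x1] [x' x1'] /=; rewrite mul0r subr0.
have ImE y : complex.Im (c%:C * f y + f' y) = c * complex.Im (f y) + complex.Im (f' y).
  by case: (f _) (f' _) => [x x1] [x' x1'] /=; rewrite mul0r addr0.
have lin (u u' : R * R -> R) : smooth_on D u -> smooth_on D u' ->
    'D_v (fun a => c * u a + u' a) (plane z) = c * 'D_v u (plane z) + 'D_v u' (plane z).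
  move=> /smooth_on_derivable us /smooth_on_derivable us'.
  have /derivableP ud := us _ v (Dz Oz); have /derivableP ud' := us' _ v (Dz Oz).
  have cd : is_derive (plane z) v (fun a => c * u a) (c * 'D_v u (plane z)).
    exact: is_deriveZ.
  have sd : is_derive (plane z) v (fun a => c * u a + u' a)
      (c * 'D_v u (plane z) + 'D_v u' (plane z)).
    exact: is_deriveD.
  by rewrite (@derive_val _ _ _ _ _ _ _ sd).
have -> : (fun a => complex.Re (c%:C * f (cplx a) + f' (cplx a))) =
    (fun a => c * complex.Re (f (cplx a)) + complex.Re (f' (cplx a))).
  by apply: funext => a; rewrite ReE.
have -> : (fun a => complex.Im (c%:C * f (cplx a) + f' (cplx a))) =
    (fun a => c * complex.Im (f (cplx a)) + complex.Im (f' (cplx a))).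
  by apply: funext => a; rewrite ImE.
rewrite (lin _ _ fr fr') (lin _ _ fi fi').
apply/eqP; rewrite eq_complex /=.
by apply/andP; split; apply/eqP; ring.
Qed.

Variable lam : C -> R.
Hypotheses (lam_smooth : smooth_on D (fun a => lam (cplx a)))
  (lam_gt0 : forall z, O z -> 0 < lam z).

Lemma smooth_onC_div f : smooth_onC O f -> smooth_onC O (fun z => f z / (lam z)%:C).
Proof.
move=> [fr fi]; have lV : smooth_on D (fun a => (lam (cplx a))^-1).
  by apply: smooth_onV => // a /lam_gt0 la; rewrite gt_eqF.
split.
  apply: smooth_on_ext (smooth_onM Do fr lV) => // a Da.
  rewrite -fmorphV; case: (f _) => x y.
  by rewrite /= mulr0 subr0.
apply: smooth_on_ext (smooth_onM Do fi lV) => // a Da.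
rewrite -fmorphV; case: (f _) => x y.
by rewrite /= mulr0 add0r.
Qed.

Definition smooth_form w :=
  smooth_onC O (fun z => (w z).1) /\ smooth_onC O (fun z => (w z).2).

Definition form_lin c w w' z : C * C := c%:C *: w z + w' z.

Lemma smooth_form_star w : smooth_form w -> smooth_form (star1 w).
Proof. by move=> [w1 w2]; split => //; exact: smooth_onCN. Qed.

Lemma smooth_ext_d1 w : smooth_form w -> smooth_onC O (ext_d1 w).
Proof.
by move=> [w1 w2]; apply: smooth_onCB; exact: smooth_onC_partial.
Qed.

Lemma smooth_codiff1 w : smooth_form w -> smooth_onC O (codiff1 lam w).
Proof.
move=> ws; apply: smooth_onCN; apply: smooth_onC_div.
by apply: smooth_ext_d1; exact: smooth_form_star.
Qed.

Lemma smooth_star2d w : smooth_form w -> smooth_onC O (star2 lam (ext_d1 w)).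
Proof. by move=> ws; apply: smooth_onC_div; exact: smooth_ext_d1. Qed.

Lemma ext_d1_ext w w' z : O z -> (forall y, O y -> w y = w' y) ->
  ext_d1 w z = ext_d1 w' z.
Proof.
by move=> Oz ww'; congr (_ - _); apply: partial_ext => // y Oy; rewrite ww'.
Qed.

Lemma star1_ext w w' y : w y = w' y -> star1 w y = star1 w' y.
Proof. by rewrite /star1 => ->. Qed.

Lemma codiff1_ext w w' z : O z -> (forall y, O y -> w y = w' y) ->
  codiff1 lam w z = codiff1 lam w' z.
Proof.
move=> Oz ww'; rewrite /codiff1 /star2; congr (- (_ / _)).
by apply: ext_d1_ext => // y Oy; apply: star1_ext; exact: ww'.
Qed.

Lemma star2d_ext w w' z : O z -> (forall y, O y -> w y = w' y) ->
  star2 lam (ext_d1 w) z = star2 lam (ext_d1 w') z.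
Proof. by move=> Oz ww'; rewrite /star2 (ext_d1_ext Oz ww'). Qed.

Lemma ext_d1_lin c w w' z : O z -> smooth_form w -> smooth_form w' ->
  ext_d1 (form_lin c w w') z = c%:C * ext_d1 w z + ext_d1 w' z.
Proof.
move=> Oz [w1 w2] [w1' w2']; rewrite /ext_d1.
have -> : dX (fun z => (form_lin c w w' z).2) z =
    c%:C * dX (fun z => (w z).2) z + dX (fun z => (w' z).2) z by exact: partial_lin.
have -> : dY (fun z => (form_lin c w w' z).1) z =
    c%:C * dY (fun z => (w z).1) z + dY (fun z => (w' z).1) z by exact: partial_lin.
move: (dX _ _) (dX _ _) (dY _ _) (dY _ _) => x x' y y'; ring.
Qed.

Lemma star1_lin c w w' : star1 (form_lin c w w') = form_lin c (star1 w) (star1 w').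
Proof.
apply: funext => z; apply: injective_projections => //=.
by rewrite /form_lin /= /GRing.scale /= opprD mulrN.
Qed.

Lemma star2d_lin c w w' z : O z -> smooth_form w -> smooth_form w' ->
  star2 lam (ext_d1 (form_lin c w w')) z =
  c%:C * star2 lam (ext_d1 w) z + star2 lam (ext_d1 w') z.
Proof. by move=> Oz ws ws'; rewrite /star2 ext_d1_lin// mulrDl mulrA. Qed.

Lemma codiff1_lin c w w' z : O z -> smooth_form w -> smooth_form w' ->
  codiff1 lam (form_lin c w w') z = c%:C * codiff1 lam w z + codiff1 lam w' z.
Proof.
move=> Oz ws ws'; rewrite /codiff1 star1_lin star2d_lin//; try exact: smooth_form_star.
by rewrite opprD mulrN.
Qed.

Lemma hodge_laplacianE w z : hodge_laplacian lam w z =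
  (dX (codiff1 lam w) z + dY (star2 lam (ext_d1 w)) z,
   dY (codiff1 lam w) z - dX (star2 lam (ext_d1 w)) z).
Proof.
have E1 : (hodge_laplacian lam w z).1 =
  dX (codiff1 lam w) z - (- dY (star2 lam (ext_d1 w)) z) by [].
have E2 : (hodge_laplacian lam w z).2 =
  dY (codiff1 lam w) z - dX (star2 lam (ext_d1 w)) z by [].
by rewrite [LHS]surjective_pairing E1 E2 opprK.
Qed.

Lemma hodge_laplacian_eq0 w z : hodge_laplacian lam w z = 0 <->
  dX (codiff1 lam w) z + dY (star2 lam (ext_d1 w)) z = 0 /\
  dY (codiff1 lam w) z - dX (star2 lam (ext_d1 w)) z = 0.
Proof.
rewrite hodge_laplacianE; split=> [H|[E1 E2]].
  split; first exact: (congr1 (fun x : C * C => x.1) H).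
  exact: (congr1 (fun x : C * C => x.2) H).
by apply: injective_projections; [exact: E1|exact: E2].
Qed.

Lemma hodge_laplacian_ext w w' z : O z -> (forall y, O y -> w y = w' y) ->
  hodge_laplacian lam w z = hodge_laplacian lam w' z.
Proof.
move=> Oz ww'; rewrite !hodge_laplacianE.
have ce y : O y -> codiff1 lam w y = codiff1 lam w' y by move=> Oy; exact: codiff1_ext.
have se y : O y -> star2 lam (ext_d1 w) y = star2 lam (ext_d1 w') y.
  by move=> Oy; exact: star2d_ext.
have c v := @partial_ext v _ _ _ Oz ce; have s v := @partial_ext v _ _ _ Oz se.
rewrite /dX /dY (c (1, 0)) (c (0, 1)) (s (1, 0)) (s (0, 1)).
reflexivity.
Qed.

Lemma hodge_laplacian_lin c w w' z : O z -> smooth_form w -> smooth_form w' ->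
  hodge_laplacian lam w z = 0 -> hodge_laplacian lam w' z = 0 ->
  hodge_laplacian lam (form_lin c w w') z = 0.
Proof.
move=> Oz ws ws' /hodge_laplacian_eq0[E1 E2] /hodge_laplacian_eq0[E1' E2'].
have cl v : partial v (codiff1 lam (form_lin c w w')) z =
    c%:C * partial v (codiff1 lam w) z + partial v (codiff1 lam w') z.
  rewrite -partial_lin//; try exact: smooth_codiff1.
  by apply: partial_ext => // y Oy; exact: codiff1_lin.
have sl v : partial v (star2 lam (ext_d1 (form_lin c w w'))) z =
    c%:C * partial v (star2 lam (ext_d1 w)) z + partial v (star2 lam (ext_d1 w')) z.
  rewrite -partial_lin//; try exact: smooth_star2d.
  by apply: partial_ext => // y Oy; exact: star2d_lin.
have lin1 (x y x' y' u v : C) : u = c%:C * x + x' -> v = c%:C * y + y' ->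
    x + y = 0 -> x' + y' = 0 -> u + v = 0.
  move=> -> -> xy xy'; have -> : c%:C * x + x' + (c%:C * y + y') =
    c%:C * (x + y) + (x' + y') by ring.
  by rewrite xy xy' mulr0 addr0.
have lin2 (x y x' y' u v : C) : u = c%:C * x + x' -> v = c%:C * y + y' ->
    x - y = 0 -> x' - y' = 0 -> u - v = 0.
  move=> -> -> xy xy'; have -> : c%:C * x + x' - (c%:C * y + y') =
    c%:C * (x - y) + (x' - y') by ring.
  by rewrite xy xy' mulr0 addr0.
apply/hodge_laplacian_eq0; split.
  exact: (lin1 _ _ _ _ _ _ (cl _) (sl _) E1 E1').
exact: (lin2 _ _ _ _ _ _ (cl _) (sl _) E2 E2').
Qed.

Lemma partial0 v z : partial v (fun=> 0) z = 0.
Proof. by rewrite /partial !derive_cst. Qed.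

Lemma ext_d1_0 z : ext_d1 (fun=> 0) z = 0.
Proof. by rewrite /ext_d1 /dX /dY !partial0 subrr. Qed.

Lemma codiff1_0 z : codiff1 lam (fun=> 0) z = 0.
Proof.
have E : star1 (fun=> 0 : C * C) = (fun=> 0).
  by apply: funext => y; rewrite /star1 /= oppr0.
by rewrite /codiff1 E /star2 ext_d1_0 mul0r oppr0.
Qed.

Lemma hodge_laplacian0 z : hodge_laplacian lam (fun=> 0) z = 0.
Proof.
rewrite hodge_laplacianE.
have -> : codiff1 lam (fun=> 0) = (fun=> 0) by apply: funext => y; exact: codiff1_0.
have -> : star2 lam (ext_d1 (fun=> 0)) = (fun=> 0).
  by apply: funext => y; rewrite /star2 ext_d1_0 mul0r.
by rewrite /dX /dY !partial0 subrr addr0.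
Qed.

Lemma partialN v f z : O z -> smooth_onC O f -> partial v (fun z => - f z) z = - partial v f z.
Proof.
move=> Oz fs; have := partial_lin v (-1) Oz fs (smooth_onC_cst 0).
rewrite partial0 addr0 rmorphN rmorph1 mulN1r => <-.
by apply: partial_ext => // y _; rewrite mulN1r rmorph0 addr0.
Qed.

(** Since star star = - 1 on 1-forms, replacing w by star w changes the pair (delta w, star d w)
    into (star d w, - delta w), which exchanges the two equations of harmonicity up to sign. *)
Lemma hodge_laplacian_star w z : O z -> smooth_form w ->
  hodge_laplacian lam w z = 0 -> hodge_laplacian lam (star1 w) z = 0.
Proof.
move=> Oz ws /hodge_laplacian_eq0[E1 E2].
have s2 y : star2 lam (ext_d1 (star1 w)) y = - codiff1 lam w y by rewrite /codiff1 opprK.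
have c1 y : O y -> codiff1 lam (star1 w) y = star2 lam (ext_d1 w) y.
  move=> Oy; rewrite /codiff1 /star2 -mulNr; congr (_ / _).
  have [w1 w2] := ws; rewrite /ext_d1 opprB.
  have N1 : dY (fun z => (star1 (star1 w) z).1) y = - dY (fun z => (w z).1) y.
    exact: partialN.
  have N2 : dX (fun z => (star1 (star1 w) z).2) y = - dX (fun z => (w z).2) y.
    exact: partialN.
  by rewrite N1 N2 opprK addrC.
have cp v : partial v (codiff1 lam (star1 w)) z = partial v (star2 lam (ext_d1 w)) z.
  exact: partial_ext.
have sp v : partial v (star2 lam (ext_d1 (star1 w))) z = - partial v (codiff1 lam w) z.
  have -> : star2 lam (ext_d1 (star1 w)) = (fun y => - codiff1 lam w y).
    by apply: funext.
  by apply: partialN => //; exact: smooth_codiff1.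
have F1 (x y u v : C) : u = y -> v = - x -> x - y = 0 -> u + v = 0.
  by move=> -> -> /eqP; rewrite subr_eq0 => /eqP ->; rewrite subrr.
have F2 (x y u v : C) : u = y -> v = - x -> x + y = 0 -> u - v = 0.
  by move=> -> ->; rewrite opprK addrC.
apply/hodge_laplacian_eq0; split; first exact: (F1 _ _ _ _ (cp _) (sp _) E2).
exact: (F2 _ _ _ _ (cp _) (sp _) E1).
Qed.

End HodgeLinearity.

(** * Separating functionals and even dimension *)

(** The size of a free family in S is at most n; a family of maximal size spans S, since any v
    outside of its span could be appended. *)
Lemma subspace_basis (K : fieldType) (n : nat) (S : set 'rV[K]_n) :
  exists (r : nat) (B : 'M[K]_(r, n)), [/\ row_free B, forall k, S (row k B) &
    forall v, S v -> (v <= B)%MS].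
Proof.
pose P r := `[< exists B : 'M[K]_(r, n), row_free B /\ forall k, S (row k B) >].
have P0 : exists r, P r.
  exists 0%N; apply/asboolP; exists 0; split; last by case.
  by rewrite /row_free mxrank0.
have Pn r : P r -> (r <= n)%N.
  by move=> /asboolP[B [Bfree _]]; have := rank_leq_col B; rewrite (eqP Bfree).
have [r /asboolP[B [Bfree BS]] rmax] := ex_maxnP P0 Pn.
exists r, B; split=> // v Sv; apply: contrapT => /negP vB.
have : P (r + 1)%N; last by move=> /rmax; rewrite addn1 ltnn.
apply/asboolP; exists (col_mx B v); split.
  rewrite /row_free eqn_leq rank_leq_row /=.
  have : (B < B + v)%MS.
    by rewrite ltmxE addsmxSl addsmx_sub submx_refl /=.
  by move=> /rank_ltmx; rewrite (eqP Bfree) (addsmxE B v) => rk; apply: leq_trans rk; rewrite addn1.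
move=> k; case: (splitP k) => [j kj|j kj].
  have -> : k = lshift 1 j by apply: val_inj.
  by rewrite rowKu.
have -> : k = rshift r j by apply: val_inj.
by rewrite rowKd row_id.
Qed.

(** Taking determinants, (-1)^r is a square in an ordered field. *)
Lemma complex_structure_even (K : realFieldType) (r : nat) (J : 'M[K]_r) :
  J *m J = - 1%:M -> ~~ odd r.
Proof.
move=> /(congr1 determinant); rewrite det_mulmx -scaleN1r detZ det1 mulr1.
case: (boolP (odd r)) => // ro; rewrite -signr_odd ro expr1 => H.
by have := sqr_ge0 (\det J); rewrite expr2 H oppr_ge0 ler10.
Qed.

Section RealDimension.
Variables (R : realType) (p : nat) (p_pr : prime p) (m : nat).
Variables (L : topologicalType) (N : nat) (A : 'I_N -> lchart R p_pr m L).
Local Notation form := (form_family R p_pr m N).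
Implicit Types (w : form) (c : R).

Definition form_eq w w' := forall i x, ccodom (A i) x -> w i x = w' i x.

Definition family_lin c w w' : form := fun i x => c%:C *: w i x + w' i x.

Definition family_star w : form := fun i x => (- (w i x).2, (w i x).1).

Definition family_comb r (c : 'rV[R]_r) (e : 'I_r -> form) : form :=
  fun i x => \sum_k (c ord0 k)%:C *: e k i x.

Variables (H : form -> Prop) (F : seq (form -> R)).
Hypotheses (H0 : H (fun _ _ => 0))
  (H_lin : forall c w w', H w -> H w' -> H (family_lin c w w'))
  (H_ext : forall w w', form_eq w w' -> H w -> H w')
  (H_star : forall w, H w -> H (family_star w))
  (F_lin : forall f, f \in F -> forall c w w', H w -> H w' ->
     f (family_lin c w w') = c * f w + f w')
  (F_ext : forall f, f \in F -> forall w, H w -> form_eq w (fun _ _ => 0) -> f w = 0)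
  (F_inj : forall w, H w -> (forall f, f \in F -> f w = 0) -> form_eq w (fun _ _ => 0)).

(** By [F_lin], [F_ext] and [F_inj], this embeds H, modulo equality on the images of the charts,
    linearly into a finite dimensional space. *)
Let E w : 'rV[R]_(size F) := \row_k (nth (fun=> 0) F k) w.

Let E_lin c w w' : H w -> H w' -> E (family_lin c w w') = c *: E w + E w'.
Proof. by move=> Hw Hw'; apply/rowP => k; rewrite !mxE F_lin// mem_nth. Qed.

Let E_eq0 w : H w -> form_eq w (fun _ _ => 0) <-> E w = 0.
Proof.
move=> Hw; split=> [w0|Ew].
  by apply/rowP => k; rewrite !mxE F_ext// mem_nth.
apply: F_inj => // f fF; have fi : (index f F < size F)%N by rewrite index_mem.
by have /rowP/(_ (Ordinal fi)) := Ew; rewrite !mxE /= nth_index.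
Qed.

Let E_eq w w' : H w -> H w' -> form_eq w w' <-> E w = E w'.
Proof.
move=> Hw Hw'; have Hd := H_lin (-1) Hw Hw'.
have := E_eq0 Hd; rewrite E_lin// scaleN1r => -[d1 d2]; split=> [ww'|EE].
  have /d1/eqP : form_eq (family_lin (-1) w w') (fun _ _ => 0).
    by move=> i x xi; rewrite /family_lin ww'// rmorphN rmorph1 scaleN1r addNr.
  by rewrite addrC subr_eq0 => /eqP.
have /d2 d3 : - E w + E w' = 0 by rewrite EE addNr.
move=> i x xi; have := d3 i x xi; rewrite /family_lin rmorphN rmorph1 scaleN1r.
by move=> /eqP; rewrite addrC subr_eq0 => /eqP.
Qed.

Let comb_EH r (c : 'rV[R]_r) (e : 'I_r -> form) : (forall k, H (e k)) ->
  H (family_comb c e) /\ E (family_comb c e) = c *m \matrix_k E (e k).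
Proof.
move=> He; have aux (s : seq 'I_r) :
    let w : form := fun i x => \sum_(k <- s) (c ord0 k)%:C *: e k i x in
    H w /\ E w = \sum_(k <- s) c ord0 k *: E (e k).
  elim: s => [|k s [IH IE]] /=.
    have -> : (fun i x => \sum_(k <- [::]) (c ord0 k)%:C *: e k i x) =
        (fun _ _ => 0) :> form.
      by apply: funext => i; apply: funext => x; rewrite big_nil.
    by split=> //; rewrite big_nil; apply/(E_eq0 H0).
  have -> : (fun i x => \sum_(k <- k :: s) (c ord0 k)%:C *: e k i x) =
      family_lin (c ord0 k) (e k) (fun i x => \sum_(k <- s) (c ord0 k)%:C *: e k i x).
    by apply: funext => i; apply: funext => x; rewrite big_cons.
  by split; [exact: H_lin|rewrite E_lin// big_cons IE].
have [h1 h2] := aux (index_enum 'I_r); split=> //.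
rewrite [LHS]h2; apply/rowP => j; rewrite summxE mxE.
by apply: eq_bigr => k _; rewrite !mxE.
Qed.

Let star_comb r (c : 'rV[R]_r) (e : 'I_r -> form) :
  family_star (family_comb c e) = family_comb c (fun k => family_star (e k)).
Proof.
apply: funext => i; apply: funext => x; rewrite /family_star /family_comb.
have f1 (I : seq 'I_r) (g : 'I_r -> cline R * cline R) :
    (\sum_(k <- I) g k).1 = \sum_(k <- I) (g k).1 by apply: (big_morph fst).
have f2 (I : seq 'I_r) (g : 'I_r -> cline R * cline R) :
    (\sum_(k <- I) g k).2 = \sum_(k <- I) (g k).2 by apply: (big_morph snd).
apply: injective_projections; rewrite /= ?f1 ?f2 ?f1 ?f2//.
by rewrite -sumrN; apply: eq_bigr => k _; rewrite /= scalerN.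
Qed.

(** A basis of the image of [E] lifts to a basis of H, on which the star acts by a matrix J with J^2
    = - 1. *)
Lemma complex_real_dim : exists genus : nat, has_real_dim A H (2 * genus)%N.
Proof.
have [r [B [Bfree BS Bgen]]] := subspace_basis [set E w | w in H].
have /choice[e eP] : forall k, exists w, H w /\ E w = row k B.
  by move=> k; have [w Hw <-] := BS k; exists w.
have He k : H (e k) by have [] := eP k.
have EeB : \matrix_k E (e k) = B.
  by apply/row_matrixP => k; rewrite rowK (eP k).2.
have Hse k : H (family_star (e k)) by exact: H_star.
pose SE : 'M[R]_(r, size F) := \matrix_k E (family_star (e k)).
have SEB : (SE <= B)%MS.
  by apply/row_subP => k; rewrite rowK; apply: Bgen; exists (family_star (e k)).
(* The rows of [SE] lie in the span of B, so row k of J holds the coordinates of the star of e k. *)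
pose J := SE *m pinvmx B.
have JB : J *m B = SE by rewrite mulmxKpV.
have JJ : J *m J = - 1%:M.
  apply: (row_free_inj Bfree); rewrite -mulmxA JB mulNmx mul1mx.
  apply/row_matrixP => k.
  have [Hc Ec] := comb_EH (row k J) He; have [Hsc Esc] := comb_EH (row k J) Hse.
  have ss : form_eq (family_star (family_star (e k))) (family_comb (row k J) (fun k => family_star (e k))).
    rewrite -star_comb => i x xi.
    have := (E_eq (Hse k) Hc).2; rewrite Ec EeB -row_mul JB rowK => /(_ erefl i x xi).
    by rewrite /family_star => ->.
  have := (E_eq (H_star (Hse k)) Hsc).1 ss; rewrite Esc -/SE row_mul => <-.
  have -> : family_star (family_star (e k)) = family_lin (-1) (e k) (fun _ _ => 0).
    apply: funext => i; apply: funext => x; rewrite /family_lin rmorphN rmorph1.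
    by rewrite scaleN1r addr0; apply: injective_projections.
  rewrite E_lin// (E_eq0 H0).1// addr0 scaleN1r (eP k).2.
  by apply/rowP => j; rewrite !mxE.
have r_even := complex_structure_even JJ.
exists r./2; rewrite mul2n even_halfK//; exists e; split=> // w; split.
  move=> Hw; have := Bgen (E w) (ex_intro2 _ _ w Hw erefl).
  move=> /submxP[c cE]; exists c; split.
    have [Hc Ec] := comb_EH c He.
    by apply: (E_eq Hw Hc).2; rewrite Ec EeB.
  move=> c' c'E; have [Hc' Ec'] := comb_EH c' He.
  have : E w = E (family_comb c' e) by apply/(E_eq Hw Hc').
  by rewrite Ec' EeB cE => /(row_free_inj Bfree).
move=> [c [cE _]]; have [Hc _] := comb_EH c He.
by apply: H_ext Hc => i x xi; rewrite cE.
Qed.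

End RealDimension.

Lemma lin_continuous (K : numFieldType) (T : topologicalType) (V : normedModType K)
    (k : K) (f f' : T -> V) (x : T) : {for x, continuous f} ->
  {for x, continuous f'} -> {for x, continuous (fun y => k *: f y + f' y)}.
Proof. by move=> fc fc'; apply: cvgD => //; apply: cvgZr. Qed.

Lemma star_continuous (K : numFieldType) (T : topologicalType) (V : normedModType K)
    (f : T -> V * V) (x : T) : {for x, continuous f} ->
  {for x, continuous (fun y => (- (f y).2, (f y).1))}.
Proof.
move=> fc.
have c1 : {for x, continuous (fun y => (f y).1)}.
  by apply: (@continuous_comp _ _ _ f fst) => // y; exact: cvg_fst.
have c2 : {for x, continuous (fun y => (f y).2)}.
  by apply: (@continuous_comp _ _ _ f snd) => // y; exact: cvg_snd.
by apply: cvg_pair => //=; apply: cvgN.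
Qed.

(** * The space of real harmonic forms *)

Section HarmonicSpace.
Variables (R : realType) (p : nat) (p_pr : prime p) (m : nat).
Variables (L : topologicalType) (N : nat) (A : 'I_N -> lchart R p_pr m L).
Variable g : metric_family R p_pr m N.
Local Notation C := (cline R).
Local Notation form := (form_family R p_pr m N).
Implicit Types (w : form) (c : R).
Hypotheses (A_atlas : is_atlas A) (g_kahler : leafwise_kahler A g).

Let H := real_harmonic_1form A g.
Let Oo i : open (cdisc (A i)). Proof. exact: open_cdisc. Qed.
Let Do i : open (@cplx R @^-1` cdisc (A i)). Proof. exact: open_cplx_preimage. Qed.
Let lam i theta z := g i (z, theta) 1 1.

Let lam_gt0 i theta z : cdisc (A i) z -> 0 < lam i theta z.
Proof.
move=> zi; have [herm _ _] := g_kahler.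
exact: (hermitian_norm 0 (herm i (z, theta) (conj zi I))).2.
Qed.

Let lam_smooth i theta :
  smooth_on (@cplx R @^-1` cdisc (A i)) (fun a => lam i theta (cplx a)).
Proof. by have [_ _ gs] := g_kahler; exact: gs. Qed.

Let slice w i theta : C -> C * C := fun z => w i (z, theta).

Let cod i theta z : cdisc (A i) z -> ccodom (A i) (z, theta). Proof. by []. Qed.

Let open_ccodom i : open (ccodom (A i)).
Proof.
rewrite /ccodom; have -> : cdisc (A i) `*` [set: zpm p_pr m] = fst @^-1` cdisc (A i).
  by apply/seteqP; split => [x []|x xi].
by apply: open_comp => // x _; exact: cvg_fst.
Qed.

Let cmap_cod i l : cdom (A i) l -> ccodom (A i) (cmap (A i) l).
Proof.
have [charts _ _] := A_atlas; have [_ dom_cod _ _ _] := charts i.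
by move=> /dom_cod[].
Qed.

Lemma real_harmonic0 : H (fun _ _ => 0).
Proof.
have c0 v : coveval (0 : C * C) v = 0 by rewrite /coveval /= !mulr0 addr0.
split; last by [].
split.
- by move=> i j l v il jl; rewrite !c0.
- by move=> i x _; exact: cst_continuous.
- by move=> i theta; split; apply: (smooth_onC_ext (@Oo i)) (smooth_onC_cst (@Oo i) 0) => z _.
- by move=> i z theta zi; exact: hodge_laplacian0.
Qed.

Lemma real_harmonic_ext w w' : form_eq A w w' -> H w -> H w'.
Proof.
move=> ww' [[wl wc ws wh] wr]; split; last by move=> i x xi; rewrite -ww'//; exact: wr.
split.
- by move=> i j l v il jl; rewrite -!ww'; try exact: cmap_cod; exact: wl.
- move=> i x xi; apply: near_eq_continuous (wc i x xi).
  have nO := open_nbhs_nbhs (conj (@open_ccodom i) xi).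
  by apply: filterS nO => y; exact: ww'.
- move=> i theta; have [s1 s2] := ws i theta.
  by split; [apply: smooth_onC_ext s1|apply: smooth_onC_ext s2] => // z zi; rewrite ww'.
- move=> i z theta zi; have := wh i z theta zi.
  by rewrite (@hodge_laplacian_ext _ _ (@Oo i) (lam i theta) _ (slice w' i theta))// => y yi;
     rewrite ww'.
Qed.

Lemma real_harmonic_lin c w w' : H w -> H w' -> H (family_lin c w w').
Proof.
move=> [[wl wc ws wh] wr] [[wl' wc' ws' wh'] wr']; split; last first.
  move=> i x xi; have [r1 r2] := wr i x xi; have [r1' r2'] := wr' i x xi.
  rewrite /family_lin; move: r1 r2 r1' r2'.
  case: (w i x) (w' i x) => [[a1 a2] [b1 b2]] [[a1' a2'] [b1' b2']] /= -> -> -> ->.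
  by rewrite !mulr0 !mul0r !addr0.
split.
- move=> i j l v il jl; have E := wl i j l v il jl; have E' := wl' i j l v il jl.
  have lin x x' u : coveval (c%:C *: x + x' : C * C) u = c%:C * coveval x u + coveval x' u.
    by rewrite /coveval /= /GRing.scale /=; ring.
  by rewrite /family_lin !lin E E'.
- move=> i x xi; have cx := wc i x xi; have cx' := wc' i x xi.
  exact: (@lin_continuous R[i] (C * zpm p_pr m)%type (C * C)%type c%:C (w i) (w' i) x cx cx').
- move=> i theta; have [s1 s2] := ws i theta; have [s1' s2'] := ws' i theta.
  by split; apply: (smooth_onC_lin (@Oo i)).
- move=> i z theta zi.
  exact: (hodge_laplacian_lin (@Oo i) (@lam_smooth i theta) (@lam_gt0 i theta) c zi
    (ws i theta) (ws' i theta) (wh i z theta zi) (wh' i z theta zi)).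
Qed.

Lemma real_harmonic_star w : H w -> H (family_star w).
Proof.
move=> [[wl wc ws wh] wr]; split; last first.
  move=> i x xi; have [r1 r2] := wr i x xi; rewrite /family_star; split=> //=.
  by move: r2; case: (w i x).2 => ? ? /= ->; rewrite oppr0.
split.
- move=> i j l v il jl; have E := wl i j l ('i * v) il jl.
  have st (x : C * C) u : coveval (- x.2, x.1) u = - coveval x ('i * u).
    case: x u => [a b] [u1 u2]; rewrite /coveval /=.
    by rewrite !mul0r !mul1r sub0r add0r rmorphN; ring.
  by rewrite /family_star !st E mulrCA.
- by move=> i x xi; exact: (star_continuous (wc i x xi)).
- move=> i theta; have [s1 s2] := ws i theta.
  by split; [exact: smooth_onCN|exact: s1].
- move=> i z theta zi.
  exact: (hodge_laplacian_star (@Oo i) (@lam_smooth i theta) (@lam_gt0 i theta) zi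
    (ws i theta) (wh i z theta zi)).
Qed.

Hypothesis (L_compact : compact [set: L]).
Hypothesis (g_indep : forall i, theta_independent A i (g i)).
Hypothesis (harmonic_indep : property_iv A g).

Lemma real_harmonic_dim : exists genus : nat, has_real_dim A H (2 * genus)%N.
Proof.
(* Weight 1 suits the curvature, which is a function on L; weight lambda suits [form10], the
   coefficient of a (1, 0)-form, for which |phi|^2 / lambda is invariant. *)
have [P1 [P1A P1P]] := @finite_determining_net _ _ _ _ _ _ A L_compact A_atlas
  (fun _ _ => 1) (fun _ z _ => conj ltr01 (@cst_continuous C R 1 z)).
have [P2 [P2A P2P]] := @finite_determining_net _ _ _ _ _ _ A L_compact A_atlas
  (leaf_density g) (fun i z zi => conj (leaf_density_gt0 g_kahler zi)
    (leaf_density_continuous g_kahler zi)).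
(* These functionals are, up to sign, the real and imaginary parts of the curvature at the points of
   P1 and of [form10] at those of P2. *)
pose F1 (x : 'I_N * C) w : R :=
  complex.Re (codiff1 (leaf_density g x.1) (leaf_form w x.1) x.2).
pose F2 (x : 'I_N * C) w : R :=
  complex.Re (star2 (leaf_density g x.1) (ext_d1 (leaf_form w x.1)) x.2).
pose F3 (x : 'I_N * C) w : R := complex.Re (leaf_form w x.1 x.2).1.
pose F4 (x : 'I_N * C) w : R := complex.Re (leaf_form w x.1 x.2).2.
pose F := [seq F1 x | x <- P1] ++ [seq F2 x | x <- P1] ++
  [seq F3 x | x <- P2] ++ [seq F4 x | x <- P2].
have FP f : f \in F -> [\/ exists2 x, x \in P1 & f = F1 x, exists2 x, x \in P1 & f = F2 x,
    exists2 x, x \in P2 & f = F3 x | exists2 x, x \in P2 & f = F4 x].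
  rewrite !mem_cat => /or4P[] /mapP[x xP ->]; by [constructor 1; exists x|
    constructor 2; exists x|constructor 3; exists x|constructor 4; exists x].
have ReE c (x y : C) : complex.Re (c%:C * x + y) = c * complex.Re x + complex.Re y.
  by case: x y => [x1 x2] [y1 y2] /=; rewrite mul0r subr0.
have sm w i : H w -> smooth_form (cdisc (A i)) (leaf_form w i).
  by move=> [[_ _ ws _] _]; exact: ws.
have ld0 i z : cdisc (A i) z -> 0 < leaf_density g i z by exact: lam_gt0.
apply: (@complex_real_dim _ _ _ _ _ _ A H F real_harmonic0 real_harmonic_lin
  real_harmonic_ext real_harmonic_star).
- move=> f /FP[] [x xP ->] c w w' Hw Hw'.
  + rewrite /F1 -ReE; congr complex.Re.
    exact: (codiff1_lin (@Oo x.1) _ c (P1A x xP) (sm w x.1 Hw) (sm w' x.1 Hw')).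
  + rewrite /F2 -ReE; congr complex.Re.
    exact: (star2d_lin _ c (P1A x xP) (sm w x.1 Hw) (sm w' x.1 Hw')).
  + by rewrite /F3 -ReE.
  + by rewrite /F4 -ReE.
- move=> f /FP[] [x xP ->] w Hw w0.
  + have w0' y : cdisc (A x.1) y -> leaf_form w x.1 y = 0 by move=> yi; exact: w0.
    by rewrite /F1 (codiff1_ext (@Oo x.1) _ (P1A x xP) w0') codiff1_0.
  + have w0' y : cdisc (A x.1) y -> leaf_form w x.1 y = 0 by move=> yi; exact: w0.
    by rewrite /F2 (star2d_ext (@Oo x.1) _ (P1A x xP) w0') /star2 ext_d1_0 mul0r.
  + by rewrite /F3 /leaf_form w0//; exact: cod (P2A x xP).
  + by rewrite /F4 /leaf_form w0//; exact: cod (P2A x xP).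
move=> w [wH wr] Fw.
have w_indep := harmonic_indep wH.
have F1w x : x \in P1 -> F1 x w = 0.
  by move=> xP; apply: Fw; rewrite !mem_cat map_f.
have F2w x : x \in P1 -> F2 x w = 0.
  by move=> xP; apply: Fw; rewrite !mem_cat [_ \in map F2 P1]map_f// orbT.
have F3w x : x \in P2 -> F3 x w = 0.
  by move=> xP; apply: Fw; rewrite !mem_cat [_ \in map F3 P2]map_f// !orbT.
have F4w x : x \in P2 -> F4 x w = 0.
  by move=> xP; apply: Fw; rewrite !mem_cat [_ \in map F4 P2]map_f// !orbT.
have leaf_smooth i := leaf_form_smooth wH i.
(* This comes before [form0], as the vanishing of the curvature is what makes [form10]
   holomorphic. *)
have curv0 : forall i z, cdisc (A i) z -> leaf_curvature g w i z = 0.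
  apply: (P1P (leaf_curvature g w)).
  - move=> i; apply: (@harmonic_curvature_holomorphic _ _ (leaf_density g i) (leaf_form w i)
      (@Oo i) (leaf_smooth i).1 (leaf_smooth i).2 (lam_smooth i 0) (@ld0 i)).
    by move=> z zi; have [_ _ _ wh] := wH; exact: (wh i z 0 zi).
  - move=> i j l il jl; rewrite !mulr1.
    by rewrite (leaf_curvature_transition A_atlas g_kahler g_indep wH w_indep il jl).
  - move=> x xP; rewrite /leaf_curvature /curvature.
    have f1 := F1w x xP; have f2 := F2w x xP; rewrite /F1 in f1; rewrite /F2 in f2.
    by rewrite f1 f2 oppr0.
have form0 : forall i z, cdisc (A i) z -> form10 (leaf_form w i) z = 0.
  apply: (P2P (fun i => form10 (leaf_form w i))).
  - move=> i; exact: (form10_holomorphic (@Oo i) (leaf_smooth i).1 (leaf_smooth i).2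
      (@ld0 i) (@curv0 i)).
  - move=> i j l il jl.
    rewrite (form10_transition A_atlas wH w_indep il jl).
    rewrite (leaf_density_transition A_atlas g_kahler g_indep il jl).
    by rewrite cabsM exprMn mulrA.
  - move=> x xP; rewrite /form10.
    have f3 := F3w x xP; have f4 := F4w x xP; rewrite /F3 in f3; rewrite /F4 in f4.
    by rewrite f3 f4 oppr0.
(* For real coefficients, a - i b = 0 gives a = b = 0; independence of theta carries this from the
   slice 0 to the others. *)
move=> i [z theta] [/= zi _].
have [r1 r2] := wr i (z, theta) (conj zi Logic.I).
rewrite (w_indep i z theta 0 zi) in r1 r2 *.
have := form0 i z zi; rewrite /form10 /leaf_form; move: r1 r2.
case: (w i (z, 0)) => [[a1 a2] [b1 b2]] /= -> -> [-> /eqP].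
by rewrite oppr_eq0 => /eqP ->.
Qed.

End HarmonicSpace.

(** * Fourier analysis on Z_p^m *)

Section RootsOfUnity.
Variable R : realType.
Implicit Types (s t : R).

(** This is exp (2 i pi t), in the form used by [pairing]. *)
Definition ez t : R[i] := cos (2 * pi * t) +i* sin (2 * pi * t).

Lemma ezD s t : ez (s + t) = ez s * ez t.
Proof.
rewrite /ez mulrDr cosD sinD; apply/eqP; rewrite eq_complex /= eqxx /=.
by apply/eqP; ring.
Qed.

Lemma ez0 : ez 0 = 1. Proof. by rewrite /ez mulr0 cos0 sin0. Qed.

Lemma ez_nat n : ez n%:R = 1.
Proof.
elim: n => [|n IHn]; first exact: ez0.
by rewrite -natr1 ezD IHn /ez mulr1 mulr_natl cos2pi sin2pi mul1r.
Qed.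

Lemma ez_sum I (r : seq I) (P : pred I) (F : I -> R) :
  ez (\sum_(i <- r | P i) F i) = \prod_(i <- r | P i) ez (F i).
Proof. exact: (big_morph ez ezD ez0). Qed.

Lemma ezNK t : ez (- t) * ez t = 1.
Proof. by rewrite -ezD addNr ez0. Qed.

(** By the half-angle formula, cos (2 pi t) = 1 forces sin (pi t) = 0, and pi t is in [0, pi[, where
    sin vanishes at 0 only. *)
Lemma ez_eq1 t : 0 <= t < 1 -> ez t = 1 -> t = 0.
Proof.
move=> /andP[t0 t1] [+ _].
rewrite -mulrA mulr_natl cos_mulr2n => /eqP; rewrite subr_eq -(mulr2n 1) => /eqP H.
have : sin (pi * t) = 0.
  by apply/eqP; rewrite -sqrf_eq0 sin2cos2; apply/eqP; move: H; rewrite !mulr2n; lra.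
have [->//|tn0] := eqVneq t 0.
have tgt0 : 0 < t by rewrite lt_def tn0.
have /gt_eqF : 0 < sin (pi * t).
  by rewrite sin_gt0_pi// mulr_gt0 ?pi_gt0//= gtr_pMr ?pi_gt0.
by move=> /eqP.
Qed.

Lemma ez_inj s t : 0 <= s < 1 -> 0 <= t < 1 -> ez s = ez t -> s = t.
Proof.
wlog st : s t / s <= t => [H s01 t01 E|].
  have [|/ltW] := leP s t; first by move=> /H; apply.
  by move=> /H/(_ t01 s01 (esym E)).
move=> /andP[s0 s1] /andP[t0 t1] E.
have : ez (t - s) = 1 by rewrite addrC ezD -E ezNK.
move=> /ez_eq1 H; apply/eqP; rewrite eq_sym -subr_eq0; apply/eqP; apply: H.
by rewrite subr_ge0 st /= ltrBlDr; lra.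
Qed.

Lemma ez_mod (K q a : nat) : (0 < q)%N ->
  ez (K%:R / q%:R * (a %% q)%:R) = ez (K%:R / q%:R * a%:R).
Proof.
move=> q0; rewrite [a in RHS](divn_eq a q) natrD mulrDr ezD.
have -> : K%:R / q%:R * (a %/ q * q)%:R = (K * (a %/ q))%:R :> R.
  by rewrite !natrM; field; rewrite pnatr_eq0 -lt0n.
by rewrite ez_nat mul1r.
Qed.

Lemma ez_geometric (q a : nat) : (0 < q)%N -> (a < q)%N ->
  \sum_(k < q) ez (k%:R / q%:R * a%:R) = if a == 0%N then q%:R else 0.
Proof.
move=> q0 aq; have [->|a0] := eqVneq a 0%N.
  under eq_bigr do rewrite mulr0 ez0.
  by rewrite sumr_const card_ord.
pose x := ez (a%:R / q%:R).
have xE k : ez (k%:R / q%:R * a%:R) = x ^+ k.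
  elim: k => [|k IHk]; first by rewrite mul0r mul0r ez0.
  rewrite exprS -IHk /x -ezD; congr ez; rewrite -natr1; ring.
under eq_bigr do rewrite xE.
have x1 : x - 1 != 0.
  rewrite subr_eq0; apply/eqP => /ez_eq1 H.
  have : a%:R / q%:R = 0 :> R.
    by apply: H; rewrite divr_ge0//= ltr_pdivrMr ?ltr0n// mul1r ltr_nat.
  by move=> /eqP; rewrite mulf_eq0 invr_eq0 !pnatr_eq0 (negbTE a0) gtn_eqF.
have xq : x ^+ q = 1.
  by rewrite -xE divff ?mul1r ?ez_nat// pnatr_eq0 -lt0n.
by apply: (mulfI x1); rewrite mulr0 -subrX1 xq subrr.
Qed.

End RootsOfUnity.

Section Digits.
Variables (R : realType) (p : nat) (p_pr : prime p).
Implicit Types (s : seq 'I_p) (a : 'I_p).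

Let p0 : (0 < p)%N. Proof. exact: prime_gt0. Qed.
Let pR0 : (p%:R : R) != 0. Proof. by rewrite pnatr_eq0 -lt0n. Qed.

Definition digits_value s : R :=
  \sum_(l < size s) (nth 0%N (map val s) l)%:R / p%:R ^+ l.+1.

(** The default value 1 makes the empty sequence, the digits of 0, reduced. *)
Definition reduced s := last 1%N (map val s) != 0%N.

Lemma digits_value_nil : digits_value [::] = 0.
Proof. by rewrite /digits_value big_ord0. Qed.

Lemma digits_value_cons a s : digits_value (a :: s) = (a%:R + digits_value s) / p%:R.
Proof.
rewrite /digits_value /= big_ord_recl /= expr1 mulrDl; congr (_ + _).
by rewrite mulr_suml; apply: eq_bigr => l _; rewrite /= [p%:R ^+ l.+2]exprSr invfM mulrA.
Qed.

Lemma digits_value_rcons s a :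
  digits_value (rcons s a) = digits_value s + a%:R / p%:R ^+ (size s).+1.
Proof.
elim: s => [|b s IHs]; first by rewrite digits_value_cons digits_value_nil add0r addr0 expr1.
rewrite rcons_cons !digits_value_cons IHs /= [p%:R ^+ (size s).+2]exprSr.
by field; rewrite pR0 expf_neq0.
Qed.

Lemma digits_value_ge0 s : 0 <= digits_value s.
Proof. by apply: sumr_ge0 => l _; rewrite divr_ge0// exprn_ge0. Qed.

Lemma digits_value_lt1 s : digits_value s < 1.
Proof.
elim: s => [|a s IHs]; first by rewrite digits_value_nil.
rewrite digits_value_cons ltr_pdivrMr ?ltr0n// mul1r.
apply: lt_le_trans (_ : a%:R + 1 <= _); first by rewrite ltrD2l.
by rewrite natr1 ler_nat.
Qed.

Lemma digits_value_frac s : exists K : nat, digits_value s = K%:R / (p ^ size s)%:R.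
Proof.
elim/last_ind: s => [|s a [K KE]]; first by exists 0%N; rewrite digits_value_nil mul0r.
exists (K * p + a)%N; rewrite digits_value_rcons KE size_rcons natrD natrM !natrX exprSr.
by field; rewrite pR0 expf_neq0.
Qed.

Lemma reduced_behead a s : reduced (a :: s) -> reduced s.
Proof. by case: s. Qed.

Lemma digits_value_eq0 s : reduced s -> digits_value s = 0 -> s = [::].
Proof.
elim: s => // a s IHs red; rewrite digits_value_cons => /eqP.
rewrite mulf_eq0 invr_eq0 (negbTE pR0) orbF paddr_eq0 ?digits_value_ge0//.
move=> /andP[a0 /eqP /(IHs (reduced_behead red)) s0].
by move: red a0; rewrite s0 /reduced /= pnatr_eq0 => /negbTE ->.
Qed.

(** Uniqueness of finite expansions in base p: multiplication by p exposes the first digit as an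
    integer part, the rest being in [0, 1[, and [reduced] excludes trailing zeros. *)
Lemma digits_value_inj s s' : reduced s -> reduced s' ->
  digits_value s = digits_value s' -> s = s'.
Proof.
elim: s s' => [|a s IHs] [|b s'] // red red'.
- by rewrite digits_value_nil => /esym/(digits_value_eq0 red') ->.
- by rewrite digits_value_nil => /(digits_value_eq0 red) ->.
rewrite !digits_value_cons => /(mulIf (invr_neq0 pR0)) E.
have := digits_value_ge0 s; have := digits_value_ge0 s'.
have := digits_value_lt1 s; have := digits_value_lt1 s' => h1 h2 h3 h4.
have ab : a = b.
  apply: val_inj; apply/eqP; rewrite eqn_leq /=; apply/andP; split.
    by rewrite -ltnS -(ltr_nat R) -natr1; lra.
  by rewrite -ltnS -(ltr_nat R) -natr1; lra.
move: E; rewrite ab => /addrI /(IHs _ (reduced_behead red) (reduced_behead red')).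
by move=> ->.
Qed.

(** If p divides k, the fraction simplifies to denominator p^(n - 1) and induction applies;
    otherwise the n-th digit is k mod p, which is nonzero, and the expansion is reduced. *)
Lemma digits_value_surj n (k : nat) : (k < p ^ n)%N ->
  exists s, [/\ reduced s, (size s <= n)%N & digits_value s = k%:R / (p ^ n)%:R].
Proof.
have full i j : (j < p ^ i)%N ->
    exists s, size s = i /\ digits_value s = j%:R / (p ^ i)%:R.
  elim: i j => [|i IHi] j.
    rewrite expn0 ltnS leqn0 => /eqP ->.
    by exists [::]; rewrite digits_value_nil mul0r.
  rewrite expnSr -ltn_divLR// => /IHi[s [sz sE]].
  exists (rcons s (Ordinal (ltn_pmod j p0))); rewrite size_rcons sz; split=> //.
  rewrite digits_value_rcons sE sz /= [in RHS](divn_eq j p) natrD !natrM !natrX exprSr.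
  by field; rewrite pR0 expf_neq0.
elim: n k => [|n IHn] k.
  rewrite expn0 ltnS leqn0 => /eqP ->.
  by exists [::]; rewrite digits_value_nil mul0r.
have [pk|pk] := eqVneq (k %% p)%N 0%N.
  rewrite expnSr -ltn_divLR// => /IHn[s [red sz sE]].
  exists s; split=> //; first exact: leqW.
  rewrite sE [in RHS](divn_eq k p) pk addn0 !natrM !natrX.
  by field; rewrite pR0 expf_neq0.
rewrite expnSr -ltn_divLR// => kn; have [s [sz sE]] := full n _ kn.
exists (rcons s (Ordinal (ltn_pmod k p0))); rewrite size_rcons sz; split=> //.
  by rewrite /reduced map_rcons last_rcons.
rewrite digits_value_rcons sE sz /= [in RHS](divn_eq k p) natrD !natrM !natrX exprSr.
by field; rewrite pR0 expf_neq0.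
Qed.

End Digits.

(** * Topology and characters of Z_p^m *)

Section PadicVectors.
Variables (R : realType) (p : nat) (p_pr : prime p) (m : nat).
Local Notation Zp := (padic_int p_pr).
Local Notation Zpm := (zpm p_pr m).
Implicit Types (x y : Zp) (xi theta : Zpm) (chi : zpm_dual p m).

Let pX0 n : (0 < p ^ n)%N. Proof. by rewrite expn_gt0 prime_gt0. Qed.

Lemma residue_ltn x n : (x n < p ^ n)%N.
Proof. by rewrite residue_compat ltn_mod. Qed.

Lemma residueD x y n : (x + y) n = ((x n + y n) %% p ^ n)%N.
Proof. by []. Qed.

Lemma residueB_eq0 x y n : ((x - y) n == 0%N) = (x n == y n).
Proof.
have E : x n = (((x - y)%R n + y n) %% p ^ n)%N by rewrite -residueD subrK.
apply/eqP/eqP => [xy|xy].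
  by rewrite E xy add0n modn_small// residue_ltn.
by rewrite residueD xy -residueD subrr residue0.
Qed.

Lemma zpm_nbhsP theta (P : set Zpm) : nbhs theta P <->
  exists n, forall theta', (forall j, theta' j ord0 n = theta j ord0 n) -> P theta'.
Proof.
split=> [[B /= Bth BP]|[n nP]].
  have /choice[f fP] : forall j : 'I_m, exists n, forall y : Zp,
      y n = theta j ord0 n -> B j ord0 y.
    by move=> j; have [n _ nB] := Bth j ord0; exists n => y; exact: nB.
  exists (\max_j f j) => theta' E; apply: BP => j k; rewrite (ord1 k); apply: fP.
  have fj : (f j <= \max_j f j)%N by exact: leq_bigmax.
  by rewrite -(residue_mod _ fj) E residue_mod.
exists (fun j k => [set y : Zp | y n = theta j k n]).
  by move=> j k; exists n.
by move=> theta' E; apply: nP => j; exact: E.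
Qed.

(** There are finitely many residue classes mod p^n, so an ultrafilter contains one of them for each
    n; any two of these meet, hence they are compatible and define its limit. *)
Lemma zpm_compact : compact [set: Zpm].
Proof.
rewrite compact_ultra => F FU _.
pose T n := {ffun 'I_m -> 'I_(p ^ n)}.
pose f n theta : T n := [ffun j => Ordinal (residue_ltn (theta j ord0) n)].
have /choice[r rF] : forall n, exists r : 'I_m -> nat,
    F [set theta : Zpm | forall j, theta j ord0 n = r j].
  move=> n; apply: contrapT => /forallNP nF.
  have : \forall x \near F, forall t : T n, (~` (f n @^-1` [set t])) x.
    apply: filter_forall => t.
    have [Ft|//] := @in_ultra_setVsetC _ F (f n @^-1` [set t]) FU.
    exfalso; apply: (nF (fun j => val (t j))); apply: filterS Ft => theta /= <- j.
    by rewrite ffunE.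
  by move=> /filter_ex[theta /(_ (f n theta))]; apply.
have rc n j : r n.+1 j = r n j %[mod p ^ n].
  have [theta [h1 h2]] := filter_ex (filterI (rF n) (rF n.+1)).
  rewrite -(h1 j) -(h2 j) [in RHS](residue_compat (theta j ord0) n) modn_mod.
  by [].
have fE j : `[< forall n, r n.+1 j = r n j %[mod p ^ n] >] by apply/asboolP.
pose lim : Zpm := \col_j padic_of p_pr (fE j).
exists lim; split=> // P /zpm_nbhsP[n nP]; apply: filterS (rF n) => theta th.
apply: nP => j; rewrite mxE /= th.
have [theta' h1] := filter_ex (rF n).
by rewrite -(h1 j) modn_small// residue_ltn.
Qed.

Definition coset n theta xi := [forall j, xi j ord0 n == theta j ord0 n].

Lemma cosetP n theta xi :
  reflect (forall j, xi j ord0 n = theta j ord0 n) (coset n theta xi).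
Proof. by apply: (iffP forallP) => H j; apply/eqP; exact: H. Qed.

(** One coordinate of [pairing]. By [char_term_residue], the residue can be read at any level n >=
    size s, hence at a common level for all coordinates. *)
Definition char_term (s : seq 'I_p) x : R[i] :=
  ez (digits_value R s * (x (size s))%:R).

Lemma char_termD s x y : char_term s (x + y) = char_term s x * char_term s y.
Proof.
have [K KE] := digits_value_frac R p_pr s.
rewrite /char_term KE residueD ez_mod//.
by rewrite natrD mulrDr ezD.
Qed.

Lemma char_term_residue s x n : (size s <= n)%N ->
  char_term s x = ez (digits_value R s * (x n)%:R).
Proof.
move=> sn; have [K KE] := digits_value_frac R p_pr s.
by rewrite /char_term KE -(residue_mod x sn) ez_mod.
Qed.

Lemma pairingE chi xi : pairing R chi xi = \prod_j char_term (val (chi j)) (xi j ord0).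
Proof. by rewrite -ez_sum. Qed.

Lemma pairingD chi xi theta :
  pairing R chi (xi + theta) = pairing R chi xi * pairing R chi theta.
Proof.
by rewrite !pairingE -big_split; apply: eq_bigr => j _; rewrite mxE char_termD.
Qed.

Lemma pairing0 chi : pairing R chi (0 : Zpm) = 1.
Proof.
rewrite pairingE big1// => j _.
by rewrite /char_term mxE residue0 mulr0 ez0.
Qed.

Lemma pairingN chi xi : pairing R chi (- xi) * pairing R chi xi = 1.
Proof. by rewrite -pairingD addNr pairing0. Qed.

Lemma pairing_locally_constant chi : locally_constant (pairing R chi : Zpm -> R[i]).
Proof.
move=> theta; apply/zpm_nbhsP; exists (\max_j size (val (chi j))) => theta' E.
rewrite !pairingE; apply: eq_bigr => j _.
have sj : (size (val (chi j)) <= \max_j size (val (chi j)))%N.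
  exact: (@leq_bigmax _ (fun j => size (val (chi j)))).
by rewrite !(char_term_residue _ sj) E.
Qed.

Lemma char_term1 s : char_term s (1 : Zp) = ez (digits_value R s).
Proof.
(* For the empty sequence the residue of 1 mod p^0 is 0, not 1, which is harmless as the value is 0
   too. *)
rewrite /char_term; case: s => [|a s]; first by rewrite digits_value_nil mul0r.
suff -> : (1 : Zp) (size (a :: s)) = 1%N by rewrite mulr1.
rewrite /= modn_small//; apply: leq_trans (prime_gt1 p_pr) _.
by rewrite expnS leq_pmulr.
Qed.

Lemma pairing_unit chi j :
  pairing R chi (\col_k (if k == j then 1 else 0) : Zpm) = ez (digits_value R (val (chi j))).
Proof.
rewrite pairingE (bigD1 j)//= mxE eqxx char_term1 big1 ?mulr1// => k kj.
by rewrite mxE (negbTE kj) /char_term residue0 mulr0 ez0.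
Qed.

(** A unit vector at a coordinate j where the characters differ will do: it pairs to the
    exponentials of two values in [0, 1[, which determine the reduced digits. *)
Lemma pairing_separates chi chi' : chi != chi' -> exists xi : Zpm,
  pairing R chi (- xi) * pairing R chi' xi != 1.
Proof.
move=> cc'; have [j cj] : exists j, chi j != chi' j.
  apply: contrapT => /forallNP H; move/eqP : cc'; apply; apply/ffunP => j.
  by apply/eqP; apply: contrapT => /negP; exact: H.
exists (\col_k (if k == j then 1 else 0)); apply/eqP => E.
move/negP : cj; apply; apply/eqP/val_inj.
have p1 (s : seq 'I_p) : 0 <= digits_value R s < 1.
  by apply/andP; split; [exact: digits_value_ge0|exact: digits_value_lt1].
apply: (digits_value_inj p_pr (valP (chi j)) (valP (chi' j))).
apply: ez_inj (p1 _) (p1 _) _; rewrite -!pairing_unit.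
set xi := (X in pairing R chi (- X)) in E *.
by rewrite -[LHS]mulr1 -E mulrA [_ * pairing R chi (- _)]mulrC pairingN mul1r.
Qed.

Lemma char_norm_eq0 chi : char_norm chi = 0%N -> forall j, val (chi j) = [::].
Proof.
move=> /eqP H j; apply: size0nil; apply/eqP; rewrite -leqn0 leqNgt; apply/negP => s0.
move: H; rewrite /char_norm -leqn0 leqNgt => /negP; apply.
have : (p ^ char_depth chi j <= \max_(k < m | (0 < char_depth chi k)%N) p ^ char_depth chi k)%N.
  exact: (@leq_bigmax_cond _ (fun k => (0 < char_depth chi k)%N) (fun k => (p ^ char_depth chi k)%N)).
by apply: leq_trans.
Qed.

End PadicVectors.

(** * Haar integration and orthogonality of characters *)

Section Integration.
Variables (R : realType) (p : nat) (p_pr : prime p) (m : nat).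
Local Notation Zpm := (zpm p_pr m).
Implicit Types (xi theta : Zpm) (chi : zpm_dual p m).
Variable mu : probability (borel_zpm p_pr m) R.
Hypothesis mu_haar : is_haar mu.
Implicit Types (v : Zpm -> R) (u : Zpm -> R[i]).

Let Rint v : R := Rintegral mu setT v.

Lemma continuous_borel v : continuous v ->
  measurable_fun setT (v : borel_zpm p_pr m -> R).
Proof.
move=> /continuousP cv; apply: (measurability _ (measurable_realfun.RGenOpens.measurableE R)).
move=> _ [_ [a [b ->] <-]]; rewrite setTI; apply: sub_sigma_algebra.
by apply: cv; exact: interval_open.
Qed.

Lemma continuous_zpm_integrable v : continuous v ->
  mu.-integrable setT (EFin \o (v : borel_zpm p_pr m -> R)).
Proof.
move=> cv; apply: measurable_bounded_integrable => //.
- by apply: (le_lt_trans (probability_le1 mu measurableT)); rewrite ltry.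
- exact: continuous_borel.
have [x _ xmax] : exists2 x, x \in [set: Zpm] & forall y, y \in [set: Zpm] -> `|v y| <= `|v x|.
  apply: (@compact_EVT_max _ _ (fun y => `|v y|) setT _ (@zpm_compact p p_pr m)).
    by exists 0.
  apply: continuous_subspaceT => y.
  by apply: continuous_comp; [exact: cv|exact: norm_continuous].
exists `|v x|; split; first exact: num_real.
by move=> M /ltW vM y _ /=; rewrite (le_trans _ vM)// xmax// inE.
Qed.

Lemma zpm_translate_continuous (b : Zpm) : continuous (fun xi : Zpm => xi + b).
Proof.
move=> xi P /zpm_nbhsP[n nP]; apply/zpm_nbhsP; exists n => xi' E /=.
by apply: nP => j; rewrite !mxE !residueD E.
Qed.

Lemma Rintegral_translate v b : continuous v -> Rint (fun xi => v (xi + b)) = Rint v.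
Proof.
move=> cv; rewrite /Rint /Rintegral; congr fine.
pose phi : borel_zpm p_pr m -> borel_zpm p_pr m := fun xi : Zpm => xi + b.
have phi_open (O : set Zpm) : open O -> open ((fun xi : Zpm => xi + b) @^-1` O).
  by move=> Oo; apply: open_comp => // x _; exact: zpm_translate_continuous.
have mphi : measurable_fun setT phi.
  apply: (@measurability _ _ _ (borel_zpm p_pr m) setT phi (@open Zpm) erefl) => _ [ O Oo <-]; rewrite setTI.
  by apply: sub_sigma_algebra; exact: phi_open.
have cvb : continuous (fun xi => v (xi + b)).
  by move=> x; apply: continuous_comp; [exact: zpm_translate_continuous|exact: cv].
have H := @integral_pushforward _ _ (borel_zpm p_pr m) (borel_zpm p_pr m) R phi mphi mu
  setT (EFin \o (v : borel_zpm p_pr m -> R)).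
rewrite -[LHS]H ?preimage_setT//; first last.
- exact: continuous_zpm_integrable.
- by apply/measurable_realfun.measurable_EFinP; exact: continuous_borel.
apply: eq_measure_integral => E mE _; rewrite /pushforward.
(* [is_haar] concerns images: the preimage of E under the translation by b is its image under the
   translation by - b. *)
rewrite -[RHS](mu_haar (- b) mE); congr (mu _).
apply/seteqP; split => [x xE|x [y yE <-]].
  by exists (x + b) => //; rewrite addrK.
by rewrite /preimage /phi /= subrK.
Qed.

Definition continuousC u :=
  continuous (fun xi => complex.Re (u xi)) /\ continuous (fun xi => complex.Im (u xi)).

Lemma locally_constant_continuousC u : locally_constant u -> continuousC u.
Proof.
move=> lu; split=> xi P Pxi; apply: filterS (lu xi) => xi' E;
  by rewrite /preimage /= E; exact: nbhs_singleton Pxi.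
Qed.

Lemma continuousC_cst c : continuousC (fun=> c).
Proof.
by split; [exact: (@cst_continuous Zpm R (complex.Re c))|
  exact: (@cst_continuous Zpm R (complex.Im c))].
Qed.

Lemma continuousCD u u' : continuousC u -> continuousC u' ->
  continuousC (fun xi => u xi + u' xi).
Proof.
move=> [u1 u2] [v1 v2]; split=> xi.
  have -> : (fun xi => complex.Re (u xi + u' xi)) =
    (fun xi => complex.Re (u xi) + complex.Re (u' xi)).
    by apply: funext => y; case: (u y) => a b; case: (u' y).
  exact: (cvgD (u1 xi) (v1 xi)).
have -> : (fun xi => complex.Im (u xi + u' xi)) =
  (fun xi => complex.Im (u xi) + complex.Im (u' xi)).
  by apply: funext => y; case: (u y) => a b; case: (u' y).
exact: (cvgD (u2 xi) (v2 xi)).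
Qed.

Lemma continuousCM u u' : continuousC u -> continuousC u' ->
  continuousC (fun xi => u xi * u' xi).
Proof.
move=> [u1 u2] [v1 v2]; split=> xi.
  have -> : (fun xi => complex.Re (u xi * u' xi)) =
    (fun xi => complex.Re (u xi) * complex.Re (u' xi) - complex.Im (u xi) * complex.Im (u' xi)).
    by apply: funext => y; case: (u y) => a b; case: (u' y).
  exact: (cvgB (cvgM (u1 xi) (v1 xi)) (cvgM (u2 xi) (v2 xi))).
have -> : (fun xi => complex.Im (u xi * u' xi)) =
  (fun xi => complex.Re (u xi) * complex.Im (u' xi) + complex.Im (u xi) * complex.Re (u' xi)).
  by apply: funext => y; case: (u y) => a b; case: (u' y).
exact: (cvgD (cvgM (u1 xi) (v2 xi)) (cvgM (u2 xi) (v1 xi))).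
Qed.

Lemma integralCD u u' : continuousC u -> continuousC u' ->
  integralC mu (fun xi => u xi + u' xi) = integralC mu u + integralC mu u'.
Proof.
move=> [u1 u2] [v1 v2]; apply/eqP; rewrite eq_complex /=; apply/andP.
split; apply/eqP.
  rewrite -RintegralD//; try exact: continuous_zpm_integrable.
  by apply: eq_Rintegral => y _; case: (u y) => a b; case: (u' y).
rewrite -RintegralD//; try exact: continuous_zpm_integrable.
by apply: eq_Rintegral => y _; case: (u y) => a b; case: (u' y).
Qed.

Lemma integralCZ c u : continuousC u ->
  integralC mu (fun xi => c * u xi) = c * integralC mu u.
Proof.
move=> [u1 u2]; case: c => a b; apply/eqP; rewrite eq_complex /=; apply/andP.
have H r v : continuous v -> mu.-integrable setT (EFin \o ((fun y => r * v y) : borel_zpm p_pr m -> R)).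
  by move=> cv; apply: continuous_zpm_integrable => x; exact: (cvgM (@cst_continuous Zpm R r x) (cv x)).
split; apply/eqP.
  rewrite -!RintegralZl//; try exact: continuous_zpm_integrable.
  rewrite -RintegralB//; try exact: H.
  by apply: eq_Rintegral => y _; case: (u y).
rewrite -!RintegralZl//; try exact: continuous_zpm_integrable.
rewrite -RintegralD//; try exact: H.
by apply: eq_Rintegral => y _; case: (u y).
Qed.

Lemma integralC_cst c : integralC mu (fun=> c) = c.
Proof.
have mu1 r : Rintegral mu setT (fun=> r) = r.
  rewrite Rintegral_cst//; have E := probability_setT mu.
  by transitivity (r * fine (1%E : \bar R)); [congr (_ * fine _)|rewrite /= mulr1].
by rewrite /integralC !mu1; case: c.
Qed.

Lemma integralC_sum (I : finType) (F : I -> Zpm -> R[i]) :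
  (forall i, continuousC (F i)) ->
  continuousC (fun xi => \sum_i F i xi) /\
  integralC mu (fun xi => \sum_i F i xi) = \sum_i integralC mu (F i).
Proof.
move=> cF; elim: (index_enum I) => [|i s [IH1 IH2]].
  have -> : (fun xi => \sum_(i <- [::]) F i xi) = fun=> 0.
    by apply: funext => xi; rewrite big_nil.
  by rewrite big_nil integralC_cst; split=> //; exact: continuousC_cst.
have -> : (fun xi => \sum_(j <- i :: s) F j xi) = (fun xi => F i xi + \sum_(j <- s) F j xi).
  by apply: funext => xi; rewrite big_cons.
by rewrite integralCD// big_cons IH2; split=> //; exact: continuousCD.
Qed.

Lemma integralC_translate u b : continuousC u ->
  integralC mu (fun xi => u (xi + b)) = integralC mu u.
Proof.
move=> [u1 u2]; rewrite /integralC.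
by congr (_ +i* _); [exact: (Rintegral_translate b u1)|exact: (Rintegral_translate b u2)].
Qed.

Lemma continuousC_pairing chi : continuousC (pairing R chi : Zpm -> R[i]).
Proof. exact: locally_constant_continuousC (@pairing_locally_constant R p p_pr m chi). Qed.

Lemma continuousC_pairingN chi : continuousC (fun xi : Zpm => pairing R chi (- xi)).
Proof.
apply: locally_constant_continuousC => xi.
have H := @pairing_locally_constant R p p_pr m chi (- xi).
move: H => /zpm_nbhsP[n nP]; apply/zpm_nbhsP; exists n => xi' E; apply: nP => j.
rewrite !mxE; apply/eqP; rewrite -residueB_eq0 opprK addrC residueB_eq0.
by rewrite E.
Qed.

(** Invariance under the translation by b identifies the integral with c times itself. *)
Lemma integralC_eigen u c b : continuousC u ->
  (forall xi, u (xi + b) = c * u xi) -> c != 1 -> integralC mu u = 0.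
Proof.
move=> cu uE c1; have := integralC_translate b cu.
rewrite (funext uE) integralCZ// => E; apply/eqP.
have : (c - 1) * integralC mu u == 0 by rewrite mulrBl mul1r E subrr.
by rewrite mulf_eq0 subr_eq0 (negbTE c1).
Qed.

Lemma pairing_orthonormal chi chi' :
  integralC mu (fun xi => pairing R chi (- xi) * pairing R chi' xi) = (chi == chi')%:R.
Proof.
have [->|cc'] := eqVneq chi chi'.
  rewrite (_ : (fun _ => _) = fun=> 1) ?integralC_cst//.
  by apply: funext => xi; rewrite pairingN.
have [b bc] := pairing_separates R p_pr cc'.
apply: (integralC_eigen (b := b) _ _ bc).
  by apply: continuousCM; [exact: continuousC_pairingN|exact: continuousC_pairing].
by move=> xi; rewrite opprD !pairingD; ring.
Qed.

Lemma integralC_pairing chi : char_norm chi != 0%N -> integralC mu (pairing R chi) = 0.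
Proof.
move=> c0; pose triv : zpm_dual p m := [ffun=> Sub [::] isT].
have -> : pairing R chi = fun xi : Zpm => pairing R triv (- xi) * pairing R chi xi.
  apply: funext => xi; rewrite [pairing R triv _]pairingE big1 ?mul1r// => j _.
  by rewrite ffunE /char_term SubK digits_value_nil mul0r ez0.
rewrite pairing_orthonormal; case: eqVneq => // E; move: c0; rewrite -E.
by rewrite /char_norm big_pred0// => j; rewrite /char_depth ffunE SubK.
Qed.

End Integration.

(** * Functions whose Fourier coefficients vanish at nontrivial characters *)

Section FourierInversion.
Variables (R : realType) (p : nat) (p_pr : prime p) (m : nat).
Local Notation Zpm := (zpm p_pr m).
Implicit Types (xi theta : Zpm) (chi : zpm_dual p m).
Variable mu : probability (borel_zpm p_pr m) R.
Hypothesis mu_haar : is_haar mu.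
Implicit Types (v : Zpm -> R) (u : Zpm -> R[i]).

Let pX0 n : (0 < p ^ n)%N. Proof. by rewrite expn_gt0 prime_gt0. Qed.

Let natrC k : (k%:R : R)%:C = k%:R.
Proof. exact: (rmorph_nat (real_complex R)). Qed.

Lemma pairing_char_norm0 chi xi : char_norm chi = 0%N -> pairing R chi xi = 1.
Proof.
move=> c0; rewrite pairingE big1// => j _.
by rewrite (char_norm_eq0 p_pr c0) /char_term digits_value_nil mul0r ez0.
Qed.

(** Fourier inversion for the point mass at 0 of the finite group (Z/p^n)^m, evaluated at xi -
    theta; the sum over the characters factors into one geometric sum for each coordinate. The
    trivial character is singled out for [coset_weight]. *)
Lemma coset_fourier n : exists (T : finType) (chi : T -> zpm_dual p m),
  (exists k, char_norm (chi k) = 0%N) /\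
  forall theta xi, (coset n theta xi)%:R =
    ((p ^ n)%:R^-1) ^+ m * \sum_k pairing R (chi k) (- theta) * pairing R (chi k) xi.
Proof.
have /choice[f fP] : forall k : 'I_(p ^ n), exists s : char_coord p,
    (size (val s) <= n)%N /\ digits_value R (val s) = k%:R / (p ^ n)%:R.
  move=> k; have [s [red sn sk]] := digits_value_surj R p_pr (ltn_ord k).
  by exists (exist _ s red).
exists {ffun 'I_m -> 'I_(p ^ n)}, 
  (fun k : {ffun 'I_m -> 'I_(p ^ n)} => [ffun j => f (k j)] : zpm_dual p m); split.
  exists [ffun=> Ordinal (pX0 n)]; rewrite /char_norm big_pred0// => j.
  rewrite /char_depth !ffunE; have [_ f0] := fP (Ordinal (pX0 n)).
  by rewrite (@digits_value_eq0 R p p_pr _ (valP (f (Ordinal (pX0 n)))) _)// f0 mul0r.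
move=> theta xi.
have -> : (coset n theta xi)%:R = \prod_j ((xi - theta) j ord0 n == 0%N)%:R :> R[i].
  have [/cosetP H|] := boolP (coset n theta xi).
    by rewrite big1// => j _; rewrite !mxE residueB_eq0 H eqxx.
  rewrite negb_forall => /existsP[j jP].
  by rewrite (bigD1 j)//= !mxE residueB_eq0 (negbTE jP) mul0r.
have -> : ((p ^ n)%:R^-1) ^+ m = \prod_(j < m) (p ^ n)%:R^-1 :> R[i].
  by rewrite prodr_const card_ord.
under [X in _ = _ * X]eq_bigr => k _.
  rewrite -pairingD addrC pairingE.
  under eq_bigr => j _.
    have [sn sv] := fP (k j).
    rewrite ffunE (char_term_residue _ _ sn) sv; over.
  over.
have := bigA_distr_bigA (fun (j : 'I_m) (k : 'I_(p ^ n)) =>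
  ez (k%:R / (p ^ n)%:R * ((xi - theta)%R j ord0 n)%:R) : R[i]).
move=> /= <-; rewrite -big_split; apply: eq_bigr => j _ /=.
rewrite ez_geometric ?residue_ltn//; case: eqP => _; last by rewrite mulr0.
by rewrite mulVf// pnatr_eq0 -lt0n.
Qed.

(** In the expansion of the coset, only characters of norm 0 meet a possibly nonzero coefficient of
    u, and these pair to 1 with - theta: this is how theta disappears from the right-hand side. *)
Lemma integralC_coset n : exists (c : R[i]) (T : finType) (chi : T -> zpm_dual p m),
  [/\ c != 0, exists k, char_norm (chi k) = 0%N &
  forall u theta, continuousC u ->
  (forall chi, char_norm chi != 0%N -> fourier mu u chi = 0) ->
  integralC mu (fun xi => u xi * (coset n theta xi)%:R) =
    c * \sum_k fourier mu u (chi k)].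
Proof.
have [T [chi [k0 E]]] := coset_fourier n.
exists (((p ^ n)%:R^-1) ^+ m), T, chi; split=> //.
  by rewrite expf_neq0// invr_eq0 pnatr_eq0 -lt0n.
move=> u theta cu u0; set c := _ ^+ m.
have cF k : continuousC (fun xi => pairing R (chi k) (- theta) * (u xi * pairing R (chi k) xi)).
  apply: continuousCM; first exact: continuousC_cst.
  by apply: continuousCM => //; exact: continuousC_pairing.
have [cS S] := integralC_sum mu cF.
have -> : (fun xi => u xi * (coset n theta xi)%:R) =
    fun xi => c * \sum_k pairing R (chi k) (- theta) * (u xi * pairing R (chi k) xi).
  apply: funext => xi; rewrite E mulrCA; congr (_ * _); rewrite mulr_sumr.
  by apply: eq_bigr => k _; rewrite mulrCA.
rewrite integralCZ// S; congr (_ * _); apply: eq_bigr => k _.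
rewrite integralCZ; last by apply: continuousCM => //; exact: continuousC_pairing.
rewrite -/(fourier mu u (chi k)).
have [k1|/u0 ->] := eqVneq (char_norm (chi k)) 0%N; last by rewrite mulr0.
by rewrite pairing_char_norm0// mul1r.
Qed.

Lemma fourier_cst c chi : char_norm chi != 0%N -> fourier mu (fun=> c) chi = 0.
Proof.
move=> c0; rewrite /fourier integralCZ ?integralC_pairing ?mulr0//.
exact: continuousC_pairing.
Qed.

Lemma coset_continuous n theta : continuous (fun xi => (coset n theta xi)%:R : R).
Proof.
move=> xi P Pxi; apply/zpm_nbhsP; exists n => xi' E.
have E' : coset n theta xi' = coset n theta xi by apply: eq_forallb => j; rewrite E.
rewrite /preimage /= E'; exact: nbhs_singleton Pxi.
Qed.

Let wgt n theta := Rintegral mu setT (fun xi : Zpm => (coset n theta xi)%:R).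

Lemma integralC_real v : integralC mu (fun xi => (v xi)%:C) = (Rintegral mu setT v)%:C.
Proof.
rewrite /integralC /= Rintegral_cst//; first by rewrite mul0r.
Qed.

(** The case u = 1 of [integralC_coset]: its sum counts the k whose character is trivial, and there
    is at least one, so the weight is nonzero. *)
Lemma coset_weight n : exists2 c : R, 0 < c & forall theta, wgt n theta = c.
Proof.
have [c [T [chi [c0 [k0 k0P] cP]]]] := integralC_coset n.
have W theta : (wgt n theta)%:C = c * \sum_k fourier mu (fun=> 1) (chi k).
  rewrite -(cP (fun=> 1) theta (@continuousC_cst R p p_pr m 1) (fourier_cst 1)).
  rewrite /wgt -integralC_real; congr (integralC mu _).
  by apply: funext => xi; rewrite mul1r natrC.
have WE theta : wgt n theta = wgt n 0.
  by apply: complexI; rewrite !W.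
exists (wgt n 0) => //; rewrite lt_def Rintegral_ge0// andbT.
apply/eqP => w0; have := W 0; rewrite w0 => /esym/eqP.
rewrite mulf_eq0 (negbTE c0) /= (eq_bigr (fun k => (char_norm (chi k) == 0%N)%:R)).
  by rewrite -natr_sum pnatr_eq0 sum_nat_eq0 => /forallP/(_ k0); rewrite k0P eqxx.
move=> k _; have [k1|/(fourier_cst 1)//] := eqVneq (char_norm (chi k)) 0%N.
rewrite /fourier -[RHS](integralC_cst mu); congr integralC; apply: funext => xi.
by rewrite pairing_char_norm0 ?mulr1.
Qed.

Lemma coset_average v n theta e : continuous v ->
  (forall xi, coset n theta xi -> `|v xi - v theta| <= e) ->
  `|Rintegral mu setT (fun xi => v xi * (coset n theta xi)%:R) - v theta * wgt n theta|
    <= e * wgt n theta.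
Proof.
move=> cv ve; pose k xi : R := (coset n theta xi)%:R.
have ck : continuous k := @coset_continuous n theta.
have cM (w w' : Zpm -> R) : continuous w -> continuous w' -> continuous (fun xi => w xi * w' xi).
  by move=> w1 w2 x; exact: cvgM (w1 x) (w2 x).
have cc (r : R) : continuous ((fun=> r) : Zpm -> R) by move=> x; exact: (@cst_continuous Zpm R r x).
have cD : continuous (fun xi => v xi * k xi - v theta * k xi).
  by move=> x; exact: cvgB (cM _ _ cv ck x) (cM _ _ (cc _) ck x).
have cN : continuous (fun xi : Zpm => `|v xi * k xi - v theta * k xi|).
  by move=> x; exact: cvg_norm (cD x).
rewrite /wgt -!RintegralZl//; try by apply: continuous_zpm_integrable.
rewrite -RintegralB//; try by apply: continuous_zpm_integrable; exact: cM.
apply: (le_trans (le_normr_Rintegral _ _)) => //; first exact: continuous_zpm_integrable.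
apply: le_Rintegral => //.
- exact: continuous_zpm_integrable cN.
- by apply: continuous_zpm_integrable; exact: cM.
move=> xi _; rewrite -mulrBl normrM [`|k xi|]ger0_norm ?ler0n// /k.
have [/ve h|_] := boolP (coset n theta xi); first by rewrite !mulr1.
by rewrite !mulr0.
Qed.

Lemma coset_averages_constant v : continuous v ->
  (forall n theta, Rintegral mu setT (fun xi => v xi * (coset n theta xi)%:R) =
                   Rintegral mu setT (fun xi => v xi * (coset n 0 xi)%:R)) ->
  forall theta theta', v theta = v theta'.
Proof.
move=> cv vE theta theta'; apply/eqP; rewrite -subr_eq0 -normr_le0.
apply/ler_addgt0Pl => e e0; rewrite addr0.
have near_coset x : exists n, forall xi, coset n x xi -> `|v xi - v x| <= e / 2.
  have /zpm_nbhsP[n nP] : \forall y \near x, `|v x - v y| < e / 2.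
    by have /cvgr_dist_lt := cv x; apply; rewrite divr_gt0.
  by exists n => xi /cosetP/nP; rewrite distrC => /ltW.
have coset_le a b x xi : (a <= b)%N -> coset b x xi -> coset a x xi.
  move=> ab /cosetP H; apply/cosetP => j.
  by rewrite -(residue_mod _ ab) H residue_mod.
have [n nP] := near_coset theta; have [n' nP'] := near_coset theta'.
(* At the common finer level, v theta and v theta' are both within e / 2 of one and the same
   average. *)
have [c c0 cE] := coset_weight (maxn n n').
have h1 := coset_average cv (fun xi h => nP xi (coset_le _ _ _ _ (leq_maxl n n') h)).
have h2 := coset_average cv (fun xi h => nP' xi (coset_le _ _ _ _ (leq_maxr n n') h)).
rewrite !cE vE in h1; rewrite !cE vE in h2.
rewrite -(ler_pM2r c0) -[X in _ * X](gtr0_norm c0) -normrM mulrBl.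
move: h1 h2; set I := Rintegral _ _ _ => h1 h2.
rewrite distrC in h1.
have -> : v theta * c - v theta' * c = (v theta * c - I) + (I - v theta' * c) by ring.
apply: le_trans (ler_normD _ _) _; apply: le_trans (lerD h1 h2) _.
by rewrite -mulrDl -splitr.
Qed.

Lemma fourier_supported_at0 u : continuousC u ->
  (forall chi, char_norm chi != 0%N -> fourier mu u chi = 0) ->
  forall theta theta', u theta = u theta'.
Proof.
move=> cu u0 theta theta'.
have E n x : integralC mu (fun xi => u xi * (coset n x xi)%:R) =
    integralC mu (fun xi => u xi * (coset n 0 xi)%:R).
  have [c [T [chi [_ _ cP]]]] := integralC_coset n.
  by rewrite !cP.
have ReE x n : Rintegral mu setT (fun xi => complex.Re (u xi * (coset n x xi)%:R)) =
    Rintegral mu setT (fun xi => complex.Re (u xi) * (coset n x xi)%:R).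
  apply: eq_Rintegral => xi _; rewrite -natrC; case: (u xi) => a b /=.
  by rewrite mulr0 subr0.
have ImE x n : Rintegral mu setT (fun xi => complex.Im (u xi * (coset n x xi)%:R)) =
    Rintegral mu setT (fun xi => complex.Im (u xi) * (coset n x xi)%:R).
  apply: eq_Rintegral => xi _; rewrite -natrC; case: (u xi) => a b /=.
  by rewrite mulr0 add0r.
apply/eqP; rewrite eq_complex; apply/andP; split; apply/eqP.
  apply: (coset_averages_constant (v := fun xi => complex.Re (u xi)) cu.1) => n x.
  by rewrite -!ReE; have [+ _] := E n x.
apply: (coset_averages_constant (v := fun xi => complex.Im (u xi)) cu.2) => n x.
by rewrite -!ImE; have [_ +] := E n x.
Qed.

(** With the character chi itself as test function, orthonormality leaves the single term |chi|^2
    times the coefficient of u at chi, which therefore vanishes if chi is nontrivial. Conversely,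
    for constant u each term has a zero factor, the norm or the coefficient. *)
Lemma padic_laplacian_eq0 u : continuousC u ->
  (forall phi, locally_constant phi -> padic_laplacian mu u phi = 0) <->
  (forall theta theta', u theta = u theta').
Proof.
move=> cu; split=> [Du|uE phi _].
  apply: fourier_supported_at0 => // chi chi0.
  have := Du _ (@pairing_locally_constant R p p_pr m chi); rewrite /padic_laplacian.
  rewrite -(fsbig_widen [set chi] setT)//.
    rewrite fsbig_set1 pairing_orthonormal// eqxx mulr1 => /eqP.
    by rewrite mulf_eq0 sqrf_eq0 pnatr_eq0 (negbTE chi0) => /eqP.
  move=> chi' [_ /= cc']; rewrite /preimage /= pairing_orthonormal//.
  by case: eqVneq cc' => [->|_ _]; rewrite ?mulr0.
rewrite /padic_laplacian fsbig1// => chi _.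
have -> : u = fun=> u 0 by apply: funext => x; exact: uE.
have [->|/(fourier_cst (u 0)) ->] := eqVneq (char_norm chi) 0%N.
  by rewrite expr0n/= !mul0r.
by rewrite mulr0 mul0r.
Qed.

End FourierInversion.

Section TransverseLaplacian.
Variables (R : realType) (p : nat) (p_pr : prime p) (m : nat).
Local Notation C := (cline R).
Local Notation Zpm := (zpm p_pr m).

Lemma Re_continuous : continuous (@complex.Re R : C -> R).
Proof.
move=> z P /nbhs_ballP[/= e e0 eP]; apply/cline_nbhsP; exists e => // h he.
apply: eP; rewrite /ball /= distrC; apply: le_lt_trans he.
by apply: le_trans (Re_le_cabs h); case: z h => [a b] [c d] /=; rewrite addrAC subrr add0r.
Qed.

Lemma Im_continuous : continuous (@complex.Im R : C -> R).
Proof.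
move=> z P /nbhs_ballP[/= e e0 eP]; apply/cline_nbhsP; exists e => // h he.
apply: eP; rewrite /ball /= distrC; apply: le_lt_trans he.
by apply: le_trans (Im_le_cabs h); case: z h => [a b] [c d] /=; rewrite addrAC subrr add0r.
Qed.

Lemma slice_continuousC (f : C * Zpm -> C) z :
  (forall theta, {for (z, theta), continuous f}) ->
  continuousC (fun theta => f (z, theta)).
Proof.
move=> cf; have cz : continuous (fun theta : Zpm => f (z, theta)).
  move=> theta P /(cf theta)[[P1 P2] /= [zP1 tP2] PP].
  apply: filterS tP2 => theta' t'; apply: (PP (z, theta')); split=> //=.
  exact: nbhs_singleton zP1.
split=> theta.
  by move=> P /(Re_continuous (x := f (z, theta))) /(cz theta).
by move=> P /(Im_continuous (x := f (z, theta))) /(cz theta).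
Qed.

Lemma theta_independent_transverse_laplacian (mu : probability (borel_zpm p_pr m) R)
    (mu_haar : is_haar mu) (L : topologicalType) (N : nat)
    (A : 'I_N -> lchart R p_pr m L) w : continuous_form A w ->
  (forall i, theta_independent A i (w i)) <-> transverse_laplacian_eq0 A mu w.
Proof.
move=> cw.
have c1 i z : cdisc (A i) z -> continuousC (fun theta => (w i (z, theta)).1).
  move=> zi; apply: (@slice_continuousC (fun x => (w i x).1)) => theta.
  apply: (@continuous_comp _ _ _ (w i) fst); last exact: cvg_fst.
  by apply: cw; split.
have c2 i z : cdisc (A i) z -> continuousC (fun theta => (w i (z, theta)).2).
  move=> zi; apply: (@slice_continuousC (fun x => (w i x).2)) => theta.
  apply: (@continuous_comp _ _ _ (w i) snd); last exact: cvg_snd.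
  by apply: cw; split.
split=> [wi i z zi phi lphi|Dw i z theta theta' zi].
  split.
    by apply: (padic_laplacian_eq0 mu_haar (c1 i z zi)).2 => // t t'; rewrite (wi i z t t' zi).
  by apply: (padic_laplacian_eq0 mu_haar (c2 i z zi)).2 => // t t'; rewrite (wi i z t t' zi).
have H1 : (w i (z, theta)).1 = (w i (z, theta')).1.
  apply: (padic_laplacian_eq0 mu_haar (c1 i z zi)).1 => phi lphi.
  exact: (Dw i z zi phi lphi).1.
have H2 : (w i (z, theta)).2 = (w i (z, theta')).2.
  apply: (padic_laplacian_eq0 mu_haar (c2 i z zi)).1 => phi lphi.
  exact: (Dw i z zi phi lphi).2.
by move: H1 H2; case: (w i (z, theta)) (w i (z, theta')) => [a b] [c d] /= -> ->.
Qed.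

End TransverseLaplacian.

Theorem theorem3 (R : realType) (p : nat) (p_pr : prime p) (q : nat)
    (q_pow : exists s : nat, q = (p ^ s)%N) (q_gt1 : (1 < q)%N)
    (m : nat) (m_ge1 : (1 <= m)%N)
    (mu : probability (borel_zpm p_pr m) R) (mu_haar : is_haar mu)
    (L : topologicalType) (N : nat) (A : 'I_N -> lchart R p_pr m L)
    (act : int -> L -> L) (g : metric_family R p_pr m N)
    (psi : R -> R -> L -> L) :
  laminated A ->
  property_i A mu q act ->
  property_ii A q act g ->
  property_iii A mu q act psi ->
  (property_iv A g <->
     (forall w, harmonic_1form A g w -> transverse_laplacian_eq0 A mu w)) /\
  (property_iv A g ->
     exists genus : nat,
       has_real_dim A (real_harmonic_1form A g) (2 * genus)%N).
Proof.
move=> [L_compact A_atlas _] _ [g_kahler g_indep _] _; split.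
  split=> [piv w wH|H w wH].
    have [_ cw _ _] := wH.
    by apply/(theta_independent_transverse_laplacian mu_haar cw) => i; exact: piv.
  have [_ cw _ _] := wH.
  by apply/(theta_independent_transverse_laplacian mu_haar cw); exact: H.
by move=> piv; exact: (real_harmonic_dim A_atlas g_kahler L_compact g_indep piv).
Qed.
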